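(* There is a discrete infinite sequence of ground state solutions of the equation $$u''+\frac{2}{r}u'+u^4+u^7=0,\qquad u'(0)=0,$$ whose maximal values $u(0)$ are distinct, different from $2$, and tend to $2$ from both above and below (i.e. the sequence of values $u(0)$ converges to $2$, with infinitely many of them greater than $2$ and infinitely many less than $2$). These ground states separate an infinite sequence of solution curves of the Dirichlet problem $$u''+\frac{2}{r}u'+\lambda\,(u^4+u^7)=0 \ \text{ for } 0<r<1,\qquad u'(0)=0,\quad u(1)=0,$$ that is, between values $u(0)$ of this sequence that are adjacent on the same side of $2$ there lie values of $u(0)$ belonging to a solution curve of the Dirichlet problem, and there are infinitely many distinct such solution curves. Moreover, for $u(0)$ large, all positive solutions of the Dirichlet problem lie on a unique solution curve: there is $A>0$ such that all positive solutions of the Dirichlet problem with $u(0)>A$ lie on one solution curve.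
   Context: A ground state is a solution $u\in C^2([0,\infty))$ of $u''+\frac{2}{r}u'+u^4+u^7=0$, $u'(0)=0$, with $u(r)>0$ for all $r\ge0$, decreasing, and $u(r)\to0$ as $r\to\infty$; its maximal value is $u(0)$. (The function $u(r)=2(36r^2+1)^{-1/3}$ is a ground state with $u(0)=2$.) A positive solution of the Dirichlet problem is a pair $(\lambda,u)$ with $\lambda>0$, $u\in C^2([0,1])$, $u>0$ on $[0,1)$, satisfying the equation and boundary conditions. The value $u(0)$ uniquely identifies $(\lambda,u)$, and a given $\alpha>0$ is the value $u(0)$ of a positive Dirichlet solution if and only if the solution of $u''+\frac2r u'+u^4+u^7=0$, $u(0)=\alpha$, $u'(0)=0$ has a (finite) first root $\omega$, in which case $\lambda=\omega^2$; otherwise that solution is a ground state. A solution curve is a maximal connected subset of the set of all points $(\lambda,u(0))$ in the plane arising from positive solutions of the Dirichlet problem. *)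

(* Defs.v *)
From Stdlib Require Import Reals.
From Coquelicot Require Import Coquelicot.
Open Scope R_scope.

(* [u] is C^2 relative to the set [D], with first and second derivatives [u1]
   and [u2].  Derivatives and continuity are relative to [D], hence one-sided at
   the end points of an interval; values of [u] outside [D] are irrelevant. *)
Definition C2_on (D : R -> Prop) (u u1 u2 : R -> R) : Prop :=
  forall r, D r -> D_in u u1 D r /\ D_in u1 u2 D r /\ continue_in u2 D r.

Definition ground_state (u : R -> R) : Prop :=
  exists u1 u2 : R -> R,
    C2_on (fun r => 0 <= r) u u1 u2 /\
    (forall r, 0 < r -> u2 r + 2 / r * u1 r + u r ^ 4 + u r ^ 7 = 0) /\
    u1 0 = 0 /\
    (forall r, 0 <= r -> 0 < u r) /\
    (forall r s, 0 <= r -> r < s -> u s < u r) /\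
    is_lim u p_infty 0.

Definition positive_dirichlet_solution (lam : R) (u : R -> R) : Prop :=
  0 < lam /\
  exists u1 u2 : R -> R,
    C2_on (fun r => 0 <= r <= 1) u u1 u2 /\
    (forall r, 0 < r < 1 ->
       u2 r + 2 / r * u1 r + lam * (u r ^ 4 + u r ^ 7) = 0) /\
    u1 0 = 0 /\ u 1 = 0 /\
    (forall r, 0 <= r < 1 -> 0 < u r).

Definition dirichlet_points (p : R * R) : Prop :=
  exists u : R -> R, positive_dirichlet_solution (fst p) u /\ snd p = u 0.

(* Coquelicot's [is_connected] only concerns subsets of the line. *)
Definition connected {T : UniformSpace} (S : T -> Prop) : Prop :=
  forall U V : T -> Prop,
    open U -> open V ->
    (forall p, S p -> U p \/ V p) ->
    (exists p, S p /\ U p) -> (exists p, S p /\ V p) ->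
    exists p, S p /\ U p /\ V p.

Definition solution_curve (C : R * R -> Prop) : Prop :=
  (forall p, C p -> dirichlet_points p) /\
  connected C /\
  (forall C' : R * R -> Prop,
     (forall p, C' p -> dirichlet_points p) -> connected C' ->
     (forall p, C p -> C' p) -> forall p, C' p -> C p).

(* [a i < a j] are consecutive values of the sequence [a], on the same side
   of 2. *)
Definition adjacent (a : nat -> R) (i j : nat) : Prop :=
  a i < a j /\ (a j < 2 \/ 2 < a i) /\ (forall k, ~ (a i < a k < a j)).

Definition curve_meets_gap (C : R * R -> Prop) (a : nat -> R) (i j : nat) : Prop :=
  exists p, C p /\ a i < snd p < a j.

(* Main.v *)
(* Near [u 0 = 2].  Let [u] be the solution with [u 0 = a], let [w] be the explicit one, with
   [w 0 = 2], and put [h = r (u - w)], so that [h'' + q h = 0] for a divided difference [q] of the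
   nonlinearity.  Since [4 w^3] is at least [(8/9) / (1 + r)^2], whose constant exceeds 1/4, the
   number of zeros of [h] tends to infinity as [a] tends to 2; it is measured by a Pruefer angle,
   which depends continuously on [a], also at [a = 2].  For a single [a <> 2] the number of zeros
   is finite: otherwise the Fowler variable [v = r^(2/3) u] of a ground state would settle at the
   level of [w], at rate [1/r], whereas the amplitude [h'^2/q + h^2] is nondecreasing because [u]
   and [w] decrease.  Hence, for each large [k], moving [a] away from 2 one meets a first value at
   which the k-th zero is lost.  Zeros cannot be lost at the end point of a Dirichlet solution, so
   that value is a ground state; there [v] becomes small, and a nearby solution that still has its
   k-th zero must climb back to [w], gaining enough energy to exclude a ground state.  So ground
   states and Dirichlet solutions alternate on both sides of 2.

   Large [u 0].  In the variables adapted to [u^7] a Lyapunov function brings every ground state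
   with [u 0] large close to the singular solution at a fixed small radius.  A polynomial
   approximation of [u^-3] with a small residual and an energy estimate follow it up to
   [r = 5 sqrt 2], where Pohozaev's functional is already too large for a ground state.  Hence all
   large [u 0] belong to Dirichlet solutions, whose first zero depends continuously on [u 0]. *)

Require Import Defs.
From Stdlib Require Import Reals Lra Lia ClassicalEpsilon.
From Coquelicot Require Import Coquelicot.
Open Scope R_scope.

(** * Calculus on the real line *)

(** In dimension three the critical exponent is 5, so [u^4] is subcritical and [u^7] supercritical.
    In the scale-invariant variables of [u^4] the equation has negative damping and the energy
    grows; in those of [u^7] the damping is positive and solutions are drawn to the singular one.
    The first fact governs large radii and the analysis near 2, the second small radii and large
    initial values. The proof uses no uniqueness or monotonicity of the ground states in [u 0] and
    never counts them: near 2 it produces, arbitrarily close and on each side, one value of a ground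
    state and one value that is not, and selects alternating sequences from these. For large [u 0]
    the obstacle is that small radii decide nothing, since [u^7] alone has a positive decaying
    solution from every initial value. Only the [u^4] term, at radii of order one, decides, so the
    solutions must be followed there with explicit error bounds; this is the origin of most
    numerical constants. *)

Lemma cont_plus (f g : R -> R) x :
  continuous f x -> continuous g x -> continuous (fun t => f t + g t) x.
Proof. intros hf hg. now apply (continuous_plus f g). Qed.

Lemma cont_minus (f g : R -> R) x :
  continuous f x -> continuous g x -> continuous (fun t => f t - g t) x.
Proof. intros hf hg. now apply (continuous_minus f g). Qed.

Lemma cont_opp (f : R -> R) x : continuous f x -> continuous (fun t => - f t) x.
Proof. intros hf. now apply (continuous_opp f). Qed.

Lemma cont_mult (f g : R -> R) x :
  continuous f x -> continuous g x -> continuous (fun t => f t * g t) x.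
Proof. intros hf hg. now apply (continuous_mult f g). Qed.

Lemma cont_pow (f : R -> R) n x : continuous f x -> continuous (fun t => f t ^ n) x.
Proof.
  intros hf. apply (continuous_comp f (fun z => z ^ n)); [assumption|].
  apply (ex_derive_continuous (fun z => z ^ n)). auto_derive; trivial.
Qed.

Lemma cont_sin (f : R -> R) x : continuous f x -> continuous (fun t => sin (f t)) x.
Proof. intros hf. apply (continuous_comp f sin); [assumption|apply continuous_sin]. Qed.

Lemma cont_cos (f : R -> R) x : continuous f x -> continuous (fun t => cos (f t)) x.
Proof. intros hf. apply (continuous_comp f cos); [assumption|apply continuous_cos]. Qed.

Ltac cont := unfold Rdiv; repeat match goal with
  | |- continuous (fun _ => ?c) _ => apply continuous_const
  | |- continuous (fun t => t) _ => apply continuous_id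
  | |- continuous (fun t => @?f t + @?g t) ?x => apply (cont_plus f g x)
  | |- continuous (fun t => @?f t - @?g t) ?x => apply (cont_minus f g x)
  | |- continuous (fun t => @?f t * @?g t) ?x => apply (cont_mult f g x)
  | |- continuous (fun t => - @?f t) ?x => apply (cont_opp f x)
  | |- continuous (fun t => (@?f t) ^ ?n) ?x => apply (cont_pow f n x)
  | |- continuous (fun t => sin (@?f t)) ?x => apply (cont_sin f x)
  | |- continuous (fun t => cos (@?f t)) ?x => apply (cont_cos f x)
  end; try assumption.

(** [auto_derive] leaves [Derive f x] for functions known only through hypotheses [is_derive]; these
    hypotheses supply both the differentiability conditions and the values. *)
Ltac derive_values := repeat match goal with
  | H : is_derive ?f ?x ?l |- _ =>
      replace (Derive (fun y => f y) x) with l by (symmetry; apply is_derive_unique; exact H);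
      clear H
  end.
Ltac derive_hyps := auto_derive;
  [ repeat split; try (eexists; eassumption); try lra | derive_values ].

Lemma exp_third_cube z : exp (z / 3) ^ 3 = exp z.
Proof.
  replace (exp (z / 3) ^ 3) with (exp (z / 3) * (exp (z / 3) * exp (z / 3))) by ring.
  rewrite <- !exp_plus. f_equal. field.
Qed.

Lemma Rabs_le_of_sq x c : 0 <= c -> x ^ 2 <= c ^ 2 -> Rabs x <= c.
Proof.
  intros hc h. apply Rnot_lt_le. intros hlt. rewrite <- (pow2_abs x) in h. simpl in h. nra.
Qed.

Lemma exists_multiple_PI c : exists k : Z, c < IZR k * PI.
Proof.
  exists (up (c / PI)). assert (h := archimed (c / PI)). assert (hpi := PI_RGT_0).
  apply Rlt_div_l; [assumption|]. lra.
Qed.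

(** The derivative is required only inside the interval, because the radial equation is singular at
    [r = 0]. *)
Lemma mvt_open (f f' : R -> R) (a b : R) :
  a < b -> (forall x, a <= x <= b -> continuous f x) ->
  (forall x, a < x < b -> is_derive f x (f' x)) ->
  exists c, a < c < b /\ f b - f a = f' c * (b - a).
Proof.
  intros hab hc hd.
  assert (pr1 : forall c, a < c < b -> derivable_pt f c).
  { intros c h. apply ex_derive_Reals_0. exists (f' c). now apply hd. }
  assert (pr2 : forall c, a < c < b -> derivable_pt id c)
    by (intros; apply derivable_pt_id).
  destruct (MVT f id a b pr1 pr2 hab) as (c & P & h).
  - intros c h. apply continuity_pt_filterlim. now apply hc.
  - intros; apply derivable_continuous_pt, derivable_pt_id.
  - exists c. split; [exact P|].
    rewrite (derive_pt_eq_0 f c (f' c) (pr1 c P)) in h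
      by (apply is_derive_Reals; now apply hd).
    replace (derive_pt id c (pr2 c P)) with 1 in h
      by (symmetry; apply derive_pt_eq_0, derivable_pt_lim_id).
    unfold id in h. lra.
Qed.

Lemma derive_nonneg_le (f f' : R -> R) (a b : R) :
  a <= b -> (forall x, a <= x <= b -> continuous f x) ->
  (forall x, a < x < b -> is_derive f x (f' x)) ->
  (forall x, a < x < b -> 0 <= f' x) -> f a <= f b.
Proof.
  intros hab hc hd h0. destruct (Req_dec a b) as [->|hn]; [lra|].
  destruct (mvt_open f f' a b) as (c & hcc & e); try assumption; [lra|].
  specialize (h0 c hcc). nra.
Qed.

Lemma derive_nonneg_le' (f f' : R -> R) (a b : R) :
  a <= b -> (forall x, a <= x <= b -> is_derive f x (f' x)) ->
  (forall x, a <= x <= b -> 0 <= f' x) -> f a <= f b.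
Proof.
  intros hab hd h0. apply derive_nonneg_le with f'; try assumption.
  - intros x hx. apply (ex_derive_continuous f). exists (f' x). now apply hd.
  - intros; apply hd; lra.
  - intros; apply h0; lra.
Qed.

Lemma continuous_bound_below (y : R -> R) (x c : R) :
  continuous y x -> c < y x ->
  exists d, 0 < d /\ forall t, Rabs (t - x) < d -> c < y t.
Proof.
  intros hc h.
  destruct (hc (fun z => c < z)) as [d hd].
  - exists (mkposreal (y x - c) (proj2 (Rlt_0_minus _ _) h)). simpl. intros z hz.
    unfold ball in hz; simpl in hz; unfold AbsRing_ball, abs, minus, plus, opp in hz; simpl in hz.
    apply Rabs_def2 in hz. lra.
  - exists d. split; [apply cond_pos|]. intros t ht. apply hd. exact ht.
Qed.

Lemma continuous_bound_above (y : R -> R) (x c : R) :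
  continuous y x -> y x < c ->
  exists d, 0 < d /\ forall t, Rabs (t - x) < d -> y t < c.
Proof.
  intros hc h.
  destruct (continuous_bound_below (fun t => - y t) x (- c)) as (d & hd & hh).
  - apply (continuous_opp y x hc).
  - lra.
  - exists d. split; [lra|]. intros t ht. specialize (hh t ht). lra.
Qed.

Lemma continuous_near (y : R -> R) (x eps : R) :
  continuous y x -> 0 < eps ->
  exists d, 0 < d /\ forall t, Rabs (t - x) < d -> y x - eps < y t < y x + eps.
Proof.
  intros hc he.
  destruct (continuous_bound_below y x (y x - eps) hc) as (d1 & h1 & k1); [lra|].
  destruct (continuous_bound_above y x (y x + eps) hc) as (d2 & h2 & k2); [lra|].
  exists (Rmin d1 d2). split; [now apply Rmin_glb_lt|]. intros t ht.
  assert (m1 := Rmin_l d1 d2). assert (m2 := Rmin_r d1 d2).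
  split; [apply k1|apply k2]; lra.
Qed.

Lemma le_of_left (f : R -> R) (p x c : R) :
  p < x -> continuous f x -> (forall t, p < t < x -> f t <= c) -> f x <= c.
Proof.
  intros hp hc h. apply Rnot_lt_le. intros hlt.
  destruct (continuous_bound_below f x c hc hlt) as (d & hd & hh).
  assert (m1 := Rmax_l p (x - d)). assert (m2 := Rmax_r p (x - d)).
  assert (m3 : Rmax p (x - d) < x) by (apply Rmax_lub_lt; lra).
  set (t := (Rmax p (x - d) + x) / 2).
  assert (k1 := h t ltac:(unfold t; lra)).
  assert (k2 := hh t ltac:(unfold t; apply Rabs_def1; lra)). lra.
Qed.

Lemma first_zero (y : R -> R) (a b : R) :
  a <= b -> (forall x, a <= x <= b -> continuous y x) -> 0 < y a -> y b <= 0 ->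
  exists s, a < s <= b /\ y s = 0 /\ forall t, a <= t < s -> 0 < y t.
Proof.
  intros hab hc ha hb.
  set (E := fun t => a <= t <= b /\ forall u, a <= u <= t -> 0 < y u).
  assert (hE : E a).
  { split; [lra|]. intros u hu. replace u with a by lra. exact ha. }
  destruct (completeness E) as [s [hub hlub]].
  { exists b. intros t [ht _]. lra. }
  { exists a. exact hE. }
  assert (has : a <= s) by (apply hub; exact hE).
  assert (hsb : s <= b) by (apply hlub; intros t [ht _]; lra).
  assert (hpos : forall t, a <= t < s -> 0 < y t).
  { intros t ht. destruct (Rlt_dec 0 (y t)) as [|hn]; [assumption|exfalso].
    assert (s <= t); [|lra]. apply hlub. intros u [hu hu'].
    destruct (Rle_dec u t); [assumption|]. exfalso. apply hn, hu'. lra. }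
  assert (h0 : y s = 0).
  { destruct (Rtotal_order (y s) 0) as [h|[h|h]]; [exfalso|exact h|exfalso].
    - destruct (continuous_bound_above y s 0) as (d & hd & hh); [apply hc; lra|exact h|].
      destruct (Req_dec s a) as [e|n]; [rewrite e in h; lra|].
      specialize (hh (Rmax a (s - d / 2))). specialize (hpos (Rmax a (s - d / 2))).
      assert (hm : a <= Rmax a (s - d/2) < s /\ s - d / 2 <= Rmax a (s - d/2)).
      { split; [split|]; [apply Rmax_l| apply Rmax_lub_lt; lra|apply Rmax_r]. }
      destruct hm as [hm hm'].
      assert (y (Rmax a (s - d / 2)) < 0) by (apply hh; apply Rabs_def1; lra).
      specialize (hpos hm). lra.
    - destruct (continuous_bound_below y s 0) as (d & hd & hh); [apply hc; lra|exact h|].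
      destruct (Req_dec s b) as [e|n]; [rewrite e in h; lra|].
      assert (hm := Rmin_l b (s + d / 2)). assert (hm' := Rmin_r b (s + d / 2)).
      assert (hm2 : s < Rmin b (s + d / 2)) by (apply Rmin_glb_lt; lra).
      assert (E (Rmin b (s + d / 2))).
      { split; [lra|]. intros u hu.
        destruct (Rlt_dec u s); [apply hpos; lra|]. apply hh. apply Rabs_def1; lra. }
      specialize (hub _ H). lra. }
  exists s. repeat split; try assumption.
  destruct (Req_dec a s) as [e|n]; [rewrite e in ha; lra|lra].
Qed.

Lemma derive_right_pos (y : R -> R) (x l : R) :
  is_derive y x l -> 0 < l ->
  exists d, 0 < d /\ (forall t, x < t < x + d -> y x < y t) /\
    (forall t, x - d < t < x -> y t < y x).
Proof.
  intros hd hl. apply is_derive_Reals in hd.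
  destruct (hd (l / 2)) as [d h]; [lra|].
  exists d. split; [apply cond_pos|].
  split; intros t ht.
  - specialize (h (t - x)). replace (x + (t - x)) with t in h by ring.
    assert (h' : Rabs ((y t - y x) / (t - x) - l) < l / 2).
    { apply h; [lra|]. apply Rabs_def1; lra. }
    apply Rabs_def2 in h'.
    assert (0 < (y t - y x) / (t - x)) by lra.
    assert (y t - y x = (y t - y x) / (t - x) * (t - x)) by (field; lra). nra.
  - specialize (h (t - x)). replace (x + (t - x)) with t in h by ring.
    assert (h' : Rabs ((y t - y x) / (t - x) - l) < l / 2).
    { apply h; [lra|]. apply Rabs_def1; lra. }
    apply Rabs_def2 in h'.
    assert (0 < (y t - y x) / (t - x)) by lra.
    assert (y t - y x = (y t - y x) / (t - x) * (t - x)) by (field; lra). nra.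
Qed.

(** At its first zero the function would come down from positive values, which a positive derivative
    forbids. Differential inequalities thus have to be examined only at points where the barrier is
    touched. *)
Lemma barrier (y : R -> R) (a b : R) :
  (forall x, a <= x <= b -> continuous y x) ->
  (forall x, a <= x <= b -> y x = 0 -> exists l, 0 < l /\ is_derive y x l) ->
  0 <= y a -> forall x, a < x <= b -> 0 < y x.
Proof.
  intros hc hd ha x hx.
  destruct (Rlt_dec 0 (y x)) as [|hn]; [assumption|exfalso].
  assert (exists a', a <= a' < x /\ 0 < y a') as (a' & ha' & hp).
  { destruct (Rle_lt_or_eq_dec _ _ ha) as [h|h]; [exists a; lra|].
    destruct (hd a) as (l & hl & hdl); [lra|lra|].
    destruct (derive_right_pos _ _ _ hdl hl) as (d & hd0 & h1 & _).
    assert (hm := Rmin_l (a + d/2) ((a + x) / 2)). assert (hm' := Rmin_r (a + d/2) ((a + x) / 2)).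
    assert (a < Rmin (a + d / 2) ((a + x) / 2)) by (apply Rmin_glb_lt; lra).
    exists (Rmin (a + d / 2) ((a + x) / 2)). split; [lra|]. rewrite h. apply h1. lra. }
  destruct (first_zero y a' x) as (s & hs & h0 & hpos); try lra.
  { intros; apply hc; lra. }
  destruct (hd s) as (l & hl & hdl); [lra|assumption|].
  destruct (derive_right_pos _ _ _ hdl hl) as (d & hd0 & _ & h2).
  assert (hm := Rmax_l a' (s - d/2)). assert (hm' := Rmax_r a' (s - d/2)).
  assert (Rmax a' (s - d / 2) < s) by (apply Rmax_lub_lt; lra).
  assert (y (Rmax a' (s - d/2)) < y s) by (apply h2; lra).
  assert (0 < y (Rmax a' (s - d/2))) by (apply hpos; lra). lra.
Qed.

Lemma crossing (g : R -> R) (a b c1 c2 : R) :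
  a <= b -> (forall x, a <= x <= b -> continuous g x) ->
  g a <= c1 -> c1 < c2 -> c2 <= g b ->
  exists t1 t2, a <= t1 < t2 /\ t2 <= b /\ g t1 = c1 /\ g t2 = c2 /\
    forall t, t1 <= t <= t2 -> c1 <= g t <= c2.
Proof.
  intros hab hc h1 h12 h2.
  destruct (first_zero (fun t => c2 - g t) a b) as (t2 & ht2 & e2 & hp2); try lra.
  { intros x hx. apply (continuous_minus (fun _ => c2) g); [apply continuous_const|now apply hc]. }
  (* Reversing time on [[a, t2]] turns the last passage through [c1] into a first zero. *)
  destruct (first_zero (fun t => g (t2 + a - t) - c1) a t2) as (s & hs & e1 & hp1); try lra.
  { intros x hx.
    apply (continuous_minus (fun t => g (t2 + a - t)) (fun _ => c1)); [|apply continuous_const].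
    apply (continuous_comp (fun t => t2 + a - t) g); [|apply hc; lra].
    apply (ex_derive_continuous (fun t => t2 + a - t)). auto_derive; trivial. }
  { replace (t2 + a - a) with t2 by ring. lra. }
  { replace (t2 + a - t2) with a by ring. lra. }
  exists (t2 + a - s), t2. repeat split; try lra.
  - destruct (Req_dec t (t2 + a - s)) as [->|n]; [lra|].
    assert (h := hp1 (t2 + a - t)). replace (t2 + a - (t2 + a - t)) with t in h by ring.
    assert (0 < g t - c1) by (apply h; lra). lra.
  - destruct (Req_dec t t2) as [->|n]; [lra|].
    assert (0 < c2 - g t) by (apply hp2; lra). lra.
Qed.

(** The product of [N] with [exp (- K r)] is nonincreasing. The initial bound is only a limiting one
    at 0, where the equations in use are singular. *)
Lemma gronwall (N N' : R -> R) (R0 K c : R) :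
  0 <= K -> 0 <= c ->
  (forall r, 0 < r < R0 -> is_derive N r (N' r)) ->
  (forall r, 0 < r < R0 -> N' r <= K * N r) ->
  (forall eps, 0 < eps -> exists d, 0 < d /\ forall r, 0 < r < d -> N r <= c + eps) ->
  forall r, 0 < r < R0 -> N r <= c * exp (K * r).
Proof.
  intros hK hc hd hle h0 r hr.
  assert (hh : N r * exp (- K * r) <= c).
  { apply Rnot_lt_le. intros hlt.
    set (eps := (N r * exp (- K * r) - c) / 2).
    destruct (h0 eps) as (d & hd0 & hN); [unfold eps; lra|].
    assert (hm := Rmin_l (r / 2) (d / 2)). assert (hm' := Rmin_r (r / 2) (d / 2)).
    set (p := Rmin (r / 2) (d / 2)) in *.
    assert (hp : 0 < p) by (apply Rmin_glb_lt; lra).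
    assert (hmon : - (N p * exp (- K * p)) <= - (N r * exp (- K * r))).
    { apply (derive_nonneg_le' (fun t => - (N t * exp (- K * t)))
        (fun t => (K * N t - N' t) * exp (- K * t))); [lra| |].
      - intros x hx. specialize (hd x). assert (hx' : 0 < x < R0) by lra. specialize (hd hx').
        auto_derive; [exists (N' x); exact hd|].
        replace (Derive (fun x0 => N x0) x) with (N' x)
          by (symmetry; now apply is_derive_unique).
        ring.
      - intros x hx. specialize (hle x). apply Rmult_le_pos; [lra|]. left; apply exp_pos. }
    assert (hN' : N p <= c + eps) by (apply hN; lra).
    assert (he : exp (- K * p) <= 1).
    { rewrite <- exp_0. destruct (Rle_lt_or_eq_dec (- K * p) 0) as [h|h]; [nra| |].
      - left. now apply exp_increasing.
      - rewrite h. lra. }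
    assert (hep : 0 < exp (- K * p)) by apply exp_pos.
    assert (heps : 0 < eps) by (unfold eps; lra).
    assert (N p * exp (- K * p) <= c + eps).
    { destruct (Rle_dec 0 (N p)); nra. }
    unfold eps in *. lra. }
  assert (he : exp (- K * r) * exp (K * r) = 1).
  { rewrite <- exp_plus. replace (- K * r + K * r) with 0 by ring. apply exp_0. }
  assert (hep : 0 < exp (K * r)) by apply exp_pos.
  replace (N r) with (N r * exp (- K * r) * exp (K * r)) by (rewrite Rmult_assoc, he; ring).
  apply Rmult_le_compat_r; lra.
Qed.

Lemma zero_of_linear (W W' : R -> R) (R0 K : R) :
  0 <= K ->
  (forall r, 0 < r < R0 -> is_derive W r (W' r)) ->
  (forall r, 0 < r < R0 -> Rabs (W' r) <= K * Rabs (W r)) ->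
  continuous W 0 -> W 0 = 0 -> forall r, 0 < r < R0 -> W r = 0.
Proof.
  intros hK hd hle hc h0 r hr.
  assert (h : W r ^ 2 <= 0 * exp (2 * K * r)).
  { apply (gronwall (fun t => W t ^ 2) (fun t => 2 * W t * W' t) R0); try lra.
    - intros t ht. specialize (hd t ht). auto_derive; [exists (W' t); exact hd|].
      replace (Derive (fun x0 => W x0) t) with (W' t)
        by (symmetry; now apply is_derive_unique). ring.
    - intros t ht. specialize (hle t ht).
      assert (h1 : W t * W' t <= Rabs (W t) * Rabs (W' t))
        by (rewrite <- Rabs_mult; apply Rle_abs).
      assert (h2 : Rabs (W t) * Rabs (W t) = W t ^ 2)
        by (rewrite <- Rabs_mult, Rabs_pos_eq; nra).
      assert (h3 := Rabs_pos (W t)). nra.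
    - intros eps he.
      assert (hc2 : continuous (fun t => W t ^ 2) 0).
      { cont. }
      destruct (continuous_bound_above (fun t => W t ^ 2) 0 eps hc2) as (d & hd0 & hh).
      { rewrite h0. lra. }
      exists d. split; [lra|]. intros t ht.
      assert (W t ^ 2 < eps); [|lra]. apply hh. apply Rabs_def1; lra. }
  nra.
Qed.

(** * Picard iteration for causal operators on the half-line *)

Section Picard.

Variable T : (R -> R) -> R -> R.
Hypothesis T_cont : forall y, (forall r, continuous y r) -> forall r, continuous (T y) r.
Hypothesis T_neg : forall y r, r <= 0 -> T y r = T (fun _ => 0) 0.
Hypothesis T_lip : forall X, 0 < X -> exists L, 0 <= L /\ forall y z, (forall r, continuous y r) ->
  (forall r, continuous z r) ->
  forall r, 0 <= r <= X -> Rabs (T y r - T z r) <= L * RInt (fun s => Rabs (y s - z s)) 0 r.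

Fixpoint picard_seq (n : nat) : R -> R :=
  match n with O => fun _ => 0 | S m => T (picard_seq m) end.

Lemma picard_seq_cont n r : continuous (picard_seq n) r.
Proof.
  revert r. induction n as [|n IH]; intros r; simpl.
  - apply continuous_const.
  - now apply T_cont.
Qed.

Lemma continuous_Rabs_minus (y z : R -> R) (r : R) :
  continuous y r -> continuous z r -> continuous (fun s => Rabs (y s - z s)) r.
Proof.
  intros hy hz. apply (continuous_comp (fun s => y s - z s) Rabs).
  - now apply (continuous_minus y z).
  - apply continuous_Rabs.
Qed.

Lemma RInt_monomial (c : R) (n : nat) (r : R) :
  is_RInt (fun s => c * s ^ n) 0 r (c * (r ^ S n / INR (S n))).
Proof.
  assert (hn : INR (S n) <> 0) by (apply not_0_INR; lia).
  replace (c * (r ^ S n / INR (S n)))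
    with (minus (c * (r ^ S n / INR (S n))) (c * (0 ^ S n / INR (S n)))).
  2: { unfold minus, plus, opp; simpl. field. exact hn. }
  apply (is_RInt_derive (fun s => c * (s ^ S n / INR (S n)))).
  - intros x _. auto_derive; trivial.
    replace (Nat.pred (S n)) with n by reflexivity. field. exact hn.
  - intros x _. apply (ex_derive_continuous (fun s => c * s ^ n)). auto_derive; trivial.
Qed.

(** The causal Lipschitz bound integrates the previous estimate, so the differences of the iterates
    are dominated by the terms of an exponential series. *)
Lemma picard_step (X : R) : 0 < X -> exists B L, 0 <= B /\ 0 <= L /\ forall n r, 0 <= r <= X ->
    Rabs (picard_seq (S n) r - picard_seq n r) <= B * ((L * r) ^ n / INR (Factorial.fact n)).
Proof.
  intros hX. destruct (T_lip X hX) as (L & hL & hlip).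
  assert (hb : exists B, forall r, 0 <= r <= X -> Rabs (picard_seq 1 r) <= B).
  { destruct (continuity_ab_maj (fun r => Rabs (picard_seq 1 r)) 0 X) as (m & hm & _); [lra| |].
    - intros c _. apply continuity_pt_filterlim.
      apply (continuous_comp (picard_seq 1) Rabs); [apply picard_seq_cont|apply continuous_Rabs].
    - exists (Rabs (picard_seq 1 m)). exact hm. }
  destruct hb as [B hB].
  assert (hB0 : 0 <= B).
  { apply Rle_trans with (Rabs (picard_seq 1 0)); [apply Rabs_pos|apply hB; lra]. }
  exists B, L. repeat split; try assumption.
  induction n as [|n IH]; intros r hr.
  - simpl pow. simpl Factorial.fact. simpl INR. replace (picard_seq 0 r) with 0 by reflexivity.
    rewrite Rminus_0_r. replace (B * (1 / 1)) with B by field. now apply hB.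
  - apply Rle_trans with
      (L * RInt (fun s => Rabs (picard_seq (S n) s - picard_seq n s)) 0 r).
    { apply (hlip (picard_seq (S n)) (picard_seq n)); try exact hr; intros; apply picard_seq_cont. }
    assert (hI := RInt_monomial (B * L ^ n / INR (Factorial.fact n)) n r).
    replace (B * ((L * r) ^ S n / INR (Factorial.fact (S n))))
      with (L * (B * L ^ n / INR (Factorial.fact n) * (r ^ S n / INR (S n)))).
    2: { rewrite fact_simpl, mult_INR, Rpow_mult_distr. simpl pow. field.
         split; [apply INR_fact_neq_0|apply not_0_INR; lia]. }
    apply Rmult_le_compat_l; [assumption|].
    rewrite <- (is_RInt_unique _ _ _ _ hI). apply RInt_le; [lra| | |].
    + apply (ex_RInt_continuous (V := R_CompleteNormedModule)). intros z _.
      apply continuous_Rabs_minus; apply picard_seq_cont.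
    + eexists; exact hI.
    + intros x hx. replace (B * L ^ n / INR (Factorial.fact n) * x ^ n)
        with (B * ((L * x) ^ n / INR (Factorial.fact n))).
      * apply IH. lra.
      * rewrite Rpow_mult_distr. field. apply INR_fact_neq_0.
Qed.

Lemma ex_series_exp_terms (B x : R) : ex_series (fun n => B * (x ^ n / INR (Factorial.fact n))).
Proof.
  apply (ex_series_scal B (fun n => x ^ n / INR (Factorial.fact n))).
  apply ex_series_ext with (fun n => scal (pow_n x n) (/ INR (Factorial.fact n))).
  - intros n. rewrite pow_n_pow. reflexivity.
  - eexists. apply is_exp_Reals.
Qed.

Definition picard_lim (r : R) : R := real (Lim_seq (fun n => picard_seq n r)).

(** The error is a tail of the exponential series. The index starts at [S n] because every iterate
    but the zeroth takes the common value [T (fun _ => 0) 0] on negative arguments. *)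
Lemma picard_uniform (X : R) : 0 < X -> exists e : nat -> R,
  is_lim_seq e 0 /\ forall n r, r <= X -> Rabs (picard_lim r - picard_seq (S n) r) <= e n.
Proof.
  intros hX. destruct (picard_step X hX) as (B & L & hB & hL & hst).
  set (a := fun n => B * ((L * X) ^ n / INR (Factorial.fact n))).
  assert (ha0 : forall n, 0 <= a n).
  { intros n. unfold a. apply Rmult_le_pos; [assumption|].
    apply Rdiv_le_0_compat; [apply pow_le; nra|apply INR_fact_lt_0]. }
  assert (ha : ex_series a) by apply ex_series_exp_terms.
  exists (fun n => Series (fun k => a (n + k)%nat)).
  assert (hstep : forall n r, r <= X ->
    Rabs (picard_seq (S (S n)) r - picard_seq (S n) r) <= a (S n)).
  { intros n r hr. destruct (Rle_dec r 0) as [h|h].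
    - simpl. rewrite (T_neg (T (picard_seq n))), (T_neg (picard_seq n)) by assumption.
      rewrite Rminus_diag, Rabs_R0. apply ha0.
    - eapply Rle_trans; [apply hst; lra|]. unfold a.
      apply Rmult_le_compat_l; [assumption|]. apply Rmult_le_compat_r.
      + left. apply Rinv_0_lt_compat, INR_fact_lt_0.
      + apply pow_incr. split; [nra|]. apply Rmult_le_compat_l; lra. }
  split.
  - assert (h := is_lim_seq_incr_n (sum_n a) 0 (Series a)).
    apply is_lim_seq_ext with (fun n => Series a - (sum_n a n - a n)).
    + intros n. destruct n as [|n].
      * rewrite sum_O. rewrite Rminus_diag, Rminus_0_r. apply Series_ext. reflexivity.
      * rewrite sum_Sn. unfold plus; simpl. rewrite (Series_incr_n a (S n)) by (lia || assumption).
        rewrite <- sum_n_Reals. simpl Nat.pred. ring_simplify.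
        apply Series_ext. reflexivity.
    + replace (Finite 0) with (Finite (Series a - (Series a - 0))) by (f_equal; ring).
      apply is_lim_seq_minus'; [apply is_lim_seq_const|].
      apply is_lim_seq_minus'; [apply Series_correct, ha|].
      now apply ex_series_lim_0.
  - intros n r hr.
    assert (hex : ex_series (fun k => a (n + k)%nat)) by now apply ex_series_incr_n.
    set (b := fun k => picard_seq (S (S (n + k))) r - picard_seq (S (n + k)) r).
    assert (hbb : forall k, Rabs (b k) <= a (S (n + k))%nat) by (intros k; now apply hstep).
    assert (hexS : ex_series (fun k => a (S (n + k))%nat)).
    { apply (ex_series_incr_n a (S n)) in ha. exact ha. }
    assert (hab : ex_series (fun k => Rabs (b k))).
    { apply (ex_series_le (fun k => Rabs (b k)) (fun k => a (S (n + k))%nat)); [|exact hexS].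
      intros k. unfold norm; simpl. unfold abs; simpl. rewrite Rabs_Rabsolu. apply hbb. }
    assert (hsum : forall m, sum_n b m = picard_seq (S (S (n + m))) r - picard_seq (S n) r).
    { induction m as [|m IH].
      - rewrite sum_O. unfold b. rewrite Nat.add_0_r. reflexivity.
      - rewrite sum_Sn, IH. unfold plus, b; simpl. rewrite Nat.add_succ_r. simpl. ring. }
    assert (hlim : is_lim_seq (fun m => picard_seq (m + (S (S n))) r) (picard_seq (S n) r + Series
      b)).
    { apply is_lim_seq_ext with (fun m => picard_seq (S n) r + sum_n b m).
      - intros m. rewrite hsum. replace (m + S (S n))%nat with (S (S (n + m))) by lia. ring.
      - apply is_lim_seq_plus'; [apply is_lim_seq_const|].
        apply Series_correct. now apply ex_series_Rabs. }
    apply (is_lim_seq_incr_n (fun m => picard_seq m r) (S (S n))) in hlim.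
    unfold picard_lim. rewrite (is_lim_seq_unique _ _ hlim). cbn [real].
    replace (picard_seq (S n) r + Series b - picard_seq (S n) r) with (Series b) by ring.
    eapply Rle_trans; [now apply Series_Rabs|].
    eapply Rle_trans; [apply Series_le; [|exact hexS]|].
    + intros k. split; [apply Rabs_pos|apply hbb].
    + rewrite (Series_incr_1 (fun k => a (n + k)%nat)) by assumption.
      rewrite (Series_ext (fun k => a (n + S k)%nat) (fun k => a (S (n + k))))
        by (intros k; f_equal; lia).
      specialize (ha0 (n + 0)%nat). lra.
Qed.

Lemma picard_lim_cont r : continuous picard_lim r.
Proof.
  assert (hX : 0 < Rabs r + 1) by (assert (h := Rabs_pos r); lra).
  destruct (picard_uniform (Rabs r + 1) hX) as (e & he & hu).
  apply (continuity_pt_filterlim picard_lim r).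
  intros eps heps. apply is_lim_seq_spec in he.
  destruct (he (mkposreal (eps / 3) ltac:(lra))) as [N hN]. simpl in hN.
  specialize (hN N (le_n N)). rewrite Rminus_0_r in hN.
  assert (hcN := picard_seq_cont (S N) r). apply continuity_pt_filterlim in hcN.
  destruct (hcN (eps / 3)) as (d & hd & hh); [lra|].
  exists (Rmin d 1). split; [apply Rmin_glb_lt; lra|].
  intros x [hx hdx]. change (Rabs (x - r) < Rmin d 1) in hdx.
  change (Rabs (picard_lim x - picard_lim r) < eps).
  assert (h1 := Rmin_l d 1). assert (h2 := Rmin_r d 1).
  assert (hxX : x <= Rabs r + 1) by (assert (hr := Rle_abs r); apply Rabs_def2 in hdx; lra).
  assert (hrX : r <= Rabs r + 1) by (assert (hr := Rle_abs r); lra).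
  assert (hux := hu N x hxX). assert (hur := hu N r hrX).
  assert (hm : Rabs (picard_seq (S N) x - picard_seq (S N) r) < eps / 3).
  { apply hh. split; [exact hx|]. change (Rabs (x - r) < d). lra. }
  assert (hN' := Rle_abs (e N)).
  replace (picard_lim x - picard_lim r) with
    ((picard_lim x - picard_seq (S N) x) + (picard_seq (S N) x - picard_seq (S N) r)
     - (picard_lim r - picard_seq (S N) r)) by ring.
  apply Rabs_def2 in hm. apply Rabs_le_between in hux, hur.
  apply Rabs_def1; lra.
Qed.

Lemma picard_fixed r : T picard_lim r = picard_lim r.
Proof.
  assert (hX : 0 < Rabs r + 1) by (assert (h := Rabs_pos r); lra).
  set (X := Rabs r + 1) in *.
  assert (hrX : r <= X) by (unfold X; assert (hr := Rle_abs r); lra).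
  destruct (picard_uniform X hX) as (e & he & hu).
  destruct (T_lip X hX) as (L & hL & hlip).
  assert (hbound : forall n, Rabs (T picard_lim r - picard_lim r) <= L * (X * e n) + e (S n)).
  { intros n. assert (he0 : 0 <= e n).
    { apply Rle_trans with (Rabs (picard_lim 0 - picard_seq (S n) 0)); [apply Rabs_pos|].
      apply hu. lra. }
    assert (h1 := hu (S n) r hrX).
    assert (h2 : Rabs (T picard_lim r - picard_seq (S (S n)) r) <= L * (X * e n)).
    { change (picard_seq (S (S n)) r) with (T (picard_seq (S n)) r).
      destruct (Rle_dec r 0) as [hr|hr].
      - rewrite (T_neg picard_lim), (T_neg (picard_seq (S n))) by assumption.
        rewrite Rminus_diag, Rabs_R0. apply Rmult_le_pos; nra.
      - eapply Rle_trans; [apply hlip; [apply picard_lim_cont|apply picard_seq_cont|lra]|].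
        apply Rmult_le_compat_l; [assumption|].
        apply Rle_trans with ((r - 0) * e n).
        + eapply Rle_trans; [apply Rle_abs|]. apply abs_RInt_le_const; [lra| |].
          * apply (ex_RInt_continuous (V := R_CompleteNormedModule)). intros z _.
            apply continuous_Rabs_minus; [apply picard_lim_cont|apply picard_seq_cont].
          * intros t ht. rewrite Rabs_Rabsolu. apply hu. lra.
        + apply Rmult_le_compat_r; [assumption|lra]. }
    apply Rabs_le_between in h1, h2. apply Rabs_le_between. lra. }
  assert (hl : is_lim_seq (fun n => L * (X * e n) + e (S n)) 0).
  { replace (Finite 0) with (Finite (L * (X * 0) + 0)) by (f_equal; ring).
    apply is_lim_seq_plus'; [|now apply is_lim_seq_incr_1 in he].
    apply (is_lim_seq_scal_l (fun n => X * e n) L (X * 0)).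
    now apply (is_lim_seq_scal_l e X 0). }
  assert (h := is_lim_seq_le _ _ _ _ hbound (is_lim_seq_const _) hl). simpl in h.
  assert (h' := Rabs_pos (T picard_lim r - picard_lim r)).
  apply Rminus_diag_uniq, Rabs_eq_0. lra.
Qed.

Theorem picard : exists y, (forall r, continuous y r) /\ forall r, y r = T y r.
Proof.
  exists picard_lim. split; [apply picard_lim_cont|]. intros; symmetry; apply picard_fixed.
Qed.

End Picard.

(** * The initial value problem *)

Definition react (c : R) : R := c ^ 4 + c ^ 7.
(** Zero reaction for negative values: solutions continue beyond their first zero and still decrease
    there, so having a first root means vanishing somewhere, and positive solutions are not
    affected. *)
Definition react_pos (u : R) : R := react (Rmax 0 u).

Lemma react_pos_eq u : 0 <= u -> react_pos u = react u.
Proof. intros h. unfold react_pos. now rewrite Rmax_right. Qed.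

Lemma react_le x y : 0 <= x <= y -> react x <= react y.
Proof. intros h. unfold react. apply Rplus_le_compat; apply pow_incr; lra. Qed.

Lemma react_gt0 x : 0 < x -> 0 < react x.
Proof.
  intros h. unfold react. assert (0 < x ^ 4) by now apply pow_lt.
  assert (0 < x ^ 7) by now apply pow_lt. lra.
Qed.

(** Divided difference of [react] in polynomial form, which keeps its meaning on the diagonal. *)
Definition react_dd (a b : R) : R :=
  (a^3 + a^2*b + a*b^2 + b^3)
  + (a^6 + a^5*b + a^4*b^2 + a^3*b^3 + a^2*b^4 + a*b^5 + b^6).

Lemma react_dd_spec a b : react a - react b = react_dd a b * (a - b).
Proof. unfold react, react_dd. ring. Qed.

Lemma pow_mult_le x y A i j : 0 <= x <= A -> 0 <= y <= A -> 0 <= x ^ i * y ^ j <= A ^ (i + j).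
Proof.
  intros hx hy. split.
  - apply Rmult_le_pos; apply pow_le; lra.
  - rewrite pow_add. apply Rmult_le_compat; try (apply pow_le; lra); apply pow_incr; lra.
Qed.

Lemma react_dd_bound a b A : 0 <= a <= A -> 0 <= b <= A ->
  0 <= react_dd a b <= 4 * A ^ 3 + 7 * A ^ 6.
Proof.
  intros ha hb. unfold react_dd.
  assert (h := fun i j => pow_mult_le a b A i j ha hb).
  assert (h30 := h 3%nat 0%nat). assert (h21 := h 2%nat 1%nat).
  assert (h12 := h 1%nat 2%nat). assert (h03 := h 0%nat 3%nat).
  assert (h60 := h 6%nat 0%nat). assert (h51 := h 5%nat 1%nat).
  assert (h42 := h 4%nat 2%nat). assert (h33 := h 3%nat 3%nat).
  assert (h24 := h 2%nat 4%nat). assert (h15 := h 1%nat 5%nat). assert (h06 := h 0%nat 6%nat).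
  simpl Nat.add in *. rewrite ?pow_O, ?pow_1 in *. lra.
Qed.

Lemma Rmax0_lip x y : Rabs (Rmax 0 x - Rmax 0 y) <= Rabs (x - y).
Proof.
  unfold Rmax. destruct (Rle_dec 0 x), (Rle_dec 0 y); unfold Rabs; repeat destruct Rcase_abs; lra.
Qed.

Lemma react_pos_lip x y A : x <= A -> y <= A -> 0 <= A ->
  Rabs (react_pos x - react_pos y) <= (4 * A ^ 3 + 7 * A ^ 6) * Rabs (x - y).
Proof.
  intros hx hy hA. unfold react_pos. rewrite react_dd_spec, Rabs_mult.
  assert (h := react_dd_bound (Rmax 0 x) (Rmax 0 y) A).
  assert (0 <= Rmax 0 x <= A) by (split; [apply Rmax_l|now apply Rmax_lub]).
  assert (0 <= Rmax 0 y <= A) by (split; [apply Rmax_l|now apply Rmax_lub]).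
  specialize (h H H0). rewrite (Rabs_pos_eq (react_dd _ _)) by lra.
  apply Rmult_le_compat; try lra; [apply Rabs_pos|apply Rmax0_lip].
Qed.

Lemma lipschitz_continuous (g : R -> R) (L x : R) : 0 <= L ->
  (forall y, Rabs (g y - g x) <= L * Rabs (y - x)) -> continuous g x.
Proof.
  intros hL h. apply (continuity_pt_filterlim g x). intros eps heps.
  exists (eps / (L + 1)). split; [apply Rdiv_lt_0_compat; lra|].
  intros y [_ hy]. change (Rabs (y - x) < eps / (L + 1)) in hy.
  change (Rabs (g y - g x) < eps). eapply Rle_lt_trans; [apply h|].
  apply Rlt_le_trans with ((L + 1) * (eps / (L + 1))); [|right; field; lra].
  assert (h0 := Rabs_pos (y - x)).
  apply Rle_lt_trans with ((L + 1) * Rabs (y - x)); [nra|]. apply Rmult_lt_compat_l; lra.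
Qed.

Lemma Rmax0_cont (f : R -> R) (r : R) : continuous f r -> continuous (fun t => Rmax 0 (f t)) r.
Proof.
  intros h. apply (continuous_comp f (Rmax 0)); [assumption|].
  apply lipschitz_continuous with 1; [lra|]. intros y. assert (h1 := Rmax0_lip y (f r)). lra.
Qed.

Lemma react_pos_cont u : continuous react_pos u.
Proof.
  assert (h : continuous (fun u => Rmax 0 u) u) by (apply Rmax0_cont; cont).
  unfold react_pos, react. cont.
Qed.

(** * Existence through the integral form of the radial equation *)

Section Existence.

Variable a : R.
Hypothesis a_pos : 0 < a.

(** Capping at [a] as well makes the nonlinearity globally Lipschitz; solutions decrease from [a],
    so the cap is inactive on them. *)
Let g (y : R) : R := react_pos (Rmin y a).
Let Lg : R := 4 * a ^ 3 + 7 * a ^ 6.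

Lemma Lg_pos : 0 <= Lg.
Proof. unfold Lg. assert (h := pow_lt a 3 a_pos). assert (h' := pow_lt a 6 a_pos). lra. Qed.

Lemma g_lip x y : Rabs (g x - g y) <= Lg * Rabs (x - y).
Proof.
  unfold g, Lg. eapply Rle_trans; [apply (react_pos_lip _ _ a); try apply Rmin_r; lra|].
  apply Rmult_le_compat_l; [apply Lg_pos|].
  unfold Rmin. destruct (Rle_dec x a), (Rle_dec y a); unfold Rabs; repeat destruct Rcase_abs; lra.
Qed.

Lemma g_cont x : continuous g x.
Proof. apply lipschitz_continuous with Lg; [apply Lg_pos|]. intros; apply g_lip. Qed.

Lemma g_bound x : 0 <= g x <= react a.
Proof.
  unfold g, react_pos. split.
  - assert (h := Rmax_l 0 (Rmin x a)). unfold react.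
    apply Rplus_le_le_0_compat; now apply pow_le.
  - apply react_le. split; [apply Rmax_l|]. apply Rmax_lub; [lra|apply Rmin_r].
Qed.

(** From [(r^2 u')' = - r^2 g u]: at a solution, [mass] is [- r^2 u'] and [flux] is [- u'], and
    solutions are the fixed points of [flux_op]. The value 0 of [flux] for [r <= 0] avoids the
    division by zero and makes [flux_op] constant there, as [picard] requires. *)
Definition mass (y : R -> R) (r : R) : R := RInt (fun s => s ^ 2 * g (y s)) 0 r.
Definition flux (y : R -> R) (r : R) : R := if Rle_dec r 0 then 0 else mass y r / r ^ 2.
Definition flux_op (y : R -> R) (r : R) : R := a - RInt (flux y) 0 r.

Lemma mass_integrand_cont (y : R -> R) (r : R) :
  continuous y r -> continuous (fun s => s ^ 2 * g (y s)) r.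
Proof.
  intros hy. cont. apply (continuous_comp y g); [exact hy|apply g_cont].
Qed.

Lemma ex_RInt_cont (f : R -> R) (x y : R) : (forall r, continuous f r) -> ex_RInt f x y.
Proof.
  intros h. apply (ex_RInt_continuous (V := R_CompleteNormedModule)). intros; apply h.
Qed.

Lemma is_derive_RInt_cont (f : R -> R) (x r : R) :
  (forall s, continuous f s) -> is_derive (fun r => RInt f x r) r (f r).
Proof.
  intros h. apply (is_derive_RInt f (fun r => RInt f x r) x r); [|apply h].
  apply filter_forall. intros t. apply (RInt_correct (V := R_CompleteNormedModule)).
  now apply ex_RInt_cont.
Qed.

Lemma mass_derive y r : (forall s, continuous y s) ->
  is_derive (mass y) r (r ^ 2 * g (y r)).
Proof.
  intros hy. apply (is_derive_RInt_cont (fun s => s ^ 2 * g (y s))).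
  intros; now apply mass_integrand_cont.
Qed.

Lemma flux_pos_eq y r : 0 < r -> flux y r = mass y r / r ^ 2.
Proof. intros h. unfold flux. destruct (Rle_dec r 0); [lra|reflexivity]. Qed.

Lemma flux_neg_eq y r : r <= 0 -> flux y r = 0.
Proof. intros h. unfold flux. destruct (Rle_dec r 0); [reflexivity|lra]. Qed.

Lemma mass_bound y r : (forall s, continuous y s) -> 0 <= r ->
  0 <= mass y r <= r ^ 3 * react a.
Proof.
  intros hy hr. unfold mass. split.
  - apply RInt_ge_0; [assumption| |].
    + apply ex_RInt_cont. intros; now apply mass_integrand_cont.
    + intros x hx. apply Rmult_le_pos; [apply pow_le; lra|apply g_bound].
  - eapply Rle_trans; [apply Rle_abs|].
    replace (r ^ 3 * react a) with ((r - 0) * (r ^ 2 * react a)) by ring.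
    apply abs_RInt_le_const; [assumption| |].
    + apply ex_RInt_cont. intros; now apply mass_integrand_cont.
    + intros t ht. assert (hg := g_bound (y t)).
      rewrite Rabs_pos_eq by (apply Rmult_le_pos; [apply pow_le; lra|lra]).
      apply Rmult_le_compat; try lra; [apply pow_le; lra|apply pow_incr; lra].
Qed.

Lemma flux_bound y r : (forall s, continuous y s) -> 0 <= r ->
  0 <= flux y r <= r * react a.
Proof.
  intros hy hr. destruct (Rle_lt_or_eq_dec _ _ hr) as [h|<-].
  - rewrite flux_pos_eq by assumption. assert (hm := mass_bound y r hy hr).
    assert (hr2 : 0 < r ^ 2) by now apply pow_lt.
    split.
    + apply Rdiv_le_0_compat; lra.
    + apply Rle_div_l; [assumption|]. replace (r * react a * r ^ 2) with (r ^ 3 * react a) by ring.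
      lra.
  - rewrite flux_neg_eq by lra. lra.
Qed.

Lemma flux_derive y r : (forall s, continuous y s) -> 0 < r ->
  is_derive (flux y) r (g (y r) - 2 / r * flux y r).
Proof.
  intros hy hr. apply is_derive_ext_loc with (fun t => mass y t / t ^ 2).
  - apply (locally_interval _ r 0 p_infty); simpl; try easy.
    intros t ht _. symmetry. now apply flux_pos_eq.
  - assert (hm := mass_derive y r hy). rewrite flux_pos_eq by assumption.
    auto_derive.
    + split; [eexists; exact hm|]. split; [apply Rmult_integral_contrapositive; split; nra|trivial].
    + replace (Derive (fun x => mass y x) r) with (r ^ 2 * g (y r))
        by (symmetry; now apply is_derive_unique).
      field. lra.
Qed.

Lemma flux_cont y : (forall s, continuous y s) -> forall r, continuous (flux y) r.
Proof.
  intros hy r. destruct (Rtotal_order r 0) as [h|[->|h]].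
  - apply (continuous_ext_loc _ (fun _ => 0)); [|apply continuous_const].
    apply (locally_interval _ r m_infty 0); simpl; try easy.
    intros t _ ht. symmetry. apply flux_neg_eq. lra.
  - apply lipschitz_continuous with (react a); [left; now apply react_gt0|].
    intros t. rewrite (flux_neg_eq y 0) by lra. rewrite !Rminus_0_r.
    assert (ha := react_gt0 a a_pos). destruct (Rle_dec t 0) as [ht|ht].
    + rewrite flux_neg_eq, Rabs_R0 by assumption. apply Rmult_le_pos; [lra|apply Rabs_pos].
    + assert (hb := flux_bound y t hy ltac:(lra)). rewrite !Rabs_pos_eq by lra. lra.
  - apply (ex_derive_continuous (flux y)). eexists. now apply flux_derive.
Qed.

Lemma flux_op_derive y r : (forall s, continuous y s) ->
  is_derive (flux_op y) r (- flux y r).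
Proof.
  intros hy. unfold flux_op.
  assert (h := is_derive_RInt_cont (flux y) 0 r (flux_cont y hy)).
  apply (is_derive_ext (fun t => minus a (RInt (flux y) 0 t))); [reflexivity|].
  replace (- flux y r) with (minus 0 (flux y r)) by (unfold minus, plus, opp; simpl; ring).
  apply (is_derive_minus (fun _ => a) (fun t => RInt (flux y) 0 t)); [|exact h].
  apply (is_derive_const a).
Qed.

Lemma flux_op_neg y r : r <= 0 -> flux_op y r = a.
Proof.
  intros hr. unfold flux_op. rewrite (RInt_ext _ (fun _ => 0)).
  - rewrite RInt_const. unfold scal; simpl; unfold mult; simpl. ring.
  - intros x hx. rewrite Rmax_left in hx by lra. apply flux_neg_eq. lra.
Qed.

(** The weight [s^2 / r^2] is at most 1 on [[0, r]], so the singular factor costs nothing. *)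
Lemma flux_lip y z r : (forall s, continuous y s) -> (forall s, continuous z s) -> 0 <= r ->
  Rabs (flux y r - flux z r) <= Lg * RInt (fun s => Rabs (y s - z s)) 0 r.
Proof.
  intros hy hz hr.
  assert (hyz : forall s, continuous (fun s => Rabs (y s - z s)) s)
    by (intros; now apply continuous_Rabs_minus).
  destruct (Rle_lt_or_eq_dec _ _ hr) as [h|<-].
  2: { rewrite !flux_neg_eq by lra. rewrite Rminus_diag, Rabs_R0, RInt_point.
       unfold zero; simpl. lra. }
  rewrite !flux_pos_eq by assumption.
  replace (mass y r / r ^ 2 - mass z r / r ^ 2) with ((mass y r - mass z r) / r ^ 2) by (field;
    lra).
  assert (hr2 : 0 < r ^ 2) by now apply pow_lt.
  unfold Rdiv. rewrite Rabs_mult, (Rabs_pos_eq (/ r ^ 2)) by (left; now apply Rinv_0_lt_compat).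
  apply Rle_div_l; [assumption|].
  unfold mass. change (RInt (fun s => s ^ 2 * g (y s)) 0 r - RInt (fun s => s ^ 2 * g (z s)) 0 r)
    with (minus (RInt (fun s => s ^ 2 * g (y s)) 0 r) (RInt (fun s => s ^ 2 * g (z s)) 0 r)).
  rewrite <- RInt_minus by (apply ex_RInt_cont; intros; now apply mass_integrand_cont).
  eapply Rle_trans; [apply abs_RInt_le; [assumption|]|].
  { apply ex_RInt_cont. intros s. apply cont_minus; now apply mass_integrand_cont. }
  replace (Lg * RInt (fun s => Rabs (y s - z s)) 0 r * r ^ 2)
    with (scal (Lg * r ^ 2) (RInt (fun s => Rabs (y s - z s)) 0 r))
    by (unfold scal; simpl; unfold mult; simpl; ring).
  rewrite <- RInt_scal by now apply ex_RInt_cont.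
  apply RInt_le; [assumption| | |].
  - apply ex_RInt_cont. intros s. apply (continuous_comp _ Rabs); [|apply continuous_Rabs].
    apply cont_minus; now apply mass_integrand_cont.
  - apply ex_RInt_cont. intros s.
    apply (cont_mult (fun _ => Lg * r ^ 2)); [apply continuous_const|apply hyz].
  - intros s hs. unfold scal, minus, plus, opp; simpl; unfold mult; simpl.
    replace (s * (s * 1) * g (y s) + - (s * (s * 1) * g (z s)))
      with (s ^ 2 * (g (y s) - g (z s))) by ring.
    rewrite Rabs_mult, (Rabs_pos_eq (s ^ 2)) by (apply pow_le; lra).
    assert (hl := g_lip (y s) (z s)). assert (h0 := Rabs_pos (g (y s) - g (z s))).
    assert (hs2 : 0 <= s ^ 2 <= r ^ 2) by (split; [apply pow_le|apply pow_incr]; lra).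
    apply Rle_trans with (r ^ 2 * (Lg * Rabs (y s - z s))); [|right; ring].
    apply Rmult_le_compat; lra.
Qed.

Lemma RInt_mono_bound (f : R -> R) (s r : R) : (forall x, continuous f x) ->
  (forall x, 0 <= f x) -> 0 <= s <= r -> RInt f 0 s <= RInt f 0 r.
Proof.
  intros hf h0 hs. rewrite <- (RInt_Chasles f 0 s r) by now apply ex_RInt_cont.
  assert (0 <= RInt f s r) by (apply RInt_ge_0; [lra|now apply ex_RInt_cont|intros; apply h0]).
  unfold plus; simpl. lra.
Qed.

Lemma flux_op_lip X : 0 < X -> exists L, 0 <= L /\
  forall y z, (forall r, continuous y r) -> (forall r, continuous z r) ->
  forall r, 0 <= r <= X ->
    Rabs (flux_op y r - flux_op z r) <= L * RInt (fun s => Rabs (y s - z s)) 0 r.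
Proof.
  intros hX. exists (X * Lg). split; [apply Rmult_le_pos; [lra|apply Lg_pos]|].
  intros y z hy hz r hr. unfold flux_op.
  assert (hyz : forall s, continuous (fun s => Rabs (y s - z s)) s)
    by (intros; now apply continuous_Rabs_minus).
  assert (hI0 : forall s, 0 <= s <= r -> 0 <= RInt (fun s => Rabs (y s - z s)) 0 s
     <= RInt (fun s => Rabs (y s - z s)) 0 r).
  { intros s hs. split.
    - apply RInt_ge_0; [lra|now apply ex_RInt_cont|intros; apply Rabs_pos].
    - apply RInt_mono_bound; [assumption|intros; apply Rabs_pos|assumption]. }
  replace (a - RInt (flux y) 0 r - (a - RInt (flux z) 0 r))
    with (minus (RInt (flux z) 0 r) (RInt (flux y) 0 r))
    by (unfold minus, plus, opp; simpl; ring).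
  rewrite <- RInt_minus by (apply ex_RInt_cont; now apply flux_cont).
  apply Rle_trans with ((r - 0) * (Lg * RInt (fun s => Rabs (y s - z s)) 0 r)).
  - apply abs_RInt_le_const; [lra| |].
    + apply ex_RInt_cont. intros s. apply (continuous_minus (flux z) (flux y)); now apply flux_cont.
    + intros t ht. unfold minus, plus, opp; simpl.
      replace (flux z t + - flux y t) with (- (flux y t - flux z t)) by ring. rewrite Rabs_Ropp.
      eapply Rle_trans; [apply flux_lip; (assumption || lra)|].
      apply Rmult_le_compat_l; [apply Lg_pos|]. apply hI0; lra.
  - assert (h := hI0 r ltac:(lra)). assert (hL := Lg_pos).
    rewrite Rminus_0_r. rewrite <- Rmult_assoc.
    apply Rmult_le_compat_r; [lra|]. apply Rmult_le_compat_r; lra.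
Qed.

(** Near 0 the integrand of [mass] is [s^2 g (y 0)] up to [eps s^2], hence the factor 1/3. This
    limit provides the second derivative of the solution at the origin. *)
Lemma flux_over_r_lim y : (forall s, continuous y s) -> forall eps, 0 < eps ->
  exists d, 0 < d /\ forall r, 0 < r < d -> Rabs (flux y r / r - g (y 0) / 3) <= eps.
Proof.
  intros hy eps he.
  assert (hc : continuous (fun s => g (y s)) 0)
    by (apply (continuous_comp y g); [apply hy|apply g_cont]).
  destruct (continuous_bound_above _ 0 (g (y 0) + eps) hc) as (d1 & hd1 & h1); [lra|].
  destruct (continuous_bound_below _ 0 (g (y 0) - eps) hc) as (d2 & hd2 & h2); [lra|].
  exists (Rmin d1 d2). split; [now apply Rmin_glb_lt|]. intros r hr.
  assert (hm1 := Rmin_l d1 d2). assert (hm2 := Rmin_r d1 d2).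
  rewrite flux_pos_eq by lra.
  assert (hr3 : 0 < r ^ 3) by (apply pow_lt; lra).
  assert (hI : forall c, is_RInt (fun s => c * s ^ 2) 0 r (c * (r ^ 3 / 3))).
  { intros c. replace 3 with (INR (S 2)) by (simpl; ring). apply RInt_monomial. }
  assert (hi : forall c, ex_RInt (fun s => c * s ^ 2) 0 r) by (intros c; eexists; apply hI).
  assert (hmi : ex_RInt (fun s => s ^ 2 * g (y s)) 0 r)
    by (apply ex_RInt_cont; intros; now apply mass_integrand_cont).
  assert (hlo : (g (y 0) - eps) * (r ^ 3 / 3) <= mass y r).
  { rewrite <- (is_RInt_unique _ _ _ _ (hI (g (y 0) - eps))).
    apply RInt_le; [lra|apply hi|exact hmi|].
    intros x hx. rewrite Rmult_comm. apply Rmult_le_compat_l; [apply pow_le; lra|].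
    left. apply h2. apply Rabs_def1; lra. }
  assert (hhi : mass y r <= (g (y 0) + eps) * (r ^ 3 / 3)).
  { rewrite <- (is_RInt_unique _ _ _ _ (hI (g (y 0) + eps))).
    apply RInt_le; [lra|exact hmi|apply hi|].
    intros x hx. rewrite (Rmult_comm _ (x ^ 2)). apply Rmult_le_compat_l; [apply pow_le; lra|].
    left. apply h1. apply Rabs_def1; lra. }
  replace (mass y r / r ^ 2 / r - g (y 0) / 3) with ((mass y r - g (y 0) * (r ^ 3 / 3)) / r ^ 3)
    by (field; lra).
  unfold Rdiv at 1. rewrite Rabs_mult, (Rabs_pos_eq (/ r ^ 3)) by (left; now apply
    Rinv_0_lt_compat).
  apply Rle_div_l; [assumption|]. apply Rabs_le_between. nra.
Qed.

Lemma solution_exists : exists U M : R -> R,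
  U 0 = a /\ M 0 = 0 /\
  (forall r, is_derive U r (- M r)) /\ (forall r, continuous M r) /\
  (forall r, 0 < r -> is_derive M r (react_pos (U r) - 2 / r * M r)) /\
  (forall r, 0 < r -> 0 < M r) /\
  (forall eps, 0 < eps -> exists d, 0 < d /\
     forall r, 0 < r < d -> Rabs (M r / r - react a / 3) <= eps).
Proof.
  destruct (picard flux_op) as (U & hc & hU).
  - intros y hy r. apply (ex_derive_continuous (flux_op y)). eexists. now apply flux_op_derive.
  - intros y r hr. rewrite !flux_op_neg by lra. reflexivity.
  - apply flux_op_lip.
  - exists U, (flux U).
    assert (h0 : U 0 = a) by (rewrite hU; apply flux_op_neg; lra).
    assert (hd : forall r, is_derive U r (- flux U r)).
    { intros r. apply (is_derive_ext (flux_op U)); [intros; symmetry; apply hU|].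
      now apply flux_op_derive. }
    (* A posteriori bound that removes the cap at [a]. *)
    assert (hle : forall r, 0 <= r -> U r <= a).
    { intros r hr. rewrite <- h0. apply Ropp_le_cancel.
      apply (derive_nonneg_le' (fun t => - U t) (flux U)); [assumption| |].
      - intros x _. specialize (hd x). auto_derive; [eexists; exact hd|].
        replace (Derive (fun x0 => U x0) x) with (- flux U x)
          by (symmetry; now apply is_derive_unique). ring.
      - intros x hx. apply flux_bound; [assumption|lra]. }
    assert (hg : forall r, 0 <= r -> g (U r) = react_pos (U r)).
    { intros r hr. unfold g. rewrite Rmin_left by now apply hle. reflexivity. }
    assert (hga : g (U 0) = react a) by (rewrite hg, h0, react_pos_eq by lra; reflexivity).
    assert (hlim := flux_over_r_lim U hc). rewrite hga in hlim.
    split; [assumption|]. split; [|split; [exact hd|split; [|split; [|split; [|exact hlim]]]]].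
    + apply flux_neg_eq; lra.
    + now apply flux_cont.
    + intros r hr. rewrite <- hg by lra. now apply flux_derive.
    + intros r hr. rewrite flux_pos_eq by assumption.
      apply Rdiv_lt_0_compat; [|now apply pow_lt].
      assert (hra := react_gt0 a a_pos).
      destruct (hlim (react a / 6)) as (d & hd0 & hh); [lra|].
      assert (hm := Rmin_l (r / 2) (d / 2)). assert (hm' := Rmin_r (r / 2) (d / 2)).
      set (p := Rmin (r / 2) (d / 2)) in *.
      assert (hp : 0 < p) by (apply Rmin_glb_lt; lra).
      specialize (hh p ltac:(lra)). apply Rabs_le_between in hh.
      rewrite flux_pos_eq in hh by assumption.
      assert (hmp : 0 < mass U p).
      { assert (hq : 0 < mass U p / p ^ 2 / p) by lra.
        assert (hp3 : 0 < p ^ 3) by now apply pow_lt.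
        replace (mass U p) with (mass U p / p ^ 2 / p * p ^ 3) by (field; lra).
        now apply Rmult_lt_0_compat. }
      apply Rlt_le_trans with (mass U p); [assumption|].
      unfold mass. rewrite <- (RInt_Chasles _ 0 p r)
        by (apply ex_RInt_cont; intros; now apply mass_integrand_cont).
      assert (0 <= RInt (fun s => s ^ 2 * g (U s)) p r).
      { apply RInt_ge_0; [lra|apply ex_RInt_cont; intros; now apply mass_integrand_cont|].
        intros x _. apply Rmult_le_pos; [apply pow2_ge_0|apply g_bound]. }
      unfold plus; simpl. simpl in H. lra.
Qed.

End Existence.

(* [M] is the slope [- U'], which is positive. *)
Definition is_solution (a : R) (U M : R -> R) : Prop :=
  U 0 = a /\ M 0 = 0 /\
  (forall r, is_derive U r (- M r)) /\ (forall r, continuous M r) /\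
  (forall r, 0 < r -> is_derive M r (react_pos (U r) - 2 / r * M r)) /\
  (forall r, 0 < r -> 0 < M r) /\
  (forall eps, 0 < eps -> exists d, 0 < d /\
     forall r, 0 < r < d -> Rabs (M r / r - react a / 3) <= eps).

(** The hypothesis [0 < a] stands inside the existential so that choice gives functions of all real
    [a]. *)
Lemma solution_pair_exists (a : R) :
  exists p : (R -> R) * (R -> R), 0 < a -> is_solution a (fst p) (snd p).
Proof.
  destruct (Rlt_dec 0 a) as [h|h].
  - destruct (solution_exists a h) as (U & M & H). now exists (U, M).
  - exists (fun _ => 0, fun _ => 0). tauto.
Qed.

Definition sol (a : R) : R -> R :=
  fst (proj1_sig (constructive_indefinite_description _ (solution_pair_exists a))).
Definition slope (a : R) : R -> R :=
  snd (proj1_sig (constructive_indefinite_description _ (solution_pair_exists a))).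

Lemma sol_spec a : 0 < a -> is_solution a (sol a) (slope a).
Proof.
  unfold sol, slope. destruct (constructive_indefinite_description _ _). assumption.
Qed.

Section Basic.
Variable a : R.
Hypothesis ha : 0 < a.

Lemma sol_0 : sol a 0 = a. Proof. apply (sol_spec a ha). Qed.
Lemma slope_0 : slope a 0 = 0. Proof. apply (sol_spec a ha). Qed.
Lemma sol_derive r : is_derive (sol a) r (- slope a r). Proof. apply (sol_spec a ha). Qed.
Lemma slope_cont r : continuous (slope a) r. Proof. apply (sol_spec a ha). Qed.
Lemma slope_derive r : 0 < r ->
  is_derive (slope a) r (react_pos (sol a r) - 2 / r * slope a r).
Proof. apply (sol_spec a ha). Qed.
Lemma slope_pos r : 0 < r -> 0 < slope a r. Proof. apply (sol_spec a ha). Qed.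
Lemma slope_over_r_lim eps : 0 < eps -> exists d, 0 < d /\
  forall r, 0 < r < d -> Rabs (slope a r / r - react a / 3) <= eps.
Proof. apply (sol_spec a ha). Qed.

Lemma slope_nonneg r : 0 <= r -> 0 <= slope a r.
Proof.
  intros h. destruct (Rle_lt_or_eq_dec _ _ h) as [h'|<-]; [left; now apply slope_pos|].
  rewrite slope_0. lra.
Qed.

Lemma sol_cont r : continuous (sol a) r.
Proof. apply (ex_derive_continuous (sol a)). eexists. apply sol_derive. Qed.

Lemma sol_decr r s : 0 <= r < s -> sol a s < sol a r.
Proof.
  intros h. destruct (mvt_open (sol a) (fun t => - slope a t) r s) as (c & hc & e); [lra| | |].
  - intros; apply sol_cont.
  - intros; apply sol_derive.
  - assert (h1 := slope_pos c ltac:(lra)). nra.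
Qed.

Lemma sol_decr_le r s : 0 <= r <= s -> sol a s <= sol a r.
Proof.
  intros h. destruct (Req_dec r s) as [->|n]; [lra|]. left. apply sol_decr. lra.
Qed.

Lemma sol_le r : 0 <= r -> sol a r <= a.
Proof. intros h. rewrite <- sol_0 at 2. apply sol_decr_le. lra. Qed.

End Basic.

(** * Uniqueness, dependence on the initial value, and the explicit solution *)

Definition reaction_lip (A : R) : R := 1 + (4 * A ^ 3 + 7 * A ^ 6).

Lemma reaction_lip_pos A : 0 < A -> 0 <= reaction_lip A.
Proof.
  intros h. unfold reaction_lip. assert (h1 := pow_lt A 3 h). assert (h2 := pow_lt A 6 h). lra.
Qed.

Lemma sol_compare (a A R0 c : R) (w m : R -> R) :
  0 < a <= A -> 0 <= c ->
  (forall r, 0 < r < R0 -> is_derive w r (- m r)) ->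
  (forall r, 0 < r < R0 -> is_derive m r (react_pos (w r) - 2 / r * m r)) ->
  (forall r, 0 < r < R0 -> w r <= A) ->
  (forall eps, 0 < eps -> exists d, 0 < d /\ forall r, 0 < r < d ->
     (w r - sol a r) ^ 2 + (m r - slope a r) ^ 2 <= c + eps) ->
  forall r, 0 < r < R0 ->
    (w r - sol a r) ^ 2 + (m r - slope a r) ^ 2 <= c * exp (reaction_lip A * r).
Proof.
  intros [ha haA] hc hw hm hA h0.
  apply (gronwall (fun r => (w r - sol a r) ^ 2 + (m r - slope a r) ^ 2)
    (fun r => 2 * (w r - sol a r) * (- (m r - slope a r)) + 2 * (m r - slope a r) *
       (react_pos (w r) - react_pos (sol a r) - 2 / r * (m r - slope a r)))); try assumption.
  - apply reaction_lip_pos; lra.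
  - intros r hr. specialize (hw r hr). specialize (hm r hr).
    assert (hs := sol_derive a ha r). assert (hsl := slope_derive a ha r ltac:(lra)).
    derive_hyps. field. lra.
  - intros r hr.
    assert (hl := react_pos_lip (w r) (sol a r) A (hA r hr)
      (Rle_trans _ _ _ (sol_le a ha r ltac:(lra)) haA) ltac:(lra)).
    set (d := w r - sol a r) in *. set (e := m r - slope a r).
    set (q := react_pos (w r) - react_pos (sol a r)) in *.
    unfold reaction_lip. set (L := 4 * A ^ 3 + 7 * A ^ 6) in *.
    assert (hL : 0 <= L).
    { unfold L. assert (h1 := pow_lt A 3 ltac:(lra)). assert (h2 := pow_lt A 6 ltac:(lra)). lra. }
    assert (heq : e * q <= Rabs e * (L * Rabs d)).
    { apply Rle_trans with (Rabs e * Rabs q); [rewrite <- Rabs_mult; apply Rle_abs|].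
      apply Rmult_le_compat_l; [apply Rabs_pos|assumption]. }
    assert (hde : Rabs e * Rabs d <= (e ^ 2 + d ^ 2) / 2).
    { rewrite <- (pow2_abs e), <- (pow2_abs d). assert (h := pow2_ge_0 (Rabs e - Rabs d)). nra. }
    assert (hde' : - (d * e) <= (e ^ 2 + d ^ 2) / 2) by (assert (h := pow2_ge_0 (e + d)); nra).
    assert (h2 : 0 <= 2 / r * e ^ 2).
    { apply Rmult_le_pos; [|apply pow2_ge_0]. left. apply Rdiv_lt_0_compat; lra. }
    assert (h3 : L * (Rabs e * Rabs d) <= L * ((e ^ 2 + d ^ 2) / 2))
      by (apply Rmult_le_compat_l; assumption).
    nra.
Qed.

(** No upper bound on [w] is assumed. The quantity [r^2 m] is nondecreasing and tends to 0 at the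
    origin, so [m >= 0] and [w <= a]; this supplies the Lipschitz constant for [sol_compare] with
    [c = 0]. *)
Lemma sol_unique (a R0 : R) (w m : R -> R) :
  0 < a ->
  (forall r, 0 < r < R0 -> is_derive w r (- m r)) ->
  (forall r, 0 < r < R0 -> is_derive m r (react_pos (w r) - 2 / r * m r)) ->
  (forall eps, 0 < eps -> exists d, 0 < d /\ forall r, 0 < r < d ->
     Rabs (w r - a) <= eps /\ Rabs (m r) <= eps) ->
  forall r, 0 < r < R0 -> w r = sol a r /\ m r = slope a r.
Proof.
  intros ha hw hm h0.
  assert (hmpos : forall r, 0 < r < R0 -> 0 <= m r).
  { intros r hr. assert (h : - (r ^ 2 * m r) <= 0 * exp (0 * r)).
    { apply (gronwall (fun r => - (r ^ 2 * m r)) (fun r => - (r ^ 2 * react_pos (w r))) R0); try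
        lra.
      - intros t ht. specialize (hm t ht). derive_hyps. field. lra.
      - intros t ht. assert (hp : 0 <= t ^ 2 * react_pos (w t)); [|lra].
        apply Rmult_le_pos; [apply pow2_ge_0|]. unfold react_pos, react.
        assert (h := Rmax_l 0 (w t)). apply Rplus_le_le_0_compat; now apply pow_le.
      - intros eps he. destruct (h0 eps he) as (d & hd & hh).
        exists (Rmin d 1). split; [apply Rmin_glb_lt; lra|]. intros t ht.
        assert (h1 := Rmin_l d 1). assert (h2 := Rmin_r d 1).
        destruct (hh t ltac:(lra)) as [_ hmt]. apply Rabs_le_between in hmt.
        assert (ht2 : 0 <= t ^ 2 <= 1) by (split; [apply pow2_ge_0|simpl; nra]).
        assert (0 <= t ^ 2 * (m t + eps)) by (apply Rmult_le_pos; lra).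
        assert (t ^ 2 * eps <= eps) by nra. lra. }
    assert (hr2 : 0 < r ^ 2) by (apply pow_lt; lra). nra. }
  assert (hwa : forall r, 0 < r < R0 -> w r <= a).
  { intros r hr. replace a with (a * exp (0 * r)) by (rewrite Rmult_0_l, exp_0; ring).
    apply (gronwall w (fun r => - m r) R0); try lra; try assumption.
    - intros t ht. specialize (hmpos t ht). lra.
    - intros eps he. destruct (h0 eps he) as (d & hd & hh). exists d. split; [assumption|].
      intros t ht. destruct (hh t ht) as [hwt _]. apply Rabs_le_between in hwt. lra. }
  intros r hr.
  assert (h : (w r - sol a r) ^ 2 + (m r - slope a r) ^ 2 <= 0 * exp (reaction_lip a * r)).
  { apply (sol_compare a a R0 0 w m); try assumption; try lra.
    intros eps he.
    set (e := Rmin 1 (eps / 8)).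
    assert (he1 : e <= 1) by apply Rmin_l. assert (he2 : e <= eps / 8) by apply Rmin_r.
    assert (hep : 0 < e) by (apply Rmin_glb_lt; lra).
    destruct (h0 e hep) as (d & hd & hh).
    assert (hsc := sol_cont a ha 0). assert (hlc := slope_cont a ha 0).
    destruct (continuous_near _ 0 e hsc hep) as (d1 & hd1 & h1).
    destruct (continuous_near _ 0 e hlc hep) as (d2 & hd2 & h2).
    rewrite sol_0 in h1 by assumption. rewrite slope_0 in h2 by assumption.
    exists (Rmin d (Rmin d1 d2)).
    assert (m1 := Rmin_l d (Rmin d1 d2)). assert (m2 := Rmin_r d (Rmin d1 d2)).
    assert (m3 := Rmin_l d1 d2). assert (m4 := Rmin_r d1 d2).
    split; [repeat apply Rmin_glb_lt; assumption|].
    intros t ht. destruct (hh t ltac:(lra)) as [hwt hmt].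
    assert (k1 := h1 t ltac:(apply Rabs_def1; lra)).
    assert (k2 := h2 t ltac:(apply Rabs_def1; lra)).
    assert (k3 := sol_le a ha t ltac:(lra)). assert (k4 := slope_nonneg a ha t ltac:(lra)).
    apply Rabs_le_between in hwt, hmt.
    assert ((w t - sol a t) ^ 2 <= 4 * e) by nra.
    assert ((m t - slope a t) ^ 2 <= 4 * e) by nra. lra. }
  assert (q1 := pow2_ge_0 (w r - sol a r)). assert (q2 := pow2_ge_0 (m r - slope a r)).
  split; apply Rminus_diag_uniq; nra.
Qed.

Lemma sol_near (a b A r : R) : 0 < a <= A -> 0 < b <= A -> 0 <= r ->
  (sol b r - sol a r) ^ 2 + (slope b r - slope a r) ^ 2 <= (b - a) ^ 2 * exp (reaction_lip A * r).
Proof.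
  intros ha hb hr. destruct (Rle_lt_or_eq_dec _ _ hr) as [h|<-].
  - apply (sol_compare a A (r + 1)); try lra; try apply pow2_ge_0.
    + intros; apply sol_derive; lra.
    + intros; apply slope_derive; lra.
    + intros t ht. assert (hl := sol_le b ltac:(lra) t ltac:(lra)). lra.
    + intros eps he.
      assert (hc : continuous (fun t => (sol b t - sol a t) ^ 2 + (slope b t - slope a t) ^ 2) 0).
      { cont; (apply sol_cont || apply slope_cont); lra. }
      destruct (continuous_bound_above _ 0 ((b - a) ^ 2 + eps) hc) as (d & hd & hh).
      { rewrite !sol_0, !slope_0 by lra. nra. }
      exists d. split; [assumption|]. intros t ht. left. apply hh. apply Rabs_def1; lra.
  - rewrite !sol_0, !slope_0 by lra. rewrite Rmult_0_r, exp_0. right; ring.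
Qed.

Lemma sol_continuous_param (a r eps : R) : 0 < a -> 0 <= r -> 0 < eps ->
  exists d, 0 < d /\ forall b, Rabs (b - a) < d ->
    0 < b /\ forall t, 0 <= t <= r ->
      Rabs (sol b t - sol a t) < eps /\ Rabs (slope b t - slope a t) < eps.
Proof.
  intros ha hr he.
  set (E := exp (reaction_lip (2 * a) * r)).
  assert (hE : 1 <= E).
  { unfold E. rewrite <- exp_0. assert (hl := reaction_lip_pos (2 * a) ltac:(lra)).
    destruct (Rle_lt_or_eq_dec 0 (reaction_lip (2 * a) * r)) as [h|h]; [nra| |].
    - left. now apply exp_increasing.
    - rewrite <- h. lra. }
  exists (Rmin (a / 2) (eps / E)).
  assert (hEe : 0 < eps / E) by (apply Rdiv_lt_0_compat; lra).
  split; [apply Rmin_glb_lt; lra|].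
  intros b hb. assert (h1 := Rmin_l (a / 2) (eps / E)). assert (h2 := Rmin_r (a / 2) (eps / E)).
  assert (hb' := Rabs_def2 _ _ hb). split; [lra|]. intros t ht.
  assert (hn := sol_near a b (2 * a) t ltac:(lra) ltac:(lra) ltac:(lra)).
  assert (hEt : exp (reaction_lip (2 * a) * t) <= E).
  { unfold E. assert (hl := reaction_lip_pos (2 * a) ltac:(lra)).
    destruct (Rle_lt_or_eq_dec (reaction_lip (2 * a) * t) (reaction_lip (2 * a) * r)) as [h|h];
      [nra| |].
    - left. now apply exp_increasing.
    - rewrite h. lra. }
  assert (hba : (b - a) ^ 2 < (eps / E) ^ 2).
  { rewrite <- (pow2_abs (b - a)). assert (h0 := Rabs_pos (b - a)). simpl; rewrite !Rmult_1_r.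
    apply Rmult_le_0_lt_compat; lra. }
  assert (hfin : (b - a) ^ 2 * exp (reaction_lip (2 * a) * t) < eps ^ 2).
  { apply Rle_lt_trans with ((b - a) ^ 2 * E).
    - apply Rmult_le_compat_l; [apply pow2_ge_0|assumption].
    - apply Rlt_le_trans with ((eps / E) ^ 2 * E); [apply Rmult_lt_compat_r; lra|].
      replace ((eps / E) ^ 2 * E) with (eps ^ 2 / E) by (field; lra).
      apply Rle_div_l; [lra|]. assert (h0 := pow2_ge_0 eps). nra. }
  assert (q1 := pow2_ge_0 (sol b t - sol a t)). assert (q2 := pow2_ge_0 (slope b t - slope a t)).
  split.
  - rewrite <- (Rabs_pos_eq eps) by lra. apply Rsqr_lt_abs_0. unfold Rsqr. nra.
  - rewrite <- (Rabs_pos_eq eps) by lra. apply Rsqr_lt_abs_0. unfold Rsqr. nra.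
Qed.

(** The explicit ground state of Lin and Ni, the real power being written with [exp] and [ln]. Its
    cube is rational, and [u^4] and [u^7] are [u] times powers of that cube, so the equation reduces
    to a rational identity. *)
Definition lin_ni (r : R) : R := 2 * exp (- ln (36 * r ^ 2 + 1) / 3).

Lemma lin_ni_pos r : 0 < lin_ni r.
Proof. unfold lin_ni. assert (h := exp_pos (- ln (36 * r ^ 2 + 1) / 3)). lra. Qed.

Lemma lin_ni_den_pos r : 0 < 36 * r ^ 2 + 1.
Proof. assert (h := pow2_ge_0 r). lra. Qed.

Lemma lin_ni_cube r : lin_ni r ^ 3 = 8 / (36 * r ^ 2 + 1).
Proof.
  assert (h := lin_ni_den_pos r). unfold lin_ni.
  rewrite Rpow_mult_distr, exp_third_cube, exp_Ropp, exp_ln by lra. field. lra.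
Qed.

Lemma lin_ni_derive r : is_derive lin_ni r (- (24 * r / (36 * r ^ 2 + 1) * lin_ni r)).
Proof.
  assert (h := lin_ni_den_pos r). unfold lin_ni. auto_derive.
  - simpl in h. lra.
  - simpl in *. unfold Rdiv. generalize (exp (- ln (36 * (r * (r * 1)) + 1) * / 3)). intros e.
    field. lra.
Qed.

Lemma sol_2 r : 0 <= r -> sol 2 r = lin_ni r /\ slope 2 r = 24 * r / (36 * r ^ 2 + 1) * lin_ni r.
Proof.
  intros hr.
  assert (hl0 : lin_ni 0 = 2).
  { unfold lin_ni. replace (36 * 0 ^ 2 + 1) with 1 by ring. rewrite ln_1.
    replace (- 0 / 3) with 0 by field. rewrite exp_0. ring. }
  destruct (Rle_lt_or_eq_dec _ _ hr) as [h|<-].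
  2: { rewrite sol_0, slope_0, hl0 by lra. split; [reflexivity|field]. }
  set (m := fun r => 24 * r / (36 * r ^ 2 + 1) * lin_ni r).
  assert (hmd : forall t, is_derive m t (24 / (36 * t ^ 2 + 1) * lin_ni t
      - 24 * t * 72 * t / (36 * t ^ 2 + 1) ^ 2 * lin_ni t
      - 24 * t / (36 * t ^ 2 + 1) * (24 * t / (36 * t ^ 2 + 1) * lin_ni t))).
  { intros t. assert (hd := lin_ni_derive t). assert (hp := lin_ni_den_pos t).
    unfold m. derive_hyps. simpl in *. field. lra. }
  destruct (sol_unique 2 (r + 1) lin_ni m) with (r := r) as [e1 e2]; try lra.
  - intros t _. apply lin_ni_derive.
  - intros t ht. assert (hp := lin_ni_den_pos t). assert (hc := lin_ni_cube t).
    assert (hpos := lin_ni_pos t).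
    replace (react_pos (lin_ni t) - 2 / t * m t) with
      (24 / (36 * t ^ 2 + 1) * lin_ni t
      - 24 * t * 72 * t / (36 * t ^ 2 + 1) ^ 2 * lin_ni t
      - 24 * t / (36 * t ^ 2 + 1) * (24 * t / (36 * t ^ 2 + 1) * lin_ni t)); [apply hmd|].
    rewrite react_pos_eq by lra. unfold react, m.
    replace (lin_ni t ^ 4) with (lin_ni t * lin_ni t ^ 3) by ring.
    replace (lin_ni t ^ 7) with (lin_ni t * (lin_ni t ^ 3) ^ 2) by ring.
    rewrite hc. field. lra.
  - intros eps he.
    assert (hc1 : continuous lin_ni 0)
      by (apply (ex_derive_continuous lin_ni); eexists; apply lin_ni_derive).
    assert (hc2 : continuous m 0) by (apply (ex_derive_continuous m); eexists; apply hmd).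
    assert (hm0 : m 0 = 0) by (unfold m; field).
    destruct (continuous_near _ _ eps hc1 he) as (d1 & hd1 & h1).
    destruct (continuous_near _ _ eps hc2 he) as (d2 & hd2 & h2).
    rewrite hl0 in h1. rewrite hm0 in h2. exists (Rmin d1 d2).
    assert (n1 := Rmin_l d1 d2). assert (n2 := Rmin_r d1 d2).
    split; [now apply Rmin_glb_lt|]. intros t ht.
    specialize (h1 t ltac:(apply Rabs_def1; lra)). specialize (h2 t ltac:(apply Rabs_def1; lra)).
    split; apply Rabs_le_between; lra.
  - split; symmetry; assumption.
Qed.

(** * Dirichlet solutions and ground states *)

Lemma D_in_interior (f f' : R -> R) (D : R -> Prop) (x d : R) :
  0 < d -> (forall y, Rabs (y - x) < d -> D y) -> D_in f f' D x -> is_derive f x (f' x).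
Proof.
  intros hd hD h. apply is_derive_Reals. intros eps he.
  destruct (h eps he) as (a & ha & hh).
  assert (hm : 0 < Rmin a d) by (apply Rmin_glb_lt; lra).
  exists (mkposreal _ hm). intros k hk hka. simpl in hka.
  assert (h1 := Rmin_l a d). assert (h2 := Rmin_r a d).
  specialize (hh (x + k)). replace (x + k - x) with k in hh by ring.
  apply hh. split.
  - split; [|intro e; apply hk; lra]. apply hD. replace (x + k - x) with k by ring. lra.
  - change (Rabs (x + k - x) < a). replace (x + k - x) with k by ring. lra.
Qed.

Lemma is_derive_D_in (f f' : R -> R) (D : R -> Prop) (x : R) :
  is_derive f x (f' x) -> D_in f f' D x.
Proof.
  intros h. apply is_derive_Reals, derivable_pt_lim_D_in in h.
  intros eps he. destruct (h eps he) as (a & ha & hh). exists a. split; [assumption|].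
  intros y [[_ hy] hy2]. apply hh. repeat split; assumption.
Qed.

Lemma D_in_near (f f' : R -> R) (D : R -> Prop) (x eps : R) :
  D_in f f' D x -> 0 < eps ->
  exists d, 0 < d /\ forall y, D y -> Rabs (y - x) < d -> Rabs (f y - f x) <= eps.
Proof.
  intros h he. destruct (h 1 Rlt_0_1) as (a & ha & hh).
  set (K := Rabs (f' x) + 1).
  assert (hK : 0 < K) by (unfold K; assert (h0 := Rabs_pos (f' x)); lra).
  exists (Rmin a (eps / K)). assert (heK : 0 < eps / K) by now apply Rdiv_lt_0_compat.
  split; [now apply Rmin_glb_lt|]. intros y hy hyx.
  assert (h1 := Rmin_l a (eps / K)). assert (h2 := Rmin_r a (eps / K)).
  destruct (Req_dec y x) as [->|n]; [rewrite Rminus_diag, Rabs_R0; lra|].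
  specialize (hh y). assert (hq : Rabs ((f y - f x) / (y - x) - f' x) < 1).
  { apply hh. split; [split; [assumption|intro e; apply n; lra]|]. change (Rabs (y - x) < a). lra. }
  assert (hq2 : Rabs ((f y - f x) / (y - x)) <= K).
  { unfold K. replace ((f y - f x) / (y - x)) with ((f y - f x) / (y - x) - f' x + f' x) by ring.
    eapply Rle_trans; [apply Rabs_triang|]. lra. }
  replace (f y - f x) with ((f y - f x) / (y - x) * (y - x)) by (field; lra).
  rewrite Rabs_mult. apply Rle_trans with (K * (eps / K)); [|right; field; lra].
  apply Rmult_le_compat; try apply Rabs_pos; lra.
Qed.

Lemma continuous_continue_in (f : R -> R) (D : R -> Prop) (x : R) :
  continuous f x -> continue_in f D x.
Proof.
  intros h. apply continuity_pt_filterlim in h. intros eps he.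
  destruct (h eps he) as (a & ha & hh). exists a. split; [assumption|].
  intros y [[_ hy] hy2]. apply hh. repeat split; assumption.
Qed.

Section Scaled.

Variables (a s : R).
Hypotheses (ha : 0 < a) (hs : 0 < s).

(** [s = sqrt lam] rescales to the Dirichlet problem on the unit interval; [s = 1] serves for ground
    states. *)
Definition scaled (r : R) : R := sol a (s * r).
Definition scaled' (r : R) : R := - s * slope a (s * r).
(** The equation does not define the second derivative at the origin; the value there is the limit
    given by [slope_over_r_lim]. *)
Definition scaled'' (r : R) : R :=
  if Rle_dec r 0 then - (s ^ 2 * (react a / 3))
  else - (s ^ 2 * (react_pos (sol a (s * r)) - 2 / (s * r) * slope a (s * r))).

Lemma scaled_derive r : is_derive scaled r (scaled' r).
Proof.
  assert (h := sol_derive a ha (s * r)). unfold scaled, scaled'.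
  derive_hyps. ring.
Qed.

Lemma scaled'_derive r : 0 < r -> is_derive scaled' r (scaled'' r).
Proof.
  intros hr. assert (hsr : 0 < s * r) by now apply Rmult_lt_0_compat.
  assert (h := slope_derive a ha (s * r) hsr). unfold scaled', scaled''.
  destruct (Rle_dec r 0) as [h0|_]; [lra|].
  derive_hyps. ring.
Qed.

Lemma scaled''_eq r : 0 < r ->
  scaled'' r + 2 / r * scaled' r + s ^ 2 * react_pos (scaled r) = 0.
Proof.
  intros hr. unfold scaled'', scaled', scaled. destruct (Rle_dec r 0) as [h0|_]; [lra|].
  field. lra.
Qed.

Lemma scaled_C2 (D : R -> Prop) : (forall r, D r -> 0 <= r) -> C2_on D scaled scaled' scaled''.
Proof.
  intros hD r hr. apply hD in hr. split; [apply is_derive_D_in, scaled_derive|].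
  assert (hs2 : 0 < s ^ 2) by now apply pow_lt.
  destruct (Rle_lt_or_eq_dec _ _ hr) as [h|<-].
  - split; [now apply is_derive_D_in, scaled'_derive|]. apply continuous_continue_in.
    apply (continuous_ext_loc _ (fun r => - (s ^ 2 * (react_pos (sol a (s * r))
       - 2 / (s * r) * slope a (s * r))))).
    + apply (locally_interval _ r 0 p_infty); simpl; try easy.
      intros t ht _. unfold scaled''. destruct (Rle_dec t 0); [lra|reflexivity].
    + assert (hc0 : continuous (fun r => s * r) r) by cont.
      assert (hc1 : continuous (fun r => sol a (s * r)) r)
        by (apply (continuous_comp (fun r => s * r) (sol a)); [assumption|now apply sol_cont]).
      assert (hc2 : continuous (fun r => slope a (s * r)) r)
        by (apply (continuous_comp (fun r => s * r) (slope a)); [assumption|now apply slope_cont]).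
      assert (hc3 : continuous (fun r => react_pos (sol a (s * r))) r)
        by (apply (continuous_comp (fun r => sol a (s * r)) react_pos); [assumption|apply
          react_pos_cont]).
      assert (hc4 : continuous (fun r => / (s * r)) r).
      { apply (ex_derive_continuous (fun r => / (s * r))). auto_derive.
        apply Rmult_integral_contrapositive. lra. }
      cont.
  - assert (h00 : scaled'' 0 = - (s ^ 2 * (react a / 3)))
      by (unfold scaled''; destruct (Rle_dec 0 0); [reflexivity|lra]).
    assert (hs'0 : scaled' 0 = 0) by (unfold scaled'; rewrite Rmult_0_r, slope_0 by assumption;
      ring).
    split.
    + intros eps he.
      destruct (slope_over_r_lim a ha (eps / (2 * s ^ 2))) as (d & hd & hh);
        [apply Rdiv_lt_0_compat; lra|].
      exists (d / s). split; [now apply Rdiv_lt_0_compat|].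
      intros y [[hyD hy0] hyd]. change (Rabs (y - 0) < d / s) in hyd.
      apply hD in hyD. assert (hy : 0 < y) by lra.
      rewrite Rminus_0_r, Rabs_pos_eq in hyd by lra.
      assert (hsy : 0 < s * y < d).
      { split; [now apply Rmult_lt_0_compat|]. replace d with (s * (d / s)) by (field; lra).
        now apply Rmult_lt_compat_l. }
      specialize (hh _ hsy). change (Rabs ((scaled' y - scaled' 0) / (y - 0) - scaled'' 0) < eps).
      rewrite h00, hs'0. unfold scaled'.
      replace ((- s * slope a (s * y) - 0) / (y - 0) - - (s ^ 2 * (react a / 3)))
        with (- (s ^ 2 * (slope a (s * y) / (s * y) - react a / 3))) by (field; lra).
      rewrite Rabs_Ropp, Rabs_mult, (Rabs_pos_eq (s ^ 2)) by lra.
      apply Rle_lt_trans with (s ^ 2 * (eps / (2 * s ^ 2))); [apply Rmult_le_compat_l; lra|].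
      replace (s ^ 2 * (eps / (2 * s ^ 2))) with (eps / 2) by (field; lra). lra.
    + intros eps he.
      set (e := eps / (8 * s ^ 2)).
      assert (hep : 0 < e) by (apply Rdiv_lt_0_compat; lra).
      destruct (slope_over_r_lim a ha e hep) as (d & hd & hh).
      assert (hrp : continuous (fun t => react_pos (sol a t)) 0).
      { apply (continuous_comp (sol a) react_pos); [now apply sol_cont|apply react_pos_cont]. }
      assert (hr0 : react_pos (sol a 0) = react a) by (rewrite sol_0, react_pos_eq by lra;
        reflexivity).
      destruct (continuous_near _ _ e hrp hep) as (d1 & hd1 & h1). rewrite hr0 in h1.
      set (dd := Rmin d d1).
      assert (m1 : dd <= d) by apply Rmin_l. assert (m2 : dd <= d1) by apply Rmin_r.
      assert (hdd : 0 < dd) by now apply Rmin_glb_lt.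
      exists (dd / s). split; [now apply Rdiv_lt_0_compat|].
      intros y [[hyD hy0] hyd]. change (Rabs (y - 0) < dd / s) in hyd.
      apply hD in hyD. assert (hy : 0 < y) by lra.
      rewrite Rminus_0_r, Rabs_pos_eq in hyd by lra.
      assert (hsy : 0 < s * y < dd).
      { split; [now apply Rmult_lt_0_compat|]. replace dd with (s * (dd / s)) by (field; lra).
        now apply Rmult_lt_compat_l. }
      specialize (hh (s * y) ltac:(lra)).
      assert (k1 := h1 (s * y) ltac:(apply Rabs_def1; lra)).
      change (Rabs (scaled'' y - scaled'' 0) < eps). rewrite h00. unfold scaled''.
      destruct (Rle_dec y 0) as [h|_]; [lra|].
      set (q := react_pos (sol a (s * y))) in *.
      replace (- (s ^ 2 * (q - 2 / (s * y) * slope a (s * y))) - - (s ^ 2 * (react a / 3)))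
        with (s ^ 2 * (2 * (slope a (s * y) / (s * y) - react a / 3) - (q - react a)))
        by (field; lra).
      set (z := slope a (s * y) / (s * y) - react a / 3) in *.
      rewrite Rabs_mult, (Rabs_pos_eq (s ^ 2)) by lra.
      apply Rabs_le_between in hh.
      apply Rle_lt_trans with (s ^ 2 * (3 * e)).
      * apply Rmult_le_compat_l; [lra|]. apply Rabs_le_between. lra.
      * unfold e. replace (s ^ 2 * (3 * (eps / (8 * s ^ 2)))) with (3 * eps / 8) by (field; lra).
        lra.
Qed.

End Scaled.

(** The substitution [r / sqrt lam] removes [lam]; uniqueness on the open interval and continuity at
    its end identify the solution. As [sol a] is strictly decreasing, positivity before the root is
    automatic. *)
Lemma dirichlet_points_iff lam a :
  dirichlet_points (lam, a) <-> 0 < a /\ 0 < lam /\ sol a (sqrt lam) = 0.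
Proof.
  split.
  - intros (u & (hlam & u1 & u2 & hC & heq & hu1 & hu01 & hpos) & e0). simpl in *.
    assert (ha : 0 < a) by (rewrite e0; apply hpos; lra).
    split; [assumption|]. split; [assumption|].
    set (s := sqrt lam). assert (hs : 0 < s) by now apply sqrt_lt_R0.
    assert (hs2 : s * s = lam) by (apply sqrt_sqrt; lra).
    assert (hin : forall r, 0 < r < s -> 0 < r / s < 1).
    { intros r hr. split; [apply Rdiv_lt_0_compat; lra|]. apply Rlt_div_l; lra. }
    assert (hdu : forall x, 0 < x < 1 -> is_derive u x (u1 x) /\ is_derive u1 x (u2 x)).
    { intros x hx. destruct (hC x ltac:(lra)) as (h1 & h2 & _).
      assert (hm : 0 < Rmin x (1 - x)) by (apply Rmin_glb_lt; lra).
      assert (hD : forall y, Rabs (y - x) < Rmin x (1 - x) -> 0 <= y <= 1).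
      { intros y hy. assert (n1 := Rmin_l x (1 - x)). assert (n2 := Rmin_r x (1 - x)).
        apply Rabs_def2 in hy. lra. }
      split; eapply (D_in_interior _ _ _ x _ hm hD); assumption. }
    assert (hu := sol_unique a s (fun r => u (r / s)) (fun r => - u1 (r / s) / s) ha).
    assert (heqs : forall r, 0 < r < s -> u (r / s) = sol a r).
    { intros r hr. apply hu; try assumption.
      - intros t ht. destruct (hdu _ (hin t ht)) as [h1 _].
        auto_derive; [eexists; exact h1|]. change (t * / s) with (t / s).
        derive_values. field. lra.
      - intros t ht. destruct (hdu _ (hin t ht)) as [_ h2].
        assert (he := heq _ (hin t ht)).
        assert (hp := hpos (t / s) ltac:(assert (h := hin t ht); lra)).
        auto_derive; [eexists; exact h2|]. change (t * / s) with (t / s). derive_values.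
        rewrite react_pos_eq by lra. unfold react.
        replace (u2 (t / s)) with (- (2 / (t / s) * u1 (t / s)
          + s * s * (u (t / s) ^ 4 + u (t / s) ^ 7))) by (rewrite hs2; lra).
        field. lra.
      - intros eps he.
        destruct (hC 0 ltac:(lra)) as (h1 & h2 & _).
        destruct (D_in_near _ _ _ _ eps h1 he) as (d1 & hd1 & k1).
        destruct (D_in_near _ _ _ _ (eps * s) h2) as (d2 & hd2 & k2);
          [now apply Rmult_lt_0_compat|].
        assert (n1 := Rmin_l 1 (Rmin d1 d2)). assert (n2 := Rmin_r 1 (Rmin d1 d2)).
        assert (n3 := Rmin_l d1 d2). assert (n4 := Rmin_r d1 d2).
        set (d := Rmin 1 (Rmin d1 d2)) in *.
        assert (hd : 0 < d) by (repeat apply Rmin_glb_lt; lra).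
        exists (s * d). split; [now apply Rmult_lt_0_compat|].
        intros t ht. assert (hts : 0 < t / s < d).
        { split; [apply Rdiv_lt_0_compat; lra|]. apply Rlt_div_l; lra. }
        specialize (k1 (t / s) ltac:(lra) ltac:(apply Rabs_def1; lra)).
        specialize (k2 (t / s) ltac:(lra) ltac:(apply Rabs_def1; lra)).
        rewrite e0. split; [assumption|].
        unfold Rdiv at 1. rewrite Rabs_mult, Rabs_Ropp, (Rabs_pos_eq (/ s))
          by (left; now apply Rinv_0_lt_compat).
        rewrite hu1, Rminus_0_r in k2. apply Rle_div_l; [assumption|]. lra. }
    destruct (hC 1 ltac:(lra)) as (h1 & _ & _).
    apply Rminus_diag_uniq. rewrite Rminus_0_r. apply Rabs_eq_0.
    apply Rle_antisym; [|apply Rabs_pos]. apply le_epsilon. intros eps he.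
    destruct (D_in_near _ _ _ _ eps h1 he) as (d & hd & k).
    assert (m1 := Rmax_l 0 (s - s * d)). assert (m2 := Rmax_r 0 (s - s * d)).
    assert (hm : Rmax 0 (s - s * d) < s) by (apply Rmax_lub_lt; nra).
    rewrite Rplus_0_l.
    apply (le_of_left (fun t => Rabs (sol a t)) _ s eps hm).
    + apply (continuous_comp (sol a) Rabs); [now apply sol_cont|apply continuous_Rabs].
    + intros t ht. rewrite <- heqs by lra. assert (hin' := hin t ltac:(lra)).
      rewrite <- (Rminus_0_r (u (t / s))), <- hu01. apply k; [lra|].
      rewrite Rabs_left1 by lra. apply (Rmult_lt_reg_r s); [assumption|].
      replace (- (t / s - 1) * s) with (s - t) by (field; lra). lra.
  - intros (ha & hlam & h0).
    set (s := sqrt lam) in *. assert (hs : 0 < s) by now apply sqrt_lt_R0.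
    assert (hs2 : s ^ 2 = lam) by (simpl; rewrite Rmult_1_r; apply sqrt_sqrt; lra).
    assert (hp : forall r, 0 <= r < 1 -> 0 < scaled a s r).
    { intros r hr. unfold scaled. rewrite <- h0. apply sol_decr; [assumption|]. nra. }
    exists (scaled a s).
    split; [|simpl; unfold scaled; rewrite Rmult_0_r; symmetry; now apply sol_0].
    split; [assumption|]. exists (scaled' a s), (scaled'' a s). split; [|split; [|split; [|split]]].
    + apply scaled_C2; try assumption. intros; lra.
    + intros r hr. assert (he := scaled''_eq a s hs r ltac:(lra)).
      rewrite hs2, react_pos_eq in he by (left; apply hp; lra). unfold react in he. exact he.
    + unfold scaled'. rewrite Rmult_0_r, slope_0 by assumption. ring.
    + unfold scaled. now rewrite Rmult_1_r.
    + exact hp.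
Qed.

(** Positivity is all that has to be required of a ground state: every [sol a] is decreasing, and
    decay at infinity follows from positivity. *)
Definition global_pos (a : R) : Prop := 0 < a /\ forall r, 0 <= r -> 0 < sol a r.

Lemma not_global_pos_zero a : 0 < a -> ~ global_pos a -> exists w, 0 < w /\ sol a w = 0.
Proof.
  intros ha hn. apply not_and_or in hn. destruct hn as [hn|hn]; [contradiction|].
  apply not_all_ex_not in hn. destruct hn as [r hn]. apply imply_to_and in hn.
  destruct hn as [hr hn].
  destruct (first_zero (sol a) 0 r) as (w & hw & e & _).
  - assumption.
  - intros; now apply sol_cont.
  - rewrite sol_0; assumption.
  - lra.
  - exists w. split; [lra|assumption].
Qed.

Lemma zero_dirichlet a w : 0 < a -> 0 < w -> sol a w = 0 -> dirichlet_points (w ^ 2, a).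
Proof.
  intros ha hw h. apply dirichlet_points_iff. split; [assumption|].
  split; [now apply pow_lt|]. rewrite sqrt_pow2 by lra. assumption.
Qed.

Lemma global_pos_not_dirichlet a lam : global_pos a -> ~ dirichlet_points (lam, a).
Proof.
  intros [ha h] hd. apply dirichlet_points_iff in hd. destruct hd as (_ & _ & h0).
  assert (hp := h (sqrt lam) (sqrt_pos lam)). lra.
Qed.

(** Since [u] decreases, the mean of the reaction over the ball of radius [r] is at least its value
    at [r]. *)
Lemma slope_ge a r : 0 < a -> 0 <= r -> 0 <= sol a r -> r * react (sol a r) / 3 <= slope a r.
Proof.
  intros ha hr h0. destruct (Rle_lt_or_eq_dec _ _ hr) as [h|<-].
  2: { rewrite slope_0 by assumption. lra. }
  assert (hpos : forall t, 0 <= t <= r -> 0 <= sol a t).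
  { intros t ht. apply Rle_trans with (sol a r); [assumption|]. now apply sol_decr_le. }
  assert (hm : - (0 ^ 3 * react (sol a 0) / 3 - 0 ^ 2 * slope a 0)
    <= - (r ^ 3 * react (sol a r) / 3 - r ^ 2 * slope a r)).
  { apply (derive_nonneg_le (fun t => - (t ^ 3 * react (sol a t) / 3 - t ^ 2 * slope a t))
      (fun t => t ^ 3 * (4 * sol a t ^ 3 + 7 * sol a t ^ 6) * slope a t / 3)); [assumption| | |].
    - intros x _.
      unfold react. cont; (apply sol_cont || apply slope_cont); assumption.
    - intros x hx. assert (hs := sol_derive a ha x). assert (hd := slope_derive a ha x ltac:(lra)).
      rewrite react_pos_eq in hd by (apply hpos; lra).
      unfold react in *. derive_hyps. field. lra.
    - intros x hx. assert (hp := hpos x ltac:(lra)). assert (hsl := slope_pos a ha x ltac:(lra)).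
      apply Rmult_le_pos; [|lra]. apply Rmult_le_pos; [|lra].
      apply Rmult_le_pos; [apply pow_le; lra|].
      assert (q1 := pow_le _ 3 hp). assert (q2 := pow_le _ 6 hp). lra. }
  rewrite slope_0 in hm by assumption.
  assert (hr2 : 0 < r ^ 2) by now apply pow_lt.
  apply Rmult_le_reg_l with (r ^ 2); [assumption|]. nra.
Qed.

Section Ground.

Variable a : R.
Hypothesis hg : global_pos a.

Let ha : 0 < a := proj1 hg.
Let hpos : forall r, 0 <= r -> 0 < sol a r := proj2 hg.

(** By [slope_ge], [- u' / u^(k+1) >= c r / 3]; integrating bounds [u^(-k)] below by [c k r^2 / 6].
    The cases [k = 3] and [k = 6] give the decay rates of the two powers. *)
Lemma ground_decay_aux (c : R) (k : nat) (r : R) : 0 <= c -> 0 <= r ->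
  (forall x, 0 < x -> c * x ^ (S k) <= react x) -> c * INR k * r ^ 2 / 6 * sol a r ^ k <= 1.
Proof.
  intros hc hr hle.
  assert (hp : forall t, 0 <= t -> 0 < sol a t ^ k) by (intros; now apply pow_lt, hpos).
  assert (hm : / sol a 0 ^ k - c * INR k * 0 ^ 2 / 6 <= / sol a r ^ k - c * INR k * r ^ 2 / 6).
  { apply (derive_nonneg_le' (fun t => / sol a t ^ k - c * INR k * t ^ 2 / 6)
      (fun t => INR k * (slope a t / sol a t ^ (S k) - c * t / 3))); [assumption| |].
    - intros x hx. assert (hs := sol_derive a ha x). assert (hxp := hpos x ltac:(lra)).
      assert (hxk := hp x ltac:(lra)).
      derive_hyps. destruct k as [|k']; [simpl; field; lra|].
        replace (Nat.pred (S k')) with k' by reflexivity.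
        rewrite <- !tech_pow_Rmult. field. repeat split; try (apply pow_nonzero); lra.
    - intros x hx. apply Rmult_le_pos; [apply pos_INR|].
      assert (hxp := hpos x ltac:(lra)). assert (hsl := slope_ge a x ha ltac:(lra) ltac:(lra)).
      assert (hle' := hle _ hxp).
      assert (hxk : 0 < sol a x ^ S k) by now apply pow_lt.
      assert (c * x / 3 <= slope a x / sol a x ^ S k); [|lra].
      apply (proj1 (Rle_div_r _ _ _ hxk)).
      apply Rle_trans with (x * react (sol a x) / 3); [|assumption].
      replace (c * x / 3 * sol a x ^ S k) with (x * (c * sol a x ^ S k) / 3) by field.
      assert (x * (c * sol a x ^ S k) <= x * react (sol a x)) by (apply Rmult_le_compat_l; lra).
      lra. }
  assert (h0 : 0 < / sol a 0 ^ k) by (apply Rinv_0_lt_compat, hp; lra).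
  assert (hk := hp r hr).
  assert (h1 : c * INR k * r ^ 2 / 6 <= / sol a r ^ k) by lra.
  apply Rle_trans with (/ sol a r ^ k * sol a r ^ k); [|right; field; lra].
  apply Rmult_le_compat_r; lra.
Qed.

Lemma ground_decay_4 r : 0 <= r -> r ^ 2 * sol a r ^ 3 <= 2.
Proof.
  intros hr. assert (h := ground_decay_aux 1 3 r ltac:(lra) hr).
  assert (1 * INR 3 * r ^ 2 / 6 * sol a r ^ 3 <= 1); [|simpl INR in *; lra].
  apply h. intros x hx. unfold react. assert (0 < x ^ 7) by now apply pow_lt. lra.
Qed.

Lemma ground_decay_7 r : 0 <= r -> r ^ 2 * sol a r ^ 6 <= 1.
Proof.
  intros hr. assert (h := ground_decay_aux 1 6 r ltac:(lra) hr).
  assert (1 * INR 6 * r ^ 2 / 6 * sol a r ^ 6 <= 1); [|simpl INR in *; lra].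
  apply h. intros x hx. unfold react. assert (0 < x ^ 4) by now apply pow_lt. lra.
Qed.

(** Equivalently [r u] is nondecreasing: [(r u)'' = - r react u] is negative, and a positive concave
    function on a half-line cannot decrease. *)
Lemma ground_slope_le r : 0 < r -> r * slope a r <= sol a r.
Proof.
  intros hr. apply Rnot_lt_le. intros hlt.
  set (k := r * slope a r - sol a r). assert (hk : 0 < k) by (unfold k; lra).
  assert (h1 : forall t, r <= t -> sol a t - t * slope a t <= - k).
  { intros t ht. assert (- (sol a r - r * slope a r) <= - (sol a t - t * slope a t)); [|unfold k in
      *; lra].
    apply (derive_nonneg_le' (fun t => - (sol a t - t * slope a t))
      (fun t => t * react (sol a t))); [assumption| |].
    - intros x hx. assert (hs := sol_derive a ha x). assert (hd := slope_derive a ha x ltac:(lra)).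
      rewrite react_pos_eq in hd by (left; apply hpos; lra).
      derive_hyps. field. lra.
    - intros x hx. apply Rmult_le_pos; [lra|]. left. apply react_gt0, hpos. lra. }
  (* At this point the line of slope [- k] through the graph of [r u] at [r] has the value [- k]. *)
  set (t := r + r * sol a r / k + 1).
  assert (ht : r <= t).
  { unfold t. assert (0 < r * sol a r / k); [|lra].
    apply Rdiv_lt_0_compat; [|assumption]. apply Rmult_lt_0_compat; [assumption|]. apply hpos; lra.
    }
  assert (h2 : - (r * sol a r + k * r) <= - (t * sol a t + k * t)).
  { apply (derive_nonneg_le' (fun t => - (t * sol a t + k * t))
      (fun t => - (sol a t - t * slope a t + k))); [assumption| |].
    - intros x hx. assert (hs := sol_derive a ha x).
      derive_hyps. ring.
    - intros x hx. specialize (h1 x ltac:(lra)). lra. }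
  assert (h3 : 0 < t * sol a t) by (apply Rmult_lt_0_compat; [lra|apply hpos; lra]).
  assert (h4 : k * t = k * r + r * sol a r + k) by (unfold t; field; lra).
  lra.
Qed.

Lemma global_pos_ground_state : ground_state (scaled a 1).
Proof.
  exists (scaled' a 1), (scaled'' a 1).
  assert (hp : forall r, 0 <= r -> 0 < scaled a 1 r).
  { intros r hr. unfold scaled. rewrite Rmult_1_l. now apply hpos. }
  split; [|split; [|split; [|split; [|split]]]].
  - apply scaled_C2; [assumption|lra|trivial].
  - intros r hr. assert (he := scaled''_eq a 1 Rlt_0_1 r hr).
    rewrite react_pos_eq in he by (left; apply hp; lra). unfold react in he. lra.
  - unfold scaled'. rewrite Rmult_0_r, slope_0 by assumption. ring.
  - exact hp.
  - intros r t hr hrt. unfold scaled. rewrite !Rmult_1_l. apply sol_decr; [assumption|lra].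
  - apply is_lim_spec. intros eps. exists (Rmax 1 (2 / eps ^ 3)). intros r hr.
    assert (he := cond_pos eps).
    assert (h1 := Rmax_l 1 (2 / eps ^ 3)). assert (h2 := Rmax_r 1 (2 / eps ^ 3)).
    unfold scaled. rewrite Rmult_1_l, Rminus_0_r, Rabs_pos_eq by (left; apply hpos; lra).
    apply Rnot_le_lt. intros hle.
    assert (hd := ground_decay_4 r ltac:(lra)).
    assert (he3 : 0 < eps ^ 3) by now apply pow_lt.
    assert (h3 : eps ^ 3 <= sol a r ^ 3) by (apply pow_incr; lra).
    assert (h4 : 2 < r * eps ^ 3).
    { apply Rlt_div_l; [assumption|]. lra. }
    assert (h5 : r * eps ^ 3 <= r ^ 2 * sol a r ^ 3).
    { apply Rmult_le_compat; try lra. simpl. nra. }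
    lra.
Qed.

End Ground.

(** * The Pruefer angle of the difference with the explicit solution *)

Lemma ode_exists (F : R -> R -> R) :
  (forall y, (forall r, continuous y r) -> forall r, continuous (fun s => F s (y s)) r) ->
  (forall X, 0 < X -> exists L, 0 <= L /\ forall s y z, 0 <= s <= X ->
     Rabs (F s y - F s z) <= L * Rabs (y - z)) ->
  exists th : R -> R, th 0 = 0 /\ (forall r, continuous th r) /\
    forall r, 0 < r -> is_derive th r (F r (th r)).
Proof.
  intros hF hL.
  set (T := fun (y : R -> R) r => RInt (fun s => F s (y s)) 0 (Rmax 0 r)).
  assert (hmax : forall r, continuous (Rmax 0) r).
  { intros r. apply lipschitz_continuous with 1; [lra|]. intros y. assert (h := Rmax0_lip y r).
    lra. }
  assert (hd : forall y r, (forall r, continuous y r) ->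
    is_derive (fun t => RInt (fun s => F s (y s)) 0 t) r (F r (y r))).
  { intros y r hy. apply (is_derive_RInt_cont (fun s => F s (y s))). now apply hF. }
  destruct (picard T) as (th & hc & hth).
  - intros y hy r. unfold T.
    apply (continuous_comp (Rmax 0) (fun t => RInt (fun s => F s (y s)) 0 t)); [apply hmax|].
    apply (ex_derive_continuous (fun t => RInt (fun s => F s (y s)) 0 t)). eexists. now apply hd.
  - intros y r hr. unfold T. rewrite !Rmax_left by lra. rewrite !RInt_point. reflexivity.
  - intros X hX. destruct (hL X hX) as (L & hL0 & hl). exists L. split; [assumption|].
    intros y z hy hz r hr. unfold T. rewrite Rmax_right by lra.
    change (RInt (fun s => F s (y s)) 0 r - RInt (fun s => F s (z s)) 0 r)
      with (minus (RInt (fun s => F s (y s)) 0 r) (RInt (fun s => F s (z s)) 0 r)).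
    assert (hFd : forall s, continuous (fun s => minus (F s (y s)) (F s (z s))) s).
    { intros s. apply (continuous_minus (fun s => F s (y s)) (fun s => F s (z s))); now apply hF. }
    assert (hyz : forall s, continuous (fun s => Rabs (y s - z s)) s)
      by (intros; now apply continuous_Rabs_minus).
    rewrite <- RInt_minus by (apply ex_RInt_cont; now apply hF).
    eapply Rle_trans; [apply abs_RInt_le; [lra|now apply ex_RInt_cont]|].
    replace (L * RInt (fun s => Rabs (y s - z s)) 0 r)
      with (scal L (RInt (fun s => Rabs (y s - z s)) 0 r)) by reflexivity.
    rewrite <- RInt_scal by now apply ex_RInt_cont.
    apply RInt_le; [lra| | |].
    + apply ex_RInt_cont. intros s.
      apply (continuous_comp _ Rabs); [apply hFd|apply continuous_Rabs].
    + apply ex_RInt_cont. intros s.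
      apply (continuous_mult (fun _ => L) (fun s => Rabs (y s - z s))); [apply
        continuous_const|apply hyz].
    + intros s hs. apply hl. lra.
  - exists th. split; [|split; [assumption|]].
    + rewrite hth. unfold T. rewrite Rmax_left by lra. now rewrite RInt_point.
    + intros r hr. apply (is_derive_ext_loc (fun t => RInt (fun s => F s (th s)) 0 t)); [|now apply
        hd].
      apply (locally_interval _ r 0 p_infty); simpl; try easy.
      intros t ht _. rewrite (hth t). unfold T. rewrite Rmax_right by lra. reflexivity.
Qed.

(** A class closed under sums and products that contains both variables, so that the Lipschitz bound
    for [react_dd] follows its syntax. *)
Definition lip_fst (A : R) (f : R -> R -> R) : Prop :=
  exists C, 0 <= C /\ forall x y l, 0 <= x <= A -> 0 <= y <= A -> 0 <= l <= A ->
    Rabs (f x l - f y l) <= C * Rabs (x - y) /\ Rabs (f x l) <= C.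

Lemma lip_fst_plus A f g : lip_fst A f -> lip_fst A g -> lip_fst A (fun x l => f x l + g x l).
Proof.
  intros (C & hC & hf) (K & hK & hg). exists (C + K). split; [lra|].
  intros x y l hx hy hl. destruct (hf x y l hx hy hl) as [f1 f2].
  destruct (hg x y l hx hy hl) as [g1 g2].
  split.
  - replace (f x l + g x l - (f y l + g y l)) with ((f x l - f y l) + (g x l - g y l)) by ring.
    eapply Rle_trans; [apply Rabs_triang|]. lra.
  - eapply Rle_trans; [apply Rabs_triang|]. lra.
Qed.

Lemma lip_fst_mult A f g : lip_fst A f -> lip_fst A g -> lip_fst A (fun x l => f x l * g x l).
Proof.
  intros (C & hC & hf) (K & hK & hg). exists (2 * C * K + C * K).
  assert (hCK : 0 <= C * K) by now apply Rmult_le_pos.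
  split; [lra|]. intros x y l hx hy hl.
  destruct (hf x y l hx hy hl) as [f1 f2]. destruct (hg x y l hx hy hl) as [g1 g2].
  destruct (hf y x l hy hx hl) as [_ f3].
  assert (hd := Rabs_pos (x - y)).
  split.
  - replace (f x l * g x l - f y l * g y l) with ((f x l - f y l) * g x l + f y l * (g x l - g y l))
      by ring.
    eapply Rle_trans; [apply Rabs_triang|]. rewrite !Rabs_mult.
    assert (Rabs (f x l - f y l) * Rabs (g x l) <= C * Rabs (x - y) * K)
      by (apply Rmult_le_compat; try apply Rabs_pos; assumption).
    assert (Rabs (f y l) * Rabs (g x l - g y l) <= C * (K * Rabs (x - y)))
      by (apply Rmult_le_compat; try apply Rabs_pos; assumption).
    nra.
  - rewrite Rabs_mult. apply Rle_trans with (C * K); [|lra].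
    apply Rmult_le_compat; try apply Rabs_pos; assumption.
Qed.

Lemma lip_fst_x A : lip_fst A (fun x _ => x).
Proof.
  exists (1 + Rabs A). assert (h := Rabs_pos A). split; [lra|]. intros x y l hx hy hl.
  assert (h1 := Rle_abs A). assert (h2 := Rabs_pos (x - y)).
  split; [nra|]. rewrite Rabs_pos_eq by lra. lra.
Qed.

Lemma lip_fst_l A : lip_fst A (fun _ l => l).
Proof.
  exists (Rabs A). assert (h := Rabs_pos A). split; [lra|]. intros x y l hx hy hl.
  assert (h1 := Rle_abs A). assert (h2 := Rabs_pos (x - y)).
  split; [rewrite Rminus_diag, Rabs_R0; nra|]. rewrite Rabs_pos_eq by lra. lra.
Qed.

Lemma lip_fst_1 A : lip_fst A (fun _ _ => 1).
Proof.
  exists 1. split; [lra|]. intros x y l hx hy hl. assert (h2 := Rabs_pos (x - y)).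
  split; [rewrite Rminus_diag, Rabs_R0; nra|]. rewrite Rabs_R1. lra.
Qed.

Lemma lip_fst_react_dd A : lip_fst A react_dd.
Proof.
  unfold react_dd. simpl pow.
  repeat first [apply lip_fst_x | apply lip_fst_l | apply lip_fst_1
    | apply (lip_fst_plus A) | apply (lip_fst_mult A)].
Qed.

(** The coefficient [q] of [h'' + q h = 0]; the positive parts keep it bounded and nonnegative after
    [sol a] has changed sign. *)
Definition potential (a r : R) : R := react_dd (Rmax 0 (sol a r)) (Rmax 0 (sol 2 r)).
Definition angle_coef (a r : R) : R := (1 + r) * potential a r - 5 / 4 / (1 + r).
(* Pruefer equation for the angle of the vector [(h, (1 + r) h' - h / 2)] with [h = r (u - w)],
   in which the oscillation threshold [(1 + r)^2 q = 1 / 4] is visible.  It makes sense also for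
   [a = 2], where [h] vanishes. *)
Definition angle_rate (a r y : R) : R := / (1 + r) + angle_coef a r * sin y ^ 2.

Lemma sol_2_pos r : 0 <= r -> 0 < sol 2 r.
Proof. intros h. destruct (sol_2 r h) as [-> _]. apply lin_ni_pos. Qed.

Lemma sol_2_cube r : 0 <= r -> sol 2 r ^ 3 = 8 / (36 * r ^ 2 + 1).
Proof. intros h. destruct (sol_2 r h) as [-> _]. apply lin_ni_cube. Qed.

Lemma Rmax0_sol_bound a r : 0 < a -> 0 <= r -> 0 <= Rmax 0 (sol a r) <= Rmax a 2.
Proof.
  intros ha hr. split; [apply Rmax_l|]. apply Rmax_lub.
  - apply Rle_trans with 2; [lra|apply Rmax_r].
  - apply Rle_trans with a; [now apply sol_le|apply Rmax_l].
Qed.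

Lemma Rmax0_sol2_bound a r : 0 <= r -> 0 <= Rmax 0 (sol 2 r) <= Rmax a 2.
Proof.
  intros hr. split; [apply Rmax_l|]. apply Rmax_lub.
  - apply Rle_trans with 2; [lra|apply Rmax_r].
  - apply Rle_trans with 2; [apply sol_le; lra|apply Rmax_r].
Qed.

Lemma potential_bound a : 0 < a -> exists B, 0 <= B /\ forall r, 0 <= r -> 0 <= potential a r <= B.
Proof.
  intros ha. set (A := Rmax a 2). assert (hA : 2 <= A) by apply Rmax_r.
  exists (4 * A ^ 3 + 7 * A ^ 6).
  assert (q1 : 0 <= A ^ 3) by (apply pow_le; lra). assert (q2 : 0 <= A ^ 6) by (apply pow_le; lra).
  split; [lra|]. intros r hr.
  apply react_dd_bound; [now apply Rmax0_sol_bound|now apply Rmax0_sol2_bound].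
Qed.

Lemma potential_cont a r : 0 < a -> continuous (potential a) r.
Proof.
  intros ha. unfold potential.
  set (f := fun t => Rmax 0 (sol a t)). set (g := fun t => Rmax 0 (sol 2 t)).
  assert (hf : continuous f r) by (apply Rmax0_cont, sol_cont; lra).
  assert (hg : continuous g r) by (apply Rmax0_cont, sol_cont; lra).
  change (continuous (fun t => react_dd (f t) (g t)) r). unfold react_dd. cont.
Qed.

Lemma sin2_lip y z : Rabs (sin y ^ 2 - sin z ^ 2) <= 2 * Rabs (y - z).
Proof.
  assert (h : Rabs (sin y - sin z) <= Rabs (y - z)).
  { destruct (MVT_gen sin z y cos) as (c & _ & e).
    - intros x _. apply is_derive_sin.
    - intros x _. apply continuity_sin.
    - rewrite e, Rabs_mult. assert (hc := COS_bound c). assert (h0 := Rabs_pos (y - z)).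
      assert (Rabs (cos c) <= 1) by (apply Rabs_le_between; lra). nra. }
  replace (sin y ^ 2 - sin z ^ 2) with ((sin y + sin z) * (sin y - sin z)) by ring.
  rewrite Rabs_mult. assert (hy := SIN_bound y). assert (hz := SIN_bound z).
  apply Rmult_le_compat; try apply Rabs_pos; [apply Rabs_le_between; lra|assumption].
Qed.

Lemma sin2_bound y : 0 <= sin y ^ 2 <= 1.
Proof. split; [apply pow2_ge_0|]. assert (h := SIN_bound y). simpl. nra. Qed.

Lemma angle_coef_bound a X : 0 < a -> 0 < X -> exists K, 0 <= K /\
  forall r, 0 <= r <= X -> Rabs (angle_coef a r) <= K.
Proof.
  intros ha hX. destruct (potential_bound a ha) as (B & hB & hb).
  exists ((1 + X) * B + 2). split; [nra|]. intros r hr. specialize (hb r ltac:(lra)).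
  unfold angle_coef.
  assert (h1 : 0 < 5 / 4 / (1 + r) <= 2).
  { split; [apply Rdiv_lt_0_compat; lra|]. apply Rle_div_l; lra. }
  assert (h2 : 0 <= (1 + r) * potential a r <= (1 + X) * B).
  { split; [apply Rmult_le_pos; lra|]. apply Rmult_le_compat; lra. }
  apply Rabs_le_between. lra.
Qed.

Lemma angle_exists a : exists th : R -> R, 0 < a -> th 0 = 0 /\ (forall r, continuous th r) /\
    forall r, 0 < r -> is_derive th r (angle_rate a r (th r)).
Proof.
  destruct (Rlt_dec 0 a) as [ha|ha]; [|exists (fun _ => 0); tauto].
  destruct (ode_exists (fun s => angle_rate a (Rmax 0 s))) as (th & h0 & hc & hd).
  - intros y hy r. assert (hm : continuous (Rmax 0) r) by (apply (Rmax0_cont (fun t => t)),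
      continuous_id).
    assert (hinv : continuous (fun s => / (1 + Rmax 0 s)) r).
    { apply (continuous_comp (Rmax 0) (fun t => / (1 + t))); [assumption|].
      apply (ex_derive_continuous (fun t => / (1 + t))). auto_derive.
      assert (h := Rmax_l 0 r). lra. }
    unfold angle_rate, angle_coef.
    apply (continuous_plus (fun s => / (1 + Rmax 0 s))); [assumption|].
    apply (continuous_mult (fun s => (1 + Rmax 0 s) * potential a (Rmax 0 s) - 5 / 4 / (1 + Rmax 0
      s))
      (fun s => sin (y s) ^ 2)).
    + apply (continuous_minus (fun s => (1 + Rmax 0 s) * potential a (Rmax 0 s))
        (fun s => 5 / 4 / (1 + Rmax 0 s))).
      * apply (continuous_mult (fun s => 1 + Rmax 0 s) (fun s => potential a (Rmax 0 s))).
        -- apply (continuous_plus (fun _ => 1)); [apply continuous_const|assumption].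
        -- apply (continuous_comp (Rmax 0) (potential a)); [assumption|now apply potential_cont].
      * apply (continuous_mult (fun _ => 5 / 4)); [apply continuous_const|assumption].
    + apply (continuous_comp y (fun t => sin t ^ 2)); [apply hy|].
      apply (ex_derive_continuous (fun t => sin t ^ 2)). auto_derive; trivial.
  - intros X hX. destruct (angle_coef_bound a X ha hX) as (K & hK & hk).
    exists (K * 2). split; [lra|]. intros s y z hs. unfold angle_rate.
    rewrite Rmax_right by lra.
    replace (/ (1 + s) + angle_coef a s * sin y ^ 2 - (/ (1 + s) + angle_coef a s * sin z ^ 2))
      with (angle_coef a s * (sin y ^ 2 - sin z ^ 2)) by ring.
    rewrite Rabs_mult, Rmult_assoc.
    apply Rmult_le_compat; try apply Rabs_pos; [now apply hk|apply sin2_lip].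
  - exists th. intros _. split; [assumption|]. split; [assumption|].
    intros r hr. specialize (hd r hr). rewrite Rmax_right in hd by lra. exact hd.
Qed.

Definition angle (a : R) : R -> R :=
  proj1_sig (constructive_indefinite_description _ (angle_exists a)).

Lemma angle_spec a : 0 < a -> angle a 0 = 0 /\ (forall r, continuous (angle a) r) /\
    forall r, 0 < r -> is_derive (angle a) r (angle_rate a r (angle a r)).
Proof. unfold angle. destruct (constructive_indefinite_description _ _). assumption. Qed.

Lemma angle_continuous_param a r eps : 0 < a -> 0 <= r -> 0 < eps ->
  exists d, 0 < d /\ forall b, Rabs (b - a) < d -> 0 < b /\ Rabs (angle b r - angle a r) < eps.
Proof.
  intros ha hr he. destruct (angle_spec a ha) as (a0 & ac & ad).
  destruct (Rle_lt_or_eq_dec _ _ hr) as [hr0|<-].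
  2: { exists a. split; [assumption|]. intros b hb. apply Rabs_def2 in hb.
  assert (hb0 : 0 < b) by lra.
       split; [assumption|]. destruct (angle_spec b hb0) as (b0 & _).
       rewrite a0, b0, Rminus_diag, Rabs_R0.
       assumption. }
  destruct (angle_coef_bound a (r + 1) ha ltac:(lra)) as (K & hK & hk).
  destruct (lip_fst_react_dd (a + 3)) as (C & hC & hlip).
  set (K1 := 4 * K + 1).
  set (E := exp (K1 * r)). assert (hE : 0 < E) by apply exp_pos.
  set (e := Rmin 1 (eps ^ 2 / (4 * E))).
  assert (heps2 : 0 < eps ^ 2) by now apply pow_lt.
  assert (hep : 0 < e) by (apply Rmin_glb_lt; [lra|apply Rdiv_lt_0_compat; lra]).
  assert (he1 : e <= 1) by apply Rmin_l.
  assert (he2 : e * E <= eps ^ 2 / 4).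
  { apply Rle_trans with (eps ^ 2 / (4 * E) * E); [|right; field; lra].
    apply Rmult_le_compat_r; [lra|apply Rmin_r]. }
  set (e' := e / ((2 + r) * (C + 1))).
  assert (he' : 0 < e') by (apply Rdiv_lt_0_compat; [assumption|apply Rmult_lt_0_compat; lra]).
  destruct (sol_continuous_param a (r + 1) e' ha ltac:(lra) he') as (d & hd & hh).
  exists (Rmin d 1). split; [apply Rmin_glb_lt; lra|]. intros b hb.
  assert (m1 := Rmin_l d 1). assert (m2 := Rmin_r d 1).
  destruct (hh b ltac:(lra)) as [hb0 hnear]. split; [assumption|].
  destruct (angle_spec b hb0) as (b0 & bc & bd).
  apply Rabs_def2 in hb.
  assert (hcoef : forall s, 0 <= s <= r + 1 -> Rabs (angle_coef b s - angle_coef a s) <= e).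
  { intros s hs. destruct (hnear s hs) as [hns _].
    unfold angle_coef, potential.
    replace ((1 + s) * react_dd (Rmax 0 (sol b s)) (Rmax 0 (sol 2 s)) - 5 / 4 / (1 + s)
      - ((1 + s) * react_dd (Rmax 0 (sol a s)) (Rmax 0 (sol 2 s)) - 5 / 4 / (1 + s)))
    with ((1 + s) * (react_dd (Rmax 0 (sol b s)) (Rmax 0 (sol 2 s))
      - react_dd (Rmax 0 (sol a s)) (Rmax 0 (sol 2 s)))) by ring.
    rewrite Rabs_mult, (Rabs_pos_eq (1 + s)) by lra.
    assert (k1 := sol_le a ha s ltac:(lra)). assert (k2 := sol_le b hb0 s ltac:(lra)).
    assert (k3 := sol_le 2 ltac:(lra) s ltac:(lra)).
    destruct (hlip (Rmax 0 (sol b s)) (Rmax 0 (sol a s)) (Rmax 0 (sol 2 s))) as [hl _];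
      try (split; [apply Rmax_l|apply Rmax_lub; lra]).
    assert (hm := Rmax0_lip (sol b s) (sol a s)).
    assert (h5 : C * Rabs (Rmax 0 (sol b s) - Rmax 0 (sol a s)) <= (C + 1) * e').
    { apply Rmult_le_compat; try lra. apply Rabs_pos. }
    apply Rle_trans with ((2 + r) * ((C + 1) * e')).
    - apply Rmult_le_compat; try lra. apply Rabs_pos.
    - right. unfold e'. field. lra. }
  (* Adding [e ^ 2] makes the inequality homogeneous: with [y] the absolute difference of the
     angles, [2 y (2 K y + e) <= (4 K + 1) (y^2 + e^2)]. *)
  assert (hN : (angle b r - angle a r) ^ 2 + e ^ 2 <= e ^ 2 * exp (K1 * r)).
  { apply (gronwall (fun s => (angle b s - angle a s) ^ 2 + e ^ 2)
      (fun s => 2 * (angle b s - angle a s) * (angle_rate b s (angle b s) - angle_rate a s (angle a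
        s)))
      (r + 1)); try (unfold K1; lra); try apply pow2_ge_0.
    - intros s hs. assert (h1 := ad s ltac:(lra)). assert (h2 := bd s ltac:(lra)).
      derive_hyps. ring.
    - intros s hs. assert (hc := hcoef s ltac:(lra)). assert (hka := hk s ltac:(lra)).
      unfold angle_rate. set (x := angle b s) in *. set (y := angle a s) in *.
      assert (hsl := sin2_lip x y). assert (hsb := sin2_bound x).
      set (kb := angle_coef b s) in *. set (ka := angle_coef a s) in *.
      assert (hdiff : Rabs (/ (1 + s) + kb * sin x ^ 2 - (/ (1 + s) + ka * sin y ^ 2))
        <= K * (2 * Rabs (x - y)) + e).
      { replace (/ (1 + s) + kb * sin x ^ 2 - (/ (1 + s) + ka * sin y ^ 2))
          with (ka * (sin x ^ 2 - sin y ^ 2) + (kb - ka) * sin x ^ 2) by ring.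
        eapply Rle_trans; [apply Rabs_triang|].
        rewrite !Rabs_mult, (Rabs_pos_eq (sin x ^ 2)) by lra.
        apply Rplus_le_compat.
        - apply Rmult_le_compat; try apply Rabs_pos; assumption.
        - assert (h0 := Rabs_pos (kb - ka)). nra. }
      set (q := / (1 + s) + kb * sin x ^ 2 - (/ (1 + s) + ka * sin y ^ 2)) in *.
      set (u := Rabs (x - y)) in *. assert (hu : 0 <= u) by apply Rabs_pos.
      assert (hu2 : (x - y) ^ 2 = u ^ 2) by (unfold u; now rewrite pow2_abs).
      assert (hxq : (x - y) * q <= u * (K * (2 * u) + e)).
      { apply Rle_trans with (Rabs ((x - y) * q)); [apply Rle_abs|]. rewrite Rabs_mult.
        apply Rmult_le_compat_l; assumption. }
      rewrite hu2. unfold K1. assert (h0 := pow2_ge_0 (u - e)). nra.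
    - intros eta heta.
      assert (hc : continuous (fun s => (angle b s - angle a s) ^ 2) 0).
      { apply (continuous_comp (fun s => angle b s - angle a s) (fun z => z ^ 2)).
        - apply (continuous_minus (angle b) (angle a)); [apply bc|apply ac].
        - apply (ex_derive_continuous (fun z => z ^ 2)). auto_derive; trivial. }
      destruct (continuous_bound_above _ _ eta hc) as (d0 & hd0 & h0).
      { rewrite a0, b0. replace ((0 - 0) ^ 2) with 0 by ring. assumption. }
      exists d0. split; [assumption|]. intros s hs.
      specialize (h0 s ltac:(apply Rabs_def1; lra)). lra. }
  fold E in hN.
  assert (h2 : e ^ 2 * E <= eps ^ 2 / 4) by (simpl; nra).
  assert (h3 := pow2_ge_0 e).
  rewrite <- (Rabs_pos_eq eps) by lra. apply Rsqr_lt_abs_0. unfold Rsqr. nra.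
Qed.

(** At a multiple of [PI] the rate is [1 / (1 + r)], whatever the coefficient, so such levels are
    only crossed upwards. *)
Lemma angle_barrier a c k r s : 0 < a -> c = IZR k * PI -> 0 < r < s -> c <= angle a r -> c < angle
  a s.
Proof.
  intros ha hc hr h. destruct (angle_spec a ha) as (a0 & ac & ad).
  assert (0 < angle a s - c); [|lra].
  apply (barrier (fun t => angle a t - c) r s); try lra.
  - intros x _. apply (continuous_minus (angle a) (fun _ => c)); [apply ac|apply continuous_const].
  - intros x hx h0. exists (/ (1 + x)). split; [apply Rinv_0_lt_compat; lra|].
    assert (hd := ad x ltac:(lra)). unfold angle_rate in hd.
    replace (angle a x) with c in hd by lra.
    rewrite hc, sin_eq_0_1 in hd by (now exists k).
    derive_hyps. ring.
Qed.

(** The rate is at least [k0 / (1 + r)], so the angle grows at least like [k0 ln (1 + r)]. The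
    number 1/4 is the constant of Euler's equation [h'' + c h / (1 + r)^2 = 0] above which solutions
    oscillate. *)
Lemma angle_unbounded a r1 k0 c : 0 < a -> 0 <= r1 -> 0 < k0 <= 1 ->
  (forall r, r1 <= r -> 1 / 4 + k0 <= (1 + r) ^ 2 * potential a r) ->
  exists r, r1 < r /\ c < angle a r.
Proof.
  intros ha hr1 hk h. destruct (angle_spec a ha) as (a0 & ac & ad).
  set (p := r1 + 1).
  set (r := (1 + p) * exp (Rmax 1 ((c - angle a p + 1) / k0)) - 1).
  assert (hm1 := Rmax_l 1 ((c - angle a p + 1) / k0)).
  assert (hm2 := Rmax_r 1 ((c - angle a p + 1) / k0)).
  set (m := Rmax 1 ((c - angle a p + 1) / k0)) in *.
  assert (hexp : 1 < exp m) by (rewrite <- exp_0; apply exp_increasing; lra).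
  assert (hpr : p < r) by (unfold r; unfold p in *; nra).
  exists r. split; [unfold p in *; lra|].
  assert (hle : angle a p - k0 * ln (1 + p) <= angle a r - k0 * ln (1 + r)).
  { apply (derive_nonneg_le' (fun t => angle a t - k0 * ln (1 + t))
      (fun t => angle_rate a t (angle a t) - k0 / (1 + t))); [lra| |].
    - intros x hx. unfold p in hx. assert (hd := ad x ltac:(lra)).
      derive_hyps. field. lra.
    - intros x hx. unfold p in hx. specialize (h x ltac:(lra)).
      unfold angle_rate, angle_coef. assert (hs := sin2_bound (angle a x)).
      set (z := sin (angle a x) ^ 2) in *. set (q := potential a x) in *.
      replace (/ (1 + x) + ((1 + x) * q - 5 / 4 / (1 + x)) * z - k0 / (1 + x))
        with ((1 + ((1 + x) ^ 2 * q - 5 / 4) * z - k0) / (1 + x)) by (field; lra).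
      apply Rdiv_le_0_compat; [|lra]. nra. }
  assert (hln : ln (1 + r) = ln (1 + p) + m).
  { replace (1 + r) with ((1 + p) * exp m) by (unfold r; ring).
    rewrite ln_mult, ln_exp; [reflexivity|unfold p; lra|apply exp_pos]. }
  rewrite hln in hle.
  assert (c - angle a p + 1 <= k0 * m).
  { replace (c - angle a p + 1) with (k0 * ((c - angle a p + 1) / k0)) by (field; lra).
    apply Rmult_le_compat_l; lra. }
  lra.
Qed.

Lemma angle_2_unbounded c : exists r, 0 < r /\ c < angle 2 r.
Proof.
  (* The surplus over the threshold is [8 / 9 - 1 / 4 = 23 / 36]. *)
  apply (angle_unbounded 2 0 (23/36)); try lra.
  intros r hr. assert (hp := sol_2_pos r hr). assert (hc := sol_2_cube r hr).
  unfold potential. rewrite Rmax_right by lra. unfold react_dd.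
  set (u := sol 2 r) in *.
  assert (h6 : 0 <= u ^ 6) by (apply pow_le; lra).
  assert (h3 : (1 + r) ^ 2 * (4 * u ^ 3) >= 8 / 9).
  { rewrite hc. apply Rle_ge. assert (hd := lin_ni_den_pos r).
    replace ((1 + r) ^ 2 * (4 * (8 / (36 * r ^ 2 + 1)))) with (32 * (1 + r) ^ 2 / (36 * r ^ 2 + 1))
      by (field; lra).
    apply (proj1 (Rle_div_r _ _ _ hd)). nra. }
  assert (hr2 : 0 <= (1 + r) ^ 2) by apply pow2_ge_0.
  assert (0 <= (1 + r) ^ 2 * (7 * u ^ 6)) by (apply Rmult_le_pos; lra).
  replace ((1 + r) ^ 2 * (u ^ 3 + u ^ 2 * u + u * u ^ 2 + u ^ 3 + (u ^ 6 + u ^ 5 * u + u ^ 4 * u ^ 2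
    + u ^ 3 * u ^ 3 + u ^ 2 * u ^ 4 + u * u ^ 5 + u ^ 6)))
  with ((1 + r) ^ 2 * (4 * u ^ 3) + (1 + r) ^ 2 * (7 * u ^ 6)) by ring.
  lra.
Qed.

(** [W] is the determinant of the vector [(h, (1 + r) h' - h / 2)] and of the unit vector
    [(sin, cos)] of the angle. It solves a homogeneous linear equation and vanishes at 0, so the two
    stay parallel. This avoids dividing by the length of the first vector, which vanishes for
    [a = 2]. *)
Lemma angle_zero a r : 0 < a -> 0 < r -> 0 <= sol a r -> sin (angle a r) = 0 -> sol a r = sol 2 r.
Proof.
  intros ha hr hpos hsin. destruct (angle_spec a ha) as (a0 & ac & ad).
  set (h := fun t => t * (sol a t - sol 2 t)).
  set (h1 := fun t => sol a t - sol 2 t - t * (slope a t - slope 2 t)).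
  set (W := fun t => h t * cos (angle a t) - ((1 + t) * h1 t - h t / 2) * sin (angle a t)).
  assert (hWc : forall t, continuous W t).
  { intros t.
    assert (c1 := sol_cont a ha t). assert (c2 := sol_cont 2 ltac:(lra) t).
    assert (c3 := slope_cont a ha t). assert (c4 := slope_cont 2 ltac:(lra) t).
    assert (cth := ac t). unfold W, h, h1. cont. }
  set (cf := fun t => (1 / 2 - (5 / 4 - (1 + t) ^ 2 * potential a t) * (sin (angle a t) * cos (angle
    a t)))
     / (1 + t)).
  assert (hWd : forall t, 0 < t < r -> is_derive W t (cf t * W t)).
  { intros t ht.
    assert (d1 := sol_derive a ha t). assert (d2 := sol_derive 2 ltac:(lra) t).
    assert (d3 := slope_derive a ha t ltac:(lra)).
    assert (d4 := slope_derive 2 ltac:(lra) t ltac:(lra)).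
    assert (dth := ad t ltac:(lra)).
    assert (hpt : 0 <= sol a t).
    { apply Rle_trans with (sol a r); [assumption|]. apply sol_decr_le; [assumption|lra]. }
    assert (hp2 := sol_2_pos t ltac:(lra)).
    rewrite react_pos_eq in d3 by assumption. rewrite react_pos_eq in d4 by lra.
    assert (hdd : react (sol a t) = react (sol 2 t) + potential a t * (sol a t - sol 2 t)).
    { unfold potential. rewrite !Rmax_right by lra.
      assert (e := react_dd_spec (sol a t) (sol 2 t)). lra. }
    rewrite hdd in d3. unfold W, h, h1, cf.
    unfold angle_rate, angle_coef in dth. set (q := potential a t) in *.
    derive_hyps. set (S := sin (angle a t)). set (Cc := cos (angle a t)).
    assert (hSC : Cc ^ 2 = 1 - S ^ 2).
    { assert (e := sin2_cos2 (angle a t)). unfold Rsqr in e. fold S Cc in e. simpl. lra. }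
    set (D := sol a t - sol 2 t) in *. set (e := slope a t - slope 2 t) in *.
    set (RHS := (1 / 2 - (5 / 4 - (1 + t) ^ 2 * q) * (S * Cc)) / (1 + t)
      * (t * D * Cc - ((1 + t) * (D - t * e) - t * D / 2) * S)).
    transitivity (RHS + t * D * ((1 + t) ^ 2 * q - 5 / 4) * S * (1 - S ^ 2 - Cc ^ 2) / (1 + t)).
    - unfold RHS, D, e. field. lra.
    - rewrite hSC. unfold RHS. field. lra. }
  destruct (potential_bound a ha) as (B & hB & hb).
  assert (hcf : forall t, 0 < t < r -> Rabs (cf t) <= 1 / 2 + (5 / 4 + (1 + r) ^ 2 * B)).
  { intros t ht. unfold cf. specialize (hb t ltac:(lra)).
    set (q := potential a t) in *. set (x := sin (angle a t) * cos (angle a t)).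
    assert (hx : -1 <= x <= 1).
    { unfold x. assert (e1 := SIN_bound (angle a t)). assert (e2 := COS_bound (angle a t)). nra. }
    assert (hq : 0 <= (1 + t) ^ 2 * q <= (1 + r) ^ 2 * B).
    { assert (0 <= (1 + t) ^ 2 <= (1 + r) ^ 2) by (split; [apply pow2_ge_0|apply pow_incr; lra]).
      split; [apply Rmult_le_pos; lra|apply Rmult_le_compat; lra]. }
    set (Q := (1 + t) ^ 2 * q) in *. set (QB := (1 + r) ^ 2 * B) in *.
    unfold Rdiv at 1. rewrite Rabs_mult, (Rabs_pos_eq (/ (1 + t)))
      by (left; apply Rinv_0_lt_compat; lra).
    apply Rle_div_l; [lra|].
    apply Rle_trans with (1 / 2 + (5 / 4 + QB)).
    - apply Rabs_le_between. nra.
    - nra. }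
  assert (hW0 : forall t, 0 < t < r -> W t = 0).
  { apply (zero_of_linear W (fun t => cf t * W t) r (1 / 2 + (5 / 4 + (1 + r) ^ 2 * B))).
    - assert (0 <= (1 + r) ^ 2 * B) by (apply Rmult_le_pos; [apply pow2_ge_0|assumption]). lra.
    - assumption.
    - intros t ht. rewrite Rabs_mult. apply Rmult_le_compat_r; [apply Rabs_pos|now apply hcf].
    - apply hWc.
    - unfold W, h. rewrite a0, sin_0. ring. }
  assert (hWr : W r = 0).
  { apply Rle_antisym.
    - apply (le_of_left W 0 r 0 hr (hWc r)). intros t ht. rewrite hW0 by lra. lra.
    - apply Ropp_le_cancel. rewrite Ropp_0.
      apply (le_of_left (fun t => - W t) 0 r 0 hr); [apply cont_opp, hWc|].
      intros t ht. rewrite hW0 by lra. lra. }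
  unfold W, h in hWr. rewrite hsin in hWr.
  assert (hcos : cos (angle a r) <> 0).
  { intros hc. assert (e := sin2_cos2 (angle a r)). unfold Rsqr in e. rewrite hsin, hc in e. lra. }
  assert (h3 : r * (sol a r - sol 2 r) * cos (angle a r) = 0) by lra.
  apply Rmult_integral in h3. destruct h3 as [h3|h3]; [|contradiction].
  apply Rmult_integral in h3. destruct h3 as [h3|h3]; lra.
Qed.

(** * Energy of ground states in Fowler variables *)

(* [rad t] is the cube root of [r = exp t]; every power of [r] in the Fowler variables
   is then an integral power of [rad t]. *)
Definition rad (t : R) : R := exp (t / 3).

Lemma rad_pos t : 0 < rad t.
Proof. apply exp_pos. Qed.

Lemma rad_derive t : is_derive rad t (rad t / 3).
Proof. unfold rad. auto_derive; [trivial|]. unfold Rdiv. ring. Qed.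

Lemma rad_incr s t : s <= t -> rad s <= rad t.
Proof.
  intros h. unfold rad. destruct (Req_dec s t) as [->|n]; [lra|]. left. apply exp_increasing. lra.
Qed.

Lemma rad_ln r : 0 < r -> rad (ln r) ^ 3 = r.
Proof.
  intros h. unfold rad. rewrite exp_third_cube. now apply exp_ln.
Qed.

Lemma rad_large c : exists T, forall t, T <= t -> c <= rad t.
Proof.
  exists (3 * c). intros t ht. unfold rad. assert (h := exp_ineq1_le (t / 3)). lra.
Qed.

(** With [r = exp t] this is [v = r^(2/3) u], the scaling of [u^4]; while [u >= 0],
    [v'' = v' / 3 + 2 / 9 v - v^4 - v^7 / r^2]. The positive coefficient of [v'] is the negative
    damping. *)
Definition fow (a t : R) : R := rad t ^ 2 * sol a (rad t ^ 3).
Definition fow' (a t : R) : R :=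
  rad t ^ 2 * (2 / 3 * sol a (rad t ^ 3) - rad t ^ 3 * slope a (rad t ^ 3)).

Lemma rad3_pos t : 0 < rad t ^ 3.
Proof. apply pow_lt, rad_pos. Qed.

Lemma rad3_derive t : is_derive (fun t => rad t ^ 3) t (rad t ^ 3).
Proof.
  assert (h := rad_derive t). derive_hyps. field.
Qed.

Lemma sol_rad_derive a t : 0 < a ->
  is_derive (fun t => sol a (rad t ^ 3)) t (- (rad t ^ 3 * slope a (rad t ^ 3))).
Proof.
  intros ha. replace (- (rad t ^ 3 * slope a (rad t ^ 3)))
    with (rad t ^ 3 * (- slope a (rad t ^ 3))) by ring.
  apply (is_derive_comp (sol a) (fun t => rad t ^ 3)); [now apply sol_derive|apply rad3_derive].
Qed.

Lemma slope_rad_derive a t : 0 < a -> is_derive (fun t => slope a (rad t ^ 3)) t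
  (rad t ^ 3 * react_pos (sol a (rad t ^ 3)) - 2 * slope a (rad t ^ 3)).
Proof.
  intros ha. assert (h3 := rad3_pos t). assert (hr := rad_pos t).
  replace (rad t ^ 3 * react_pos (sol a (rad t ^ 3)) - 2 * slope a (rad t ^ 3))
    with (rad t ^ 3 * (react_pos (sol a (rad t ^ 3)) - 2 / rad t ^ 3 * slope a (rad t ^ 3)))
    by (field; lra).
  apply (is_derive_comp (slope a) (fun t => rad t ^ 3)); [now apply slope_derive|apply rad3_derive].
Qed.

Lemma fow_derive a t : 0 < a -> is_derive (fow a) t (fow' a t).
Proof.
  intros ha. assert (h := rad_derive t). assert (hs := sol_rad_derive a t ha).
  unfold fow, fow'. set (u := fun t => sol a (rad t ^ 3)) in *.
  change (is_derive u t (- (rad t ^ 3 * slope a (rad t ^ 3)))) in hs.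
  change (is_derive (fun t => rad t ^ 2 * u t) t
    (rad t ^ 2 * (2 / 3 * u t - rad t ^ 3 * slope a (rad t ^ 3)))).
  derive_hyps. field.
Qed.

Lemma fow_cont a t : 0 < a -> continuous (fow a) t.
Proof. intros ha. apply (ex_derive_continuous (fow a)). eexists. now apply fow_derive. Qed.

Lemma fow'_derive a t : 0 < a -> 0 <= sol a (rad t ^ 3) ->
  is_derive (fow' a) t
    (fow' a t / 3 + 2 / 9 * fow a t - fow a t ^ 4 - fow a t ^ 7 / rad t ^ 6).
Proof.
  intros ha hp. assert (h := rad_derive t). assert (hs := sol_rad_derive a t ha).
  assert (hr := rad_pos t).
  assert (hd := slope_rad_derive a t ha).
  rewrite react_pos_eq in hd by assumption. unfold react in hd.
  unfold fow', fow. set (u := fun t => sol a (rad t ^ 3)) in *.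
  set (m := fun t => slope a (rad t ^ 3)) in *.
  change (is_derive u t (- (rad t ^ 3 * m t))) in hs.
  change (is_derive m t (rad t ^ 3 * (u t ^ 4 + u t ^ 7) - 2 * m t)) in hd.
  change (sol a (rad t ^ 3)) with (u t) in *. change (slope a (rad t ^ 3)) with (m t) in *.
  change (is_derive (fun t => rad t ^ 2 * (2 / 3 * u t - rad t ^ 3 * m t)) t
    (rad t ^ 2 * (2 / 3 * u t - rad t ^ 3 * m t) / 3 + 2 / 9 * (rad t ^ 2 * u t)
     - (rad t ^ 2 * u t) ^ 4 - (rad t ^ 2 * u t) ^ 7 / rad t ^ 6)).
  derive_hyps. field. lra.
Qed.

Lemma global_pos_2 : global_pos 2.
Proof. split; [lra|]. intros r hr. now apply sol_2_pos. Qed.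

Section GroundFowler.

Variable a : R.
Hypothesis hg : global_pos a.

Let ha : 0 < a := proj1 hg.

Lemma ground_at t : 0 < sol a (rad t ^ 3).
Proof. apply hg. left. apply rad3_pos. Qed.

Lemma fow_pos t : 0 < fow a t.
Proof. unfold fow. apply Rmult_lt_0_compat; [apply pow_lt, rad_pos|apply ground_at]. Qed.

Lemma fow_cube_le t : fow a t ^ 3 <= 2.
Proof.
  unfold fow. assert (h := ground_decay_4 a hg (rad t ^ 3) ltac:(left; apply rad3_pos)).
  rewrite Rpow_mult_distr. replace ((rad t ^ 2) ^ 3) with ((rad t ^ 3) ^ 2) by ring. exact h.
Qed.

Lemma fow_lt t : fow a t < 127 / 100.
Proof.
  assert (h := fow_cube_le t). assert (hp := fow_pos t). apply Rnot_le_lt. intros hle.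
  assert ((127 / 100) ^ 3 <= fow a t ^ 3) by (apply pow_incr; lra). lra.
Qed.

(** The upper bound expresses that [u] decreases, the lower one that [r u] does not. *)
Lemma fow'_bounds t : - fow a t / 3 <= fow' a t <= 2 / 3 * fow a t.
Proof.
  assert (hr2 : 0 < rad t ^ 2) by apply pow_lt, rad_pos. assert (hr3 := rad3_pos t).
  assert (h1 := ground_slope_le a hg (rad t ^ 3) hr3).
  assert (h2 := slope_pos a ha (rad t ^ 3) hr3).
  assert (h3 : 0 < rad t ^ 3 * slope a (rad t ^ 3)) by now apply Rmult_lt_0_compat.
  unfold fow, fow'. set (m := rad t ^ 3 * slope a (rad t ^ 3)) in *.
  set (u := sol a (rad t ^ 3)) in *. set (p := rad t ^ 2) in *. split; nra.
Qed.

Lemma fow'_derive_ground t : is_derive (fow' a) t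
    (fow' a t / 3 + 2 / 9 * fow a t - fow a t ^ 4 - fow a t ^ 7 / rad t ^ 6).
Proof. apply fow'_derive; [assumption|]. left. apply ground_at. Qed.

(* The Fowler energy; the term [/ rad t ^ 6] compensates the non-autonomous term
   [v^8 / (8 r^2)], which makes it nondecreasing. *)
Definition energy (t : R) : R :=
  fow' a t ^ 2 / 2 - fow a t ^ 2 / 9 + fow a t ^ 5 / 5 + fow a t ^ 8 / (8 * rad t ^ 6) - / rad t ^
    6.

Lemma energy_derive t : is_derive energy t
  (fow' a t ^ 2 / 3 + (2 - fow a t ^ 8 / 4) / rad t ^ 6).
Proof.
  assert (h := rad_derive t). assert (h1 := fow_derive a t ha). assert (h2 := fow'_derive_ground t).
  assert (hr := rad_pos t). assert (hr6 : 0 < rad t ^ 6) by now apply pow_lt.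
  unfold energy. derive_hyps. field. lra.
Qed.

Lemma fow_8_le t : 0 < fow a t ^ 8 < 8.
Proof.
  assert (hp := fow_pos t). assert (hl := fow_lt t). assert (h3 := fow_cube_le t).
  split; [now apply pow_lt|].
  replace (fow a t ^ 8) with (fow a t ^ 3 * fow a t ^ 3 * fow a t ^ 2) by ring.
  assert (q3 : 0 < fow a t ^ 3) by now apply pow_lt.
  assert (q6 : fow a t ^ 3 * fow a t ^ 3 <= 4) by nra.
  assert (q2 : 0 < fow a t ^ 2 < 2) by (split; [now apply pow_lt|simpl; nra]). nra.
Qed.

Lemma energy_derive_ge t : fow' a t ^ 2 / 3 <= fow' a t ^ 2 / 3 + (2 - fow a t ^ 8 / 4) / rad t ^ 6.
Proof.
  assert (h := fow_8_le t). assert (hr6 : 0 < rad t ^ 6) by apply pow_lt, rad_pos.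
  assert (0 <= (2 - fow a t ^ 8 / 4) / rad t ^ 6) by (apply Rdiv_le_0_compat; lra). lra.
Qed.

Lemma energy_gain (c s t : R) : s <= t ->
  (forall x, s <= x <= t -> c <= fow' a x ^ 2 / 3) -> energy s + c * (t - s) <= energy t.
Proof.
  intros hst h.
  assert (energy s - c * s <= energy t - c * t); [|lra].
  apply (derive_nonneg_le' (fun x => energy x - c * x)
    (fun x => fow' a x ^ 2 / 3 + (2 - fow a x ^ 8 / 4) / rad x ^ 6 - c)); [assumption| |].
  - intros x _. assert (hd := energy_derive x). derive_hyps. ring.
  - intros x hx. specialize (h x hx). assert (h' := energy_derive_ge x). lra.
Qed.

Lemma energy_mono s t : s <= t -> energy s <= energy t.
Proof.
  intros h. assert (h' := energy_gain 0 s t h). rewrite Rmult_0_l, Rplus_0_r in h'. apply h'.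
  intros x _. assert (h0 := pow2_ge_0 (fow' a x)). lra.
Qed.

(** Energy of the limit equation at infinity, without the term [v^7 / r^2]. *)
Definition autonomous_energy (v v' : R) : R := v' ^ 2 / 2 - v ^ 2 / 9 + v ^ 5 / 5.

Lemma energy_close t :
  energy t <= autonomous_energy (fow a t) (fow' a t) <= energy t + / rad t ^ 6.
Proof.
  assert (hr := rad_pos t). assert (hr6 : 0 < rad t ^ 6) by now apply pow_lt.
  assert (h8 := fow_8_le t). unfold energy, autonomous_energy.
  assert (h : 0 <= fow a t ^ 8 / (8 * rad t ^ 6) <= / rad t ^ 6).
  { split; [apply Rdiv_le_0_compat; lra|].
    replace (fow a t ^ 8 / (8 * rad t ^ 6)) with (fow a t ^ 8 / 8 * / rad t ^ 6) by (field; lra).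
    assert (hi : 0 < / rad t ^ 6) by now apply Rinv_0_lt_compat. nra. }
  lra.
Qed.

(* Pohozaev's functional [r^3 (u'^2/2 + F u) + r^2 u u'/2] in the Fowler variables. *)
Definition pohozaev (t : R) : R :=
  (fow' a t ^ 2 / 2 - fow a t ^ 2 / 9 + fow a t ^ 5 / 5 + fow a t ^ 8 / (8 * rad t ^ 6)
   - fow a t * fow' a t / 6) / rad t.

Lemma pohozaev_derive t : is_derive pohozaev t
  (fow a t ^ 5 * (/ 10 - fow a t ^ 3 / (8 * rad t ^ 6)) / rad t).
Proof.
  assert (h := rad_derive t). assert (h1 := fow_derive a t ha). assert (h2 := fow'_derive_ground t).
  assert (hr := rad_pos t). assert (hr6 : 0 < rad t ^ 6) by now apply pow_lt.
  unfold pohozaev. derive_hyps. field. lra.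
Qed.

(** Once [r^2 >= 3], the bound [v^3 <= 2] makes [pohozaev] nondecreasing. Its numerator is at most
    4, so a positive value could not survive the factor [r^(-1/3)]. *)
Lemma pohozaev_nonpos t : 3 <= rad t ^ 6 -> pohozaev t <= 0.
Proof.
  intros hT. apply Rnot_lt_le. intros hpos.
  assert (hmono : forall s, t <= s -> pohozaev t <= pohozaev s).
  { intros s hs. eapply (derive_nonneg_le' pohozaev _ t s hs); [intros x _; apply pohozaev_derive|].
    intros x hx. assert (hr := rad_pos x). assert (hrt := rad_pos t).
    assert (h6 : 3 <= rad x ^ 6).
    { apply Rle_trans with (rad t ^ 6); [assumption|]. apply pow_incr.
      split; [lra|apply rad_incr; lra]. }
    assert (hp := fow_pos x). assert (h3 := fow_cube_le x).
    assert (hp5 : 0 < fow a x ^ 5) by now apply pow_lt.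
    apply Rdiv_le_0_compat; [|assumption]. apply Rmult_le_pos; [lra|].
    assert (fow a x ^ 3 / (8 * rad x ^ 6) <= / 10); [|lra].
    apply Rle_div_l; lra. }
  destruct (rad_large (8 / pohozaev t + rad t)) as (S & hS).
  set (s := Rmax S t). specialize (hS s (Rmax_l S t)).
  specialize (hmono s (Rmax_r S t)).
  assert (hr := rad_pos s). assert (hrt := rad_pos t).
  assert (h8 := fow_8_le s). assert (hl := fow_lt s). assert (hp := fow_pos s).
  assert (hb := fow'_bounds s). assert (h3 := fow_cube_le s).
  assert (hr6 : 3 <= rad s ^ 6).
  { apply Rle_trans with (rad t ^ 6); [assumption|]. apply pow_incr. split; [lra|].
    apply rad_incr, Rmax_r. }
  assert (hnum : pohozaev s * rad s <= 4).
  { unfold pohozaev. rewrite Rmult_comm. unfold Rdiv at 1.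
    rewrite <- Rmult_assoc, Rinv_r_simpl_m by lra.
    assert (e1 : fow a s ^ 8 / (8 * rad s ^ 6) <= 1) by (apply Rle_div_l; lra).
    assert (e2 : fow' a s ^ 2 <= 1) by nra.
    assert (e3 : - (fow a s * fow' a s) <= 1) by nra.
    assert (e4 : 0 <= fow a s ^ 2) by apply pow2_ge_0.
    assert (e5 : fow a s ^ 5 <= 4).
    { replace (fow a s ^ 5) with (fow a s ^ 3 * fow a s ^ 2) by ring.
      assert (0 < fow a s ^ 3) by now apply pow_lt. assert (fow a s ^ 2 <= 2) by nra. nra. }
    lra. }
  assert (h8p : 8 / pohozaev t * pohozaev t = 8) by (field; lra).
  assert (8 <= pohozaev s * rad s); [|lra].
  rewrite <- h8p, Rmult_comm. apply Rmult_le_compat; try lra.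
  left. apply Rdiv_lt_0_compat; lra.
Qed.

(** An energy [g > 0] would persist, and [pohozaev <= 0] would then force [v v' >= 6 g], making
    [v^2] grow without bound. *)
Lemma energy_nonpos t : energy t <= 0.
Proof.
  apply Rnot_lt_le. intros hpos. set (g := energy t) in *.
  destruct (rad_large 2) as (S & hS). set (s := Rmax S t).
  assert (hv : forall x, s <= x -> 6 * g <= fow a x * fow' a x).
  { intros x hx. assert (m1 := Rmax_l S t). assert (m2 := Rmax_r S t).
    assert (he := energy_mono t x ltac:(unfold s in hx; lra)). fold g in he.
    assert (hr2 := hS x ltac:(unfold s in hx; lra)).
    assert (hr6 : 2 ^ 6 <= rad x ^ 6) by (apply pow_incr; lra).
    assert (hp := pohozaev_nonpos x ltac:(lra)). unfold pohozaev in hp. unfold energy in he.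
    assert (hi : 0 < / rad x ^ 6) by (apply Rinv_0_lt_compat; lra).
    assert (hnum : fow' a x ^ 2 / 2 - fow a x ^ 2 / 9 + fow a x ^ 5 / 5 + fow a x ^ 8 / (8 * rad x ^
      6)
      - fow a x * fow' a x / 6 <= 0); [|lra].
    set (N := fow' a x ^ 2 / 2 - fow a x ^ 2 / 9 + fow a x ^ 5 / 5 + fow a x ^ 8 / (8 * rad x ^ 6)
      - fow a x * fow' a x / 6) in *.
    replace N with (N / rad x * rad x) by (field; lra). nra. }
  set (s2 := s + 1 / g).
  assert (hs2 : s <= s2).
  { unfold s2. assert (0 < 1 / g) by (apply Rdiv_lt_0_compat; lra). lra. }
  assert (hgrow : fow a s ^ 2 - 12 * g * s <= fow a s2 ^ 2 - 12 * g * s2).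
  { apply (derive_nonneg_le' (fun x => fow a x ^ 2 - 12 * g * x)
      (fun x => 2 * fow a x * fow' a x - 12 * g)); [assumption| |].
    - intros x _. assert (h1 := fow_derive a x ha). derive_hyps. ring.
    - intros x hx. specialize (hv x ltac:(lra)). lra. }
  assert (h12 : 12 * g * s2 = 12 * g * s + 12) by (unfold s2; field; lra).
  assert (hl := fow_lt s2). assert (hp := fow_pos s2). assert (h0 := pow2_ge_0 (fow a s)).
  assert (fow a s2 ^ 2 <= 2) by nra. lra.
Qed.

(* Climbing from a small value of [v] back to the level of the explicit solution makes the energy
   positive. *)
Lemma no_return T T' : T <= T' -> 4000 <= rad T ^ 6 -> fow a T <= 17 / 100 ->
  54 / 100 <= fow a T' -> False.
Proof.
  intros hTT h6 h1 h2.
  destruct (crossing (fow a) T T' (3 / 10) (54 / 100)) as (t1 & t2 & ht & ht2 & e1 & e2 & hb); try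
    lra.
  { intros; now apply fow_cont. }
  assert (hinv : forall x, T <= x -> 0 < / rad x ^ 6 <= 1 / 4000).
  { intros x hx. assert (hrT := rad_pos T). assert (h : rad T ^ 6 <= rad x ^ 6).
    { apply pow_incr. split; [lra|now apply rad_incr]. }
    split; [apply Rinv_0_lt_compat; lra|]. replace (1 / 4000) with (/ 4000) by field.
    apply Rinv_le_contravar; lra. }
  assert (heT : - (36 / 10000) <= energy T).
  { destruct (energy_close T) as [_ hc]. specialize (hinv T ltac:(lra)).
    assert (hp := fow_pos T). unfold autonomous_energy in hc.
    assert (q1 := pow2_ge_0 (fow' a T)). assert (q2 : 0 < fow a T ^ 5) by now apply pow_lt.
    assert (q3 : fow a T ^ 2 <= (17 / 100) ^ 2) by (apply pow_incr; lra). lra. }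
  (* The gain is measured against [v] and not against time: between the two levels the energy bound
     gives [v'^2 >= 1 / 100], hence [v'^2 / 3 >= v' / 30]. The climb from 30/100 to 54/100 yields
     8/1000, more than the initial deficit 36/10000. *)
  assert (hgain : energy t1 - / 30 * fow a t1 <= energy t2 - / 30 * fow a t2).
  { apply (derive_nonneg_le' (fun x => energy x - / 30 * fow a x)
      (fun x => fow' a x ^ 2 / 3 + (2 - fow a x ^ 8 / 4) / rad x ^ 6 - / 30 * fow' a x)); [lra| |].
    - intros x _. assert (d1 := energy_derive x). assert (d2 := fow_derive a x ha).
      derive_hyps. ring.
    - intros x hx. assert (hge := energy_derive_ge x).
      assert (hee : - (36 / 10000) <= energy x).
      { apply Rle_trans with (energy T); [assumption|]. apply energy_mono. lra. }
      destruct (energy_close x) as [hc _]. unfold autonomous_energy in hc.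
      specialize (hb x hx). set (v := fow a x) in *. set (w := fow' a x) in *.
      assert (hpoly : 86 / 10000 <= v ^ 2 / 9 - v ^ 5 / 5).
      { assert (hv3 : v ^ 3 <= (54 / 100) ^ 3) by (apply pow_incr; lra).
        assert (hv2 : (3 / 10) ^ 2 <= v ^ 2) by (apply pow_incr; lra).
        replace (v ^ 5) with (v ^ 2 * v ^ 3) by ring. nra. }
      assert (hw2 : 1 / 100 <= w ^ 2) by lra.
      assert (hw : / 10 * w <= w ^ 2).
      { destruct (Rle_dec w (/ 10)); [|nra]. destruct (Rle_dec 0 w); nra. }
      lra. }
  assert (he1 := energy_mono T t1 ltac:(lra)). assert (he2 := energy_nonpos t2).
  lra.
Qed.

Lemma energy_settles g : 0 < g -> exists T, forall s t, T <= s <= t -> energy t - energy s <= g.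
Proof.
  intros hg0.
  set (Es := fun y => exists t, y = energy t).
  destruct (completeness Es) as [m [hub hlub]].
  { exists 0. intros y [t ->]. apply energy_nonpos. }
  { exists (energy 0). now exists 0. }
  destruct (classic (exists T, m - g < energy T)) as [[T hT]|hn].
  - exists T. intros s t hst. assert (h1 : energy t <= m) by (apply hub; now exists t).
    assert (h2 := energy_mono T s ltac:(lra)). lra.
  - exfalso. assert (m <= m - g); [|lra]. apply hlub. intros y [t ->].
    apply Rnot_lt_le. intros h. apply hn. now exists t.
Qed.

Lemma fow'_lipschitz s t : 0 <= s <= t -> Rabs (fow' a t - fow' a s) <= 10 * (t - s).
Proof.
  intros hst.
  assert (hd : forall x, s <= x <= t -> Rabs (fow' a x / 3 + 2 / 9 * fow a x - fow a x ^ 4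
    - fow a x ^ 7 / rad x ^ 6) <= 10).
  { intros x hx. assert (hp := fow_pos x). assert (hl := fow_lt x). assert (h3 := fow_cube_le x).
    assert (hb := fow'_bounds x).
    assert (hr1 : 1 <= rad x).
    { unfold rad. assert (h := exp_ineq1_le (x / 3)). lra. }
    assert (hr6 : 1 <= rad x ^ 6) by (rewrite <- (pow1 6); apply pow_incr; lra).
    assert (q3 : 0 < fow a x ^ 3) by now apply pow_lt.
    assert (q4 : 0 < fow a x ^ 4 <= 3).
    { split; [now apply pow_lt|]. replace (fow a x ^ 4) with (fow a x ^ 3 * fow a x) by ring. nra. }
    assert (q7 : 0 < fow a x ^ 7 <= 6).
    { split; [now apply pow_lt|]. replace (fow a x ^ 7) with (fow a x ^ 3 * fow a x ^ 4) by ring.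
      nra. }
    assert (qq : 0 < fow a x ^ 7 / rad x ^ 6 <= 6).
    { split; [apply Rdiv_lt_0_compat; lra|]. apply Rle_div_l; nra. }
    apply Rabs_le_between. lra. }
  assert (h1 : 10 * s - fow' a s <= 10 * t - fow' a t).
  { apply (derive_nonneg_le' (fun x => 10 * x - fow' a x) (fun x => 10 - (fow' a x / 3 + 2 / 9 * fow
      a x
      - fow a x ^ 4 - fow a x ^ 7 / rad x ^ 6))); [lra| |].
    - intros x _. assert (h := fow'_derive_ground x). derive_hyps. ring.
    - intros x hx. specialize (hd x hx). apply Rabs_le_between in hd. lra. }
  assert (h2 : 10 * s + fow' a s <= 10 * t + fow' a t).
  { apply (derive_nonneg_le' (fun x => 10 * x + fow' a x) (fun x => 10 + (fow' a x / 3 + 2 / 9 * fow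
      a x
      - fow a x ^ 4 - fow a x ^ 7 / rad x ^ 6))); [lra| |].
    - intros x _. assert (h := fow'_derive_ground x). derive_hyps. ring.
    - intros x hx. specialize (hd x hx). apply Rabs_le_between in hd. lra. }
  apply Rabs_le_between. lra.
Qed.

(** By the Lipschitz bound, [|v'| > eps] implies [|v'| >= eps / 2] for a further time [eps / 20];
    this raises the energy by [eps^3 / 240], twice the rise still possible late in time. *)
Lemma fow'_to_0 eps : 0 < eps -> exists T, forall t, T <= t -> Rabs (fow' a t) <= eps.
Proof.
  intros he. set (g := eps ^ 3 / 480).
  assert (hg0 : 0 < g) by (apply Rdiv_lt_0_compat; [now apply pow_lt|lra]).
  destruct (energy_settles g hg0) as (T & hT). exists (Rmax 0 T). intros t ht.
  assert (m1 := Rmax_l 0 T). assert (m2 := Rmax_r 0 T).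
  apply Rnot_lt_le. intros hlt.
  assert (hgain := energy_gain (eps ^ 2 / 12) t (t + eps / 20) ltac:(lra)).
  assert (h1 : energy t + eps ^ 2 / 12 * (t + eps / 20 - t) <= energy (t + eps / 20)).
  { apply hgain. intros x hx.
    assert (hlip := fow'_lipschitz t x ltac:(lra)).
    assert (hx2 : eps / 2 <= Rabs (fow' a x)).
    { assert (htr := Rabs_triang (fow' a x) (- (fow' a x - fow' a t))).
      replace (fow' a x + - (fow' a x - fow' a t)) with (fow' a t) in htr by ring.
      rewrite Rabs_Ropp in htr. lra. }
    assert ((eps / 2) ^ 2 <= Rabs (fow' a x) ^ 2) by (apply pow_incr; lra).
    rewrite pow2_abs in H. lra. }
  specialize (hT t (t + eps / 20) ltac:(lra)).
  assert (hid : eps ^ 2 / 12 * (t + eps / 20 - t) = 2 * g) by (unfold g; field).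
  lra.
Qed.

End GroundFowler.

(** * Accumulation at 2 *)

(* Limit of the Fowler variable of the explicit solution. *)
Definition well : R := exp (ln (2 / 9) / 3).

Lemma well_pos : 0 < well.
Proof. apply exp_pos. Qed.

Lemma well_cube : well ^ 3 = 2 / 9.
Proof.
  unfold well. rewrite exp_third_cube. apply exp_ln. lra.
Qed.

Lemma well_bounds : 6 / 10 < well < 608 / 1000.
Proof.
  assert (hp := well_pos). assert (hc := well_cube). split; apply Rnot_le_lt; intros h.
  - assert (well ^ 3 <= (6 / 10) ^ 3) by (apply pow_incr; lra). lra.
  - assert ((608 / 1000) ^ 3 <= well ^ 3) by (apply pow_incr; lra). lra.
Qed.

(** Factorization at the equilibrium [well], where [v^4 = 2 / 9 v]. The cofactor is positive for
    [v > 0], so [well] is the bottom of the potential. *)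
Lemma autonomous_energy_well v v' : autonomous_energy v v' =
  autonomous_energy well 0 + v' ^ 2 / 2
  + (v - well) ^ 2 * (2 * v ^ 3 + 4 * well * v ^ 2 + 6 * well ^ 2 * v + 3 * well ^ 3) / 10.
Proof.
  unfold autonomous_energy. assert (h := well_cube).
  replace (v ^ 2 / 9) with (v ^ 2 * well ^ 3 / 2) by (rewrite h; field).
  replace (well ^ 2 / 9) with (well ^ 2 * well ^ 3 / 2) by (rewrite h; field).
  field.
Qed.

Lemma fow_2_cube t : fow 2 t ^ 3 = 2 / 9 * (1 - / (36 * rad t ^ 6 + 1)).
Proof.
  unfold fow. rewrite Rpow_mult_distr. rewrite sol_2_cube by (left; apply rad3_pos).
  assert (h : 0 < rad t ^ 6) by apply pow_lt, rad_pos.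
  replace ((rad t ^ 3) ^ 2) with (rad t ^ 6) by ring.
  replace ((rad t ^ 2) ^ 3) with (rad t ^ 6) by ring. field. lra.
Qed.

Lemma fow_2_near_well t : 0 <= well - fow 2 t <= / rad t ^ 6.
Proof.
  assert (h6 : 0 < rad t ^ 6) by apply pow_lt, rad_pos.
  assert (hi : 0 < / rad t ^ 6) by now apply Rinv_0_lt_compat.
  assert (hc := fow_2_cube t). assert (hw := well_cube). assert (hb := well_bounds).
  assert (hp := fow_pos 2 global_pos_2 t).
  assert (hd : 0 < / (36 * rad t ^ 6 + 1) <= / rad t ^ 6).
  { split; [apply Rinv_0_lt_compat; lra|]. apply Rinv_le_contravar; lra. }
  assert (he : (well - fow 2 t) * (well ^ 2 + well * fow 2 t + fow 2 t ^ 2)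
    = 2 / 9 * / (36 * rad t ^ 6 + 1)).
  { transitivity (well ^ 3 - fow 2 t ^ 3); [ring|]. rewrite hw, hc. ring. }
  set (v := fow 2 t) in *. set (z := / (36 * rad t ^ 6 + 1)) in *. set (y := / rad t ^ 6) in *.
  assert (hq : 36 / 100 <= well ^ 2 + well * v + v ^ 2) by (simpl; nra).
  set (q := well ^ 2 + well * v + v ^ 2) in *.
  split; nra.
Qed.

Section Touching.

Variable a : R.
Hypothesis hg : global_pos a.
Hypothesis touch : forall T, exists t, T <= t /\ fow a t = fow 2 t.

(** At late meeting times [v] is close to [well], like the explicit variable, and [v'] is close to
    0. So the nondecreasing energy cannot exceed its bottom value. *)
Lemma touching_energy s : energy a s <= autonomous_energy well 0.
Proof.
  apply le_epsilon. intros eps he.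
  set (e := Rmin 1 eps). assert (he1 : 0 < e) by (apply Rmin_glb_lt; lra).
  assert (he2 : e <= 1) by apply Rmin_l. assert (he3 : e <= eps) by apply Rmin_r.
  destruct (fow'_to_0 a hg (e / 2) ltac:(lra)) as (T1 & h1).
  destruct (rad_large (2 / e)) as (T2 & h2).
  destruct (touch (Rmax s (Rmax T1 T2))) as (t & ht & htt).
  assert (m1 := Rmax_l s (Rmax T1 T2)). assert (m2 := Rmax_r s (Rmax T1 T2)).
  assert (m3 := Rmax_l T1 T2). assert (m4 := Rmax_r T1 T2).
  specialize (h1 t ltac:(lra)). specialize (h2 t ltac:(lra)).
  assert (hm := energy_mono a hg s t ltac:(lra)).
  destruct (energy_close a hg t) as [hc _]. rewrite autonomous_energy_well, htt in hc.
  assert (hw := fow_2_near_well t). assert (hb := well_bounds). assert (hwc := well_cube).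
  assert (hp := fow_pos 2 global_pos_2 t).
  assert (h2e : 2 <= 2 / e) by (apply (proj1 (Rle_div_r _ _ _ he1)); lra).
  assert (hr6 : 2 / e <= rad t ^ 6).
  { apply Rle_trans with (rad t); [assumption|]. rewrite <- (pow_1 (rad t)) at 1.
    apply Rle_pow; [lra|lia]. }
  assert (hi : / rad t ^ 6 <= e / 2).
  { replace (e / 2) with (/ (2 / e)) by (field; lra). apply Rinv_le_contravar; lra. }
  assert (hv' : fow' a t ^ 2 <= e / 2).
  { rewrite <- pow2_abs. assert (h0 := Rabs_pos (fow' a t)).
    assert (Rabs (fow' a t) ^ 2 <= (e / 2) ^ 2) by (apply pow_incr; lra). nra. }
  set (v := fow 2 t) in *.
  assert (hpoly : 0 <= 2 * v ^ 3 + 4 * well * v ^ 2 + 6 * well ^ 2 * v + 3 * well ^ 3 <= 10).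
  { assert (v <= well) by lra. assert (hv3 : 0 <= v ^ 3 <= well ^ 3)
      by (split; [apply pow_le; lra|apply pow_incr; lra]).
    assert (hv2 : 0 <= v ^ 2 <= well ^ 2) by (split; [apply pow_le; lra|apply pow_incr; lra]).
    assert (hw2 : 0 <= well ^ 2 <= 4 / 10) by (split; [apply pow_le; lra|simpl; nra]).
    assert (0 <= well * v ^ 2 <= 1 / 2) by nra. assert (0 <= well ^ 2 * v <= 1 / 2) by nra.
    rewrite hwc in *. lra. }
  assert (hsq : (v - well) ^ 2 <= e / 2) by (simpl; nra).
  assert (h0 := pow2_ge_0 (v - well)).
  set (P := 2 * v ^ 3 + 4 * well * v ^ 2 + 6 * well ^ 2 * v + 3 * well ^ 3) in *.
  assert ((v - well) ^ 2 * P / 10 <= e / 2) by nra.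
  lra.
Qed.

(** The autonomous energy exceeds [energy], hence the bottom value, by at most [1 / r^2], and the
    excess controls [v'] and [v - well]. The constant 15 comes from the cofactor being at least
    [3 well^3 = 2 / 3]. *)
Lemma touching_bounds t :
  fow' a t ^ 2 <= 2 / rad t ^ 6 /\ (fow a t - well) ^ 2 <= 15 / rad t ^ 6.
Proof.
  assert (hE := touching_energy t). destruct (energy_close a hg t) as [_ hc].
  rewrite autonomous_energy_well in hc.
  assert (hp := fow_pos a hg t). assert (hb := well_bounds). assert (hwc := well_cube).
  assert (hpoly : 2 / 3 <= 2 * fow a t ^ 3 + 4 * well * fow a t ^ 2 + 6 * well ^ 2 * fow a t + 3 *
    well ^ 3).
  { assert (0 <= fow a t ^ 3) by (apply pow_le; lra). assert (0 <= fow a t ^ 2) by apply pow2_ge_0.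
    assert (0 <= well ^ 2) by apply pow2_ge_0.
    assert (0 <= well * fow a t ^ 2) by (apply Rmult_le_pos; lra).
    assert (0 <= well ^ 2 * fow a t) by (apply Rmult_le_pos; lra). lra. }
  assert (h0 := pow2_ge_0 (fow a t - well)). assert (h1 := pow2_ge_0 (fow' a t)).
  unfold Rdiv. set (y := / rad t ^ 6) in *.
  set (P := 2 * fow a t ^ 3 + 4 * well * fow a t ^ 2 + 6 * well ^ 2 * fow a t + 3 * well ^ 3) in *.
  set (z := (fow a t - well) ^ 2) in *. split; nra.
Qed.

End Touching.

Section NotTouching.

Variable a : R.
Hypothesis hg : global_pos a.
Hypothesis ha2 : a <> 2.

Let ha : 0 < a := proj1 hg.

Definition prod_gap (r : R) : R := r * (sol a r - sol 2 r).
Definition prod_gap' (r : R) : R := sol a r - sol 2 r - r * (slope a r - slope 2 r).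
Definition coef (r : R) : R := react_dd (sol a r) (sol 2 r).
Definition amplitude (r : R) : R := prod_gap' r ^ 2 / coef r + prod_gap r ^ 2.

Lemma coef_ge r : 0 <= r -> sol 2 r ^ 3 <= coef r.
Proof.
  intros hr. assert (h1 := proj2 hg r hr). assert (h2 := sol_2_pos r hr).
  unfold coef, react_dd. set (x := sol a r) in *. set (y := sol 2 r) in *.
  assert (hxy : forall i j, 0 <= x ^ i * y ^ j) by (intros; apply Rmult_le_pos; apply pow_le; lra).
  assert (q1 := hxy 3%nat 0%nat). assert (q2 := hxy 2%nat 1%nat). assert (q3 := hxy 1%nat 2%nat).
  assert (p1 := hxy 6%nat 0%nat). assert (p2 := hxy 5%nat 1%nat). assert (p3 := hxy 4%nat 2%nat).
  assert (p4 := hxy 3%nat 3%nat). assert (p5 := hxy 2%nat 4%nat). assert (p6 := hxy 1%nat 5%nat).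
  assert (p7 := hxy 0%nat 6%nat). rewrite ?pow_O, ?pow_1 in *. lra.
Qed.

Lemma coef_pos r : 0 <= r -> 0 < coef r.
Proof.
  intros hr. apply Rlt_le_trans with (sol 2 r ^ 3); [|now apply coef_ge].
  now apply pow_lt, sol_2_pos.
Qed.

(* Both solutions decrease, hence so does the coefficient of [h'' + coef h = 0]. *)
Lemma coef_derive r : 0 < r -> exists dq, 0 <= dq /\ is_derive coef r (- dq).
Proof.
  intros hr. assert (h1 := sol_derive a ha r). assert (h2 := sol_derive 2 ltac:(lra) r).
  assert (p1 := proj2 hg r ltac:(lra)). assert (p2 := sol_2_pos r ltac:(lra)).
  assert (s1 := slope_pos a ha r hr). assert (s2 := slope_pos 2 ltac:(lra) r hr).
  exists (slope a r * (3 * sol a r ^ 2 + 2 * (sol a r * sol 2 r) + sol 2 r ^ 2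
      + 6 * sol a r ^ 5 + 5 * (sol a r ^ 4 * sol 2 r) + 4 * (sol a r ^ 3 * sol 2 r ^ 2)
      + 3 * (sol a r ^ 2 * sol 2 r ^ 3) + 2 * (sol a r * sol 2 r ^ 4) + sol 2 r ^ 5)
    + slope 2 r * (sol a r ^ 2 + 2 * (sol a r * sol 2 r) + 3 * sol 2 r ^ 2
      + sol a r ^ 5 + 2 * (sol a r ^ 4 * sol 2 r) + 3 * (sol a r ^ 3 * sol 2 r ^ 2)
      + 4 * (sol a r ^ 2 * sol 2 r ^ 3) + 5 * (sol a r * sol 2 r ^ 4) + 6 * sol 2 r ^ 5)).
  split.
  - assert (hxy : forall i j, 0 <= sol a r ^ i * sol 2 r ^ j)
      by (intros; apply Rmult_le_pos; apply pow_le; lra).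
    assert (q1 := hxy 2%nat 0%nat). assert (q2 := hxy 1%nat 1%nat). assert (q3 := hxy 0%nat 2%nat).
    assert (n1 := hxy 5%nat 0%nat). assert (n2 := hxy 4%nat 1%nat). assert (n3 := hxy 3%nat 2%nat).
    assert (n4 := hxy 2%nat 3%nat). assert (n5 := hxy 1%nat 4%nat). assert (n6 := hxy 0%nat 5%nat).
    rewrite ?pow_O, ?pow_1 in *.
    apply Rplus_le_le_0_compat; apply Rmult_le_pos; lra.
  - unfold coef, react_dd. derive_hyps. ring.
Qed.

(** By [h'' = - coef h] the derivative is [- coef' (h' / coef)^2], and [coef] is nonincreasing. *)
Lemma amplitude_mono r s : 0 < r <= s -> amplitude r <= amplitude s.
Proof.
  intros hrs.
  assert (hd : forall x, 0 < x -> exists l, 0 <= l /\ is_derive amplitude x l).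
  { intros x hx.
    assert (h1 := sol_derive a ha x). assert (h2 := sol_derive 2 ltac:(lra) x).
    assert (h3 := slope_derive a ha x hx). assert (h4 := slope_derive 2 ltac:(lra) x hx).
    assert (p1 := proj2 hg x ltac:(lra)). assert (p2 := sol_2_pos x ltac:(lra)).
    rewrite react_pos_eq in h3, h4 by lra.
    destruct (coef_derive x hx) as (dq & hdq & hcd). assert (hcp := coef_pos x ltac:(lra)).
    assert (hdd : react (sol a x) = react (sol 2 x) + coef x * (sol a x - sol 2 x)).
    { unfold coef. assert (e := react_dd_spec (sol a x) (sol 2 x)). lra. }
    rewrite hdd in h3.
    exists (dq * prod_gap' x ^ 2 / coef x ^ 2). split.
    - apply Rdiv_le_0_compat; [|now apply pow_lt]. apply Rmult_le_pos; [assumption|apply pow2_ge_0].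
    - unfold amplitude, prod_gap, prod_gap'. derive_hyps. field. lra. }
  destruct (Req_dec r s) as [->|n]; [lra|].
  destruct (MVT_gen amplitude r s (Derive amplitude)) as (c & hc & e).
  - intros x hx. rewrite Rmin_left in hx by lra. destruct (hd x ltac:(lra)) as (l & _ & hl).
    apply Derive_correct. now exists l.
  - intros x hx. rewrite Rmin_left in hx by lra. destruct (hd x ltac:(lra)) as (l & _ & hl).
    apply continuity_pt_filterlim. apply (ex_derive_continuous amplitude). now exists l.
  - rewrite Rmin_left, Rmax_right in hc by lra. destruct (hd c ltac:(lra)) as (l & hl0 & hl).
    apply is_derive_unique in hl. rewrite hl in e. nra.
Qed.

(** In Fowler variables [h = r^(1/3) (v_a - v_2)]. The differences of [v] and [v'] are [O(1 / r)]
    and [coef] is at least of order [1 / r^2], so both terms of the amplitude are [O(r^(-4/3))]. *)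
Lemma amplitude_small t : (forall T, exists t, T <= t /\ fow a t = fow 2 t) -> 1 <= rad t ->
  amplitude (rad t ^ 3) <= 400 / rad t.
Proof.
  intros touch hr1.
  destruct (touching_bounds a hg touch t) as [a1 a2].
  (* The explicit solution meets itself at all times, so the same bounds hold for it. *)
  destruct (touching_bounds 2 global_pos_2 (fun T => ex_intro _ T (conj (Rle_refl T) eq_refl)) t) as
    [b1 b2].
  assert (hr := rad_pos t). assert (hr3 := rad3_pos t).
  assert (hr6 : 1 <= rad t ^ 6) by (rewrite <- (pow1 6); apply pow_incr; lra).
  assert (hc2 := fow_2_cube t).
  assert (hd : / (36 * rad t ^ 6 + 1) <= / 2) by (apply Rinv_le_contravar; lra).
  assert (hv3 : / 9 <= fow 2 t ^ 3) by lra.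
  set (x := fow a t - fow 2 t). set (y := fow' a t - fow' 2 t). set (z := / rad t ^ 6).
  assert (hz : 0 < z) by (apply Rinv_0_lt_compat; lra).
  unfold Rdiv in a1, a2, b1, b2. fold z in a1, a2, b1, b2.
  assert (hx : x ^ 2 <= 60 * z).
  { unfold x. assert (h := pow2_ge_0 ((fow a t - well) + (fow 2 t - well))). nra. }
  assert (hy : y ^ 2 <= 8 * z).
  { unfold y. assert (h := pow2_ge_0 (fow' a t + fow' 2 t)). nra. }
  assert (hy3 : (y + x / 3) ^ 2 <= 30 * z).
  { assert (h := pow2_ge_0 (y - x / 3)). nra. }
  assert (e1 : prod_gap (rad t ^ 3) = rad t * x).
  { unfold prod_gap, x, fow. ring. }
  assert (e2 : prod_gap' (rad t ^ 3) = (y + x / 3) / rad t ^ 2).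
  { unfold prod_gap', x, y, fow, fow'. field. lra. }
  assert (e3 : / 9 * z <= coef (rad t ^ 3)).
  { apply Rle_trans with (sol 2 (rad t ^ 3) ^ 3); [|apply coef_ge; lra].
    replace (sol 2 (rad t ^ 3) ^ 3) with (fow 2 t ^ 3 * z) by (unfold fow, z; field; lra).
    apply Rmult_le_compat_r; lra. }
  unfold amplitude. rewrite e1, e2.
  assert (hcp : 0 < coef (rad t ^ 3)) by (apply coef_pos; lra).
  assert (hr2 : 0 < rad t ^ 2) by now apply pow_lt.
  assert (hr4 : 0 < rad t ^ 4) by now apply pow_lt.
  assert (k1 : ((y + x / 3) / rad t ^ 2) ^ 2 / coef (rad t ^ 3) <= 270 / rad t ^ 4).
  { apply Rle_div_l; [assumption|].
    replace (((y + x / 3) / rad t ^ 2) ^ 2) with ((y + x / 3) ^ 2 / rad t ^ 4) by (field; lra).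
    unfold Rdiv. rewrite (Rmult_comm 270), Rmult_assoc, (Rmult_comm ((y + x * / 3) ^ 2)).
    apply Rmult_le_compat_l; [left; now apply Rinv_0_lt_compat|]. unfold Rdiv in hy3. lra. }
  assert (k2 : (rad t * x) ^ 2 <= 60 / rad t ^ 4).
  { apply (proj1 (Rle_div_r _ _ _ hr4)).
    replace ((rad t * x) ^ 2 * rad t ^ 4) with (x ^ 2 * rad t ^ 6) by ring.
    replace 60 with (60 * z * rad t ^ 6) by (unfold z; field; lra).
    apply Rmult_le_compat_r; lra. }
  assert (k3 : / rad t ^ 4 <= / rad t).
  { apply Rinv_le_contravar; [assumption|]. rewrite <- (pow_1 (rad t)) at 1.
    apply Rle_pow; [assumption|lia]. }
  assert (k4 : 0 < / rad t ^ 4) by now apply Rinv_0_lt_compat.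
  unfold Rdiv in *. lra.
Qed.

(** The amplitude is positive at a point where [u] and [w] differ and cannot decrease afterwards,
    against [amplitude_small]. *)
Lemma not_touching : ~ forall T, exists t, T <= t /\ fow a t = fow 2 t.
Proof.
  intros touch.
  assert (exists r0, 0 < r0 /\ sol a r0 <> sol 2 r0) as (r0 & hr0 & hne).
  { apply NNPP. intros hn.
    assert (hall : forall r, 0 < r -> sol a r = sol 2 r)
      by (intros r hr; apply NNPP; intros h; apply hn; now exists r).
    assert (hc : continuous (fun r => Rabs (sol a r - sol 2 r)) 0)
      by (apply continuous_Rabs_minus; apply sol_cont; lra).
    assert (h0 : 0 < Rabs (sol a 0 - sol 2 0)) by (rewrite !sol_0 by lra; apply Rabs_pos_lt; lra).
    destruct (continuous_bound_below _ 0 0 hc h0) as (d & hd & hh).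
    specialize (hh (d / 2) ltac:(apply Rabs_def1; lra)).
    rewrite hall, Rminus_diag, Rabs_R0 in hh by lra. lra. }
  assert (hA : 0 < amplitude r0).
  { unfold amplitude. assert (h1 : 0 <= prod_gap' r0 ^ 2 / coef r0)
      by (apply Rdiv_le_0_compat; [apply pow2_ge_0|apply coef_pos; lra]).
    assert (h2 : 0 < prod_gap r0 ^ 2); [|lra].
    apply pow2_gt_0. unfold prod_gap. apply Rmult_integral_contrapositive. lra. }
  set (A0 := amplitude r0) in *.
  destruct (rad_large (1 + r0 + 500 / A0)) as (T & hT). specialize (hT T (Rle_refl T)).
  assert (hq : 0 < 500 / A0) by (apply Rdiv_lt_0_compat; lra).
  assert (hr1 : 1 <= rad T) by lra.
  assert (hsmall := amplitude_small T touch hr1).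
  assert (hr3 : rad T <= rad T ^ 3) by (rewrite <- (pow_1 (rad T)) at 1; apply Rle_pow;
    [assumption|lia]).
  assert (hm := amplitude_mono r0 (rad T ^ 3) ltac:(lra)). fold A0 in hm.
  assert (400 / rad T < A0); [|lra].
  apply Rlt_div_l; [lra|]. assert (A0 * (500 / A0) = 500) by (field; lra). nra.
Qed.

End NotTouching.

Lemma ln_rad_le T s : rad T ^ 3 <= s -> T <= ln s.
Proof.
  intros h. unfold rad in h. rewrite exp_third_cube in h. rewrite <- (ln_exp T).
  destruct h as [h|<-]; [left; apply ln_increasing; [apply exp_pos|assumption]|lra].
Qed.

Lemma angle_crossing a k r s : 0 < a -> 0 < r < s ->
  angle a r < IZR k * PI -> IZR k * PI < angle a s -> 0 < sol a s ->
  exists t, rad t ^ 3 <= s /\ r <= rad t ^ 3 /\ fow a t = fow 2 t.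
Proof.
  intros ha hrs h1 h2 hp. destruct (angle_spec a ha) as (_ & ac & _).
  destruct (first_zero (fun x => IZR k * PI - angle a x) r s) as (x & hx & e & _); try lra.
  - intros y _. apply (continuous_minus (fun _ => IZR k * PI) (angle a)); [apply
      continuous_const|apply ac].
  - assert (hsx : 0 < sol a x).
    { apply Rlt_le_trans with (sol a s); [assumption|]. apply sol_decr_le; [assumption|lra]. }
    assert (hz := angle_zero a x ha ltac:(lra) ltac:(lra)).
    exists (ln x). unfold fow. rewrite rad_ln by lra. split; [lra|]. split; [lra|].
    rewrite hz; [reflexivity|]. apply sin_eq_0_1. exists k. lra.
Qed.

Lemma angle_bounded a : global_pos a -> a <> 2 -> exists c, forall r, 0 < r -> angle a r <= c.
Proof.
  intros hg h2. apply NNPP. intros hn. apply (not_touching a hg h2). intros T.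
  assert (ha := proj1 hg). destruct (exists_multiple_PI (angle a (rad T ^ 3))) as (k & hk).
  assert (exists r, 0 < r /\ IZR k * PI < angle a r) as (r & hr & hkr).
  { apply NNPP. intros hn'. apply hn. exists (IZR k * PI). intros r hr.
    apply Rnot_lt_le. intros h. apply hn'. now exists r. }
  assert (h3 := rad3_pos T).
  assert (hlt : rad T ^ 3 < r).
  { destruct (Rtotal_order (rad T ^ 3) r) as [h|[h|h]]; [assumption|subst r; lra|].
    assert (hb := angle_barrier a (IZR k * PI) k r (rad T ^ 3) ha eq_refl ltac:(lra) ltac:(lra)).
    lra. }
  destruct (angle_crossing a k (rad T ^ 3) r ha ltac:(lra) hk hkr) as (t & h5 & h6 & h7).
  - apply hg. lra.
  - exists t. split; [|assumption].
    assert (h := ln_rad_le T (rad t ^ 3) h6). unfold rad in h.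
    now rewrite exp_third_cube, ln_exp in h.
Qed.

(** A bounded angle leaves radii arbitrarily far out with [(1 + r)^2 q < 1 / 4 + 1 / 36], which is
    5/4 times 2/9. As [(1 + r)^2 w^3 >= 2 / 9] and [q >= w^3 + w^2 u], this forces [u < w / 4],
    hence [v < well / 4 < 152 / 1000]. *)
Lemma ground_small a T : global_pos a -> a <> 2 -> exists t, T <= t /\ fow a t <= 152 / 1000.
Proof.
  intros hg h2. assert (ha := proj1 hg). destruct (angle_bounded a hg h2) as (c & hc).
  assert (h3 := rad3_pos T).
  assert (exists r, rad T ^ 3 <= r /\ (1 + r) ^ 2 * potential a r < 1 / 4 + 1 / 36) as (r & hr &
    hpot).
  { apply NNPP. intros hn.
    destruct (angle_unbounded a (rad T ^ 3) (1 / 36) c ha) as (r & hr & hcr); try lra.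
    - intros r hr. apply Rnot_lt_le. intros h. apply hn. now exists r.
    - specialize (hc r ltac:(lra)). lra. }
  exists (ln r). split; [now apply ln_rad_le|].
  assert (hr0 : 0 < r) by lra.
  assert (hpa := proj2 hg r ltac:(lra)). assert (hp2 := sol_2_pos r ltac:(lra)).
  assert (hc2 := sol_2_cube r ltac:(lra)).
  unfold potential in hpot. rewrite !Rmax_right in hpot by lra.
  set (u := sol a r) in *. set (w := sol 2 r) in *.
  assert (hdd : w ^ 3 + w ^ 2 * u <= react_dd u w).
  { unfold react_dd.
    assert (hxy : forall i j, 0 <= u ^ i * w ^ j) by (intros; apply Rmult_le_pos; apply pow_le;
      lra).
    assert (q1 := hxy 3%nat 0%nat). assert (q2 := hxy 2%nat 1%nat). assert (q3 := hxy 1%nat 2%nat).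
    assert (p1 := hxy 6%nat 0%nat). assert (p2 := hxy 5%nat 1%nat). assert (p3 := hxy 4%nat 2%nat).
    assert (p4 := hxy 3%nat 3%nat). assert (p5 := hxy 2%nat 4%nat). assert (p6 := hxy 1%nat 5%nat).
    assert (p7 := hxy 0%nat 6%nat). rewrite ?pow_O, ?pow_1 in *. lra. }
  assert (hr2 : 0 <= (1 + r) ^ 2) by apply pow2_ge_0.
  assert (hw3 : 2 / 9 <= (1 + r) ^ 2 * w ^ 3).
  { rewrite hc2. assert (hd := lin_ni_den_pos r).
    replace ((1 + r) ^ 2 * (8 / (36 * r ^ 2 + 1))) with (8 * (1 + r) ^ 2 / (36 * r ^ 2 + 1)) by
      (field; lra).
    apply (proj1 (Rle_div_r _ _ _ hd)). nra. }
  assert (hu : u < w / 4).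
  { apply Rnot_le_lt. intros hle.
    assert (h4 : 5 / 4 * w ^ 3 <= w ^ 3 + w ^ 2 * u).
    { assert (0 <= w ^ 2) by apply pow2_ge_0. replace (w ^ 3) with (w ^ 2 * w) by ring. nra. }
    assert ((1 + r) ^ 2 * (5 / 4 * w ^ 3) <= (1 + r) ^ 2 * react_dd u w)
      by (apply Rmult_le_compat_l; lra). lra. }
  assert (hn := fow_2_near_well (ln r)). assert (hb := well_bounds).
  unfold fow in *. rewrite rad_ln in * by assumption. fold u. fold w in hn.
  assert (hq : 0 < rad (ln r) ^ 2) by apply pow_lt, rad_pos.
  assert (rad (ln r) ^ 2 * u <= rad (ln r) ^ 2 * (w / 4)) by (apply Rmult_le_compat_l; lra). lra.
Qed.

Lemma fow_2_large : exists T, forall t, T <= t -> 54 / 100 <= fow 2 t.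
Proof.
  destruct (rad_large 100) as (T & hT). exists T. intros t ht. specialize (hT t ht).
  assert (hn := fow_2_near_well t). assert (hb := well_bounds).
  assert (h6 : 100 <= rad t ^ 6).
  { apply Rle_trans with (rad t); [assumption|]. rewrite <- (pow_1 (rad t)) at 1.
    apply Rle_pow; [lra|lia]. }
  assert (hi : / rad t ^ 6 <= / 100) by (apply Rinv_le_contravar; lra). lra.
Qed.

(* By [angle_zero], [u - w] then has at least [k] zeros while [u > 0]. *)
Definition reaches (k : Z) (a : R) : Prop :=
  exists r, 0 < r /\ 0 < sol a r /\ IZR k * PI < angle a r.

Lemma reaches_open k a : 0 < a -> reaches k a ->
  exists d, 0 < d /\ forall b, Rabs (b - a) < d -> 0 < b /\ reaches k b.
Proof.
  intros ha (r & hr & hp & hk).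
  destruct (sol_continuous_param a r (sol a r) ha ltac:(lra) hp) as (d1 & hd1 & h1).
  destruct (angle_continuous_param a r (angle a r - IZR k * PI) ha ltac:(lra) ltac:(lra)) as (d2 &
    hd2 & h2).
  exists (Rmin d1 d2). split; [now apply Rmin_glb_lt|]. intros b hb.
  assert (m1 := Rmin_l d1 d2). assert (m2 := Rmin_r d1 d2).
  destruct (h1 b ltac:(lra)) as [hb0 hs]. destruct (hs r ltac:(lra)) as [hs1 _].
  destruct (h2 b ltac:(lra)) as [_ hang].
  apply Rabs_def2 in hs1, hang. split; [assumption|]. exists r. repeat split; lra.
Qed.

Lemma reaches_2 k : reaches k 2.
Proof.
  destruct (angle_2_unbounded (IZR k * PI)) as (r & hr & h). exists r. split; [assumption|].
  split; [apply sol_2_pos; lra|assumption].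
Qed.

Lemma reaches_finite a : 0 < a -> a <> 2 -> exists k, ~ reaches k a.
Proof.
  intros ha h2. destruct (classic (global_pos a)) as [hg|hn].
  - destruct (angle_bounded a hg h2) as (c & hc). destruct (exists_multiple_PI c) as (k & hk).
    exists k. intros (r & hr & _ & h). specialize (hc r hr). lra.
  - destruct (not_global_pos_zero a ha hn) as (w & hw & h0).
    destruct (angle_spec a ha) as (_ & ac & _).
    destruct (continuity_ab_maj (angle a) 0 w) as (m & hm & _); [lra| |].
    + intros c _. apply continuity_pt_filterlim, ac.
    + destruct (exists_multiple_PI (angle a m)) as (k & hk). exists k.
      intros (r & hr & hp & h). assert (hrw : r < w).
      { apply Rnot_le_lt. intros hle. assert (hd := sol_decr_le a ha w r ltac:(lra)). lra. }
      specialize (hm r ltac:(lra)). lra.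
Qed.

(** * Initial values at which the k-th zero is lost *)

Section Boundary.

Variables (k : Z) (a : R) (S : R -> Prop).
Hypothesis (ha : 0 < a).
Hypothesis (hnot : ~ reaches k a).
Hypothesis (hacc : forall eps, 0 < eps -> exists b, S b /\ Rabs (b - a) < eps /\ reaches k b).

Lemma not_reaches_le r : 0 < r -> 0 < sol a r -> angle a r <= IZR k * PI.
Proof. intros hr hp. apply Rnot_lt_le. intros h. apply hnot. now exists r. Qed.

(** If [sol a] vanished at [w], its angle there would be strictly below [k PI], since equality would
    make the explicit solution vanish too. Slightly after [w] the angle is still below and [sol a]
    is negative; both persist for nearby [b], whose angle then cannot have exceeded [k PI] while
    [sol b] was positive. *)
Lemma boundary_ground : global_pos a.
Proof.
  apply NNPP. intros hn. destruct (not_global_pos_zero a ha hn) as (w & hw & h0).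
  destruct (angle_spec a ha) as (a0 & ac & ad).
  assert (hpos : forall r, 0 < r < w -> 0 < sol a r).
  { intros r hr. rewrite <- h0. apply sol_decr; [assumption|lra]. }
  assert (hle : angle a w <= IZR k * PI).
  { apply (le_of_left (angle a) 0 w _ hw (ac w)). intros t ht.
    apply not_reaches_le; [lra|now apply hpos]. }
  assert (hlt : angle a w < IZR k * PI).
  { destruct (Rle_lt_or_eq_dec _ _ hle) as [h|h]; [assumption|exfalso].
    assert (hz := angle_zero a w ha hw ltac:(lra)).
    rewrite h0 in hz. assert (hp := sol_2_pos w ltac:(lra)).
    rewrite <- hz in hp; [lra|]. apply sin_eq_0_1. now exists k. }
  destruct (continuous_bound_above _ _ _ (ac w) hlt) as (d & hd & hh).
  set (w' := w + d / 2). specialize (hh w' ltac:(unfold w'; apply Rabs_def1; lra)).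
  assert (hneg : sol a w' < 0) by (rewrite <- h0; apply sol_decr; [assumption|unfold w'; lra]).
  destruct (sol_continuous_param a w' (- sol a w') ha ltac:(unfold w'; lra) ltac:(lra)) as (d1 & hd1
    & h1).
  destruct (angle_continuous_param a w' (IZR k * PI - angle a w') ha ltac:(unfold w'; lra)
    ltac:(lra))
    as (d2 & hd2 & h2).
  destruct (hacc (Rmin d1 d2) ltac:(now apply Rmin_glb_lt)) as (b & _ & hb & (r & hr & hp & hk)).
  assert (m1 := Rmin_l d1 d2). assert (m2 := Rmin_r d1 d2).
  destruct (h1 b ltac:(lra)) as [hb0 hs].
  destruct (hs w' ltac:(unfold w'; lra)) as [hs1 _].
  destruct (h2 b ltac:(lra)) as [_ hang]. apply Rabs_def2 in hs1, hang.
  assert (hrw : r < w').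
  { apply Rnot_le_lt. intros hle'.
    assert (hd' := sol_decr_le b hb0 w' r ltac:(unfold w' in *; lra)). lra. }
  assert (hbar := angle_barrier b (IZR k * PI) k r w' hb0 eq_refl ltac:(lra) ltac:(lra)). lra.
Qed.

Lemma boundary_not_ground : a <> 2 -> exists b, S b /\ 0 < b /\ ~ global_pos b.
Proof.
  intros ha2. assert (hg := boundary_ground).
  destruct fow_2_large as (T1 & hT1). destruct (rad_large 4000) as (T2 & hT2).
  destruct (ground_small a (Rmax T1 T2) hg ha2) as (T & hT & hsmall).
  assert (m1 := Rmax_l T1 T2). assert (m2 := Rmax_r T1 T2).
  set (rT := rad T ^ 3). assert (hrT : 0 < rT) by apply rad3_pos.
  assert (hlt : angle a rT < IZR k * PI).
  { destruct (Rle_lt_or_eq_dec _ _ (not_reaches_le rT hrT (proj2 hg rT ltac:(lra)))) as [h|h];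
      [assumption|].
    assert (hb := angle_barrier a (IZR k * PI) k rT (rT + 1) ha eq_refl ltac:(lra) ltac:(lra)).
    assert (hl := not_reaches_le (rT + 1) ltac:(lra) (proj2 hg (rT + 1) ltac:(lra))). lra. }
  assert (hr2 : 0 < rad T ^ 2) by apply pow_lt, rad_pos.
  (* The tolerance 1/100 in the Fowler variable keeps [0.152 + 0.01] below the 0.17 required by
     [no_return]. *)
  destruct (sol_continuous_param a rT (/ 100 / rad T ^ 2) ha ltac:(lra)) as (d1 & hd1 & h1).
  { apply Rdiv_lt_0_compat; lra. }
  destruct (angle_continuous_param a rT (IZR k * PI - angle a rT) ha ltac:(lra) ltac:(lra))
    as (d2 & hd2 & h2).
  destruct (hacc (Rmin d1 d2) ltac:(now apply Rmin_glb_lt)) as (b & hSb & hb & (r & hr & hp & hk)).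
  assert (n1 := Rmin_l d1 d2). assert (n2 := Rmin_r d1 d2).
  destruct (h1 b ltac:(lra)) as [hb0 hs]. destruct (hs rT ltac:(lra)) as [hs1 _].
  destruct (h2 b ltac:(lra)) as [_ hang]. apply Rabs_def2 in hs1, hang.
  exists b. split; [assumption|]. split; [assumption|]. intros hgb.
  assert (hrr : rT < r).
  { destruct (Rtotal_order rT r) as [h|[h|h]]; [assumption|subst r; lra|].
    assert (hbar := angle_barrier b (IZR k * PI) k r rT hb0 eq_refl ltac:(lra) ltac:(lra)). lra. }
  destruct (angle_crossing b k rT r hb0 ltac:(lra) ltac:(lra) hk hp) as (t & h5 & h6 & h7).
  assert (htT : T <= t).
  { assert (h := ln_rad_le T (rad t ^ 3) h6). unfold rad in h.
    now rewrite exp_third_cube, ln_exp in h. }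
  apply (no_return b hgb T t htT).
  - specialize (hT2 T ltac:(lra)). apply Rle_trans with (rad T); [assumption|].
    rewrite <- (pow_1 (rad T)) at 1. apply Rle_pow; [lra|lia].
  - unfold fow in *. fold rT in hsmall. fold rT.
    assert (rad T ^ 2 * sol b rT <= rad T ^ 2 * (sol a rT + / 100 / rad T ^ 2))
      by (apply Rmult_le_compat_l; lra).
    replace (rad T ^ 2 * (sol a rT + / 100 / rad T ^ 2)) with (rad T ^ 2 * sol a rT + / 100) in H
      by (field; assert (hq := rad_pos T); lra).
    lra.
  - rewrite h7. apply hT1. lra.
Qed.

End Boundary.

(** [sg] selects the side of 2. With [k] not reached at distance [d / 2], the supremum [s] of the
    distances up to which [k] is reached throughout is a boundary point, approached from the values
    nearer to 2, which form [S]. *)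
Lemma accumulation (sg d : R) : (sg = 1 \/ sg = -1) -> 0 < d < 1 ->
  (exists x, 0 < x < d /\ global_pos (2 + sg * x)) /\
  (exists x, 0 < x < d /\ 0 < 2 + sg * x /\ ~ global_pos (2 + sg * x)).
Proof.
  intros hsg hd.
  assert (hpos : forall x, 0 <= x < 1 -> 0 < 2 + sg * x) by (intros x hx; destruct hsg; subst sg;
    lra).
  assert (habs : forall x y, Rabs (2 + sg * x - (2 + sg * y)) = Rabs (x - y)).
  { intros x y. replace (2 + sg * x - (2 + sg * y)) with (sg * (x - y)) by ring.
    rewrite Rabs_mult. replace (Rabs sg) with 1; [ring|].
    destruct hsg; subst sg; [symmetry; apply Rabs_R1|rewrite Rabs_left; lra]. }
  set (x1 := d / 2).
  assert (hne : forall x, 0 < x -> 2 + sg * x <> 2) by (intros x hx; destruct hsg; subst sg; lra).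
  destruct (reaches_finite (2 + sg * x1)) as (k & hk); [apply hpos; unfold x1; lra|apply hne; unfold
    x1; lra|].
  set (E := fun x => 0 <= x <= x1 /\ forall y, 0 <= y <= x -> reaches k (2 + sg * y)).
  assert (hE0 : E 0).
  { split; [unfold x1; lra|]. intros y hy. replace y with 0 by lra.
    replace (2 + sg * 0) with 2 by ring. apply reaches_2. }
  destruct (completeness E) as [s [hub hlub]].
  { exists x1. intros x [hx _]. lra. }
  { now exists 0. }
  assert (hs0 : 0 <= s) by (apply hub; exact hE0).
  assert (hs1 : s <= x1) by (apply hlub; intros x [hx _]; lra).
  assert (hbelow : forall y, 0 <= y < s -> reaches k (2 + sg * y)).
  { intros y hy. apply NNPP. intros hn. assert (s <= y); [|lra]. apply hlub. intros x [hx hx'].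
    apply Rnot_lt_le. intros hlt. apply hn, hx'. lra. }
  assert (hns : ~ reaches k (2 + sg * s)).
  { intros hr. destruct (reaches_open k (2 + sg * s) (hpos s ltac:(unfold x1 in *; lra)) hr) as (e &
      he & hh).
    destruct (Req_dec s x1) as [heq|hneq]; [rewrite heq in hr; contradiction|].
    assert (m1 := Rmin_l x1 (s + e / 2)). assert (m2 := Rmin_r x1 (s + e / 2)).
    assert (m3 : s < Rmin x1 (s + e / 2)) by (apply Rmin_glb_lt; lra).
    assert (hE : E (Rmin x1 (s + e / 2))).
    { split; [lra|]. intros y hy. destruct (Rlt_dec y s); [apply hbelow; lra|].
      apply hh. rewrite habs. apply Rabs_def1; lra. }
    specialize (hub _ hE). lra. }
  assert (hsp : 0 < s).
  { destruct (Rle_lt_or_eq_dec _ _ hs0) as [h|h]; [assumption|exfalso]. apply hns.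
    rewrite <- h. replace (2 + sg * 0) with 2 by ring. apply reaches_2. }
  set (S := fun b => exists y, 0 < y < s /\ b = 2 + sg * y).
  assert (hacc : forall eps, 0 < eps -> exists b, S b /\ Rabs (b - (2 + sg * s)) < eps /\ reaches k
    b).
  { intros eps he. assert (m1 := Rmin_l (s / 2) (eps / 2)). assert (m2 := Rmin_r (s / 2) (eps / 2)).
    assert (m3 : 0 < Rmin (s / 2) (eps / 2)) by (apply Rmin_glb_lt; lra).
    exists (2 + sg * (s - Rmin (s / 2) (eps / 2))). split; [|split].
    - exists (s - Rmin (s / 2) (eps / 2)). split; [lra|reflexivity].
    - rewrite habs. apply Rabs_def1; lra.
    - apply hbelow. lra. }
  assert (hsp' : 0 < 2 + sg * s) by (apply hpos; unfold x1 in *; lra).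
  split.
  - exists s. split; [unfold x1 in *; lra|]. exact (boundary_ground k (2 + sg * s) S hsp' hns hacc).
  - destruct (boundary_not_ground k (2 + sg * s) S hsp' hns hacc (hne s hsp)) as (b & (y & hy & hb)
      & hb0 & hnb).
    exists y. subst b. split; [unfold x1 in *; lra|]. split; assumption.
Qed.

(** * No ground state with large initial value *)

Lemma sqrt2_sq : sqrt 2 ^ 2 = 2.
Proof. apply pow2_sqrt. lra. Qed.

Lemma sqrt2_pos : 0 < sqrt 2.
Proof. apply sqrt_lt_R0. lra. Qed.

Lemma srad_pos t : 0 < sqrt 2 * rad t ^ 3.
Proof. apply Rmult_lt_0_compat; [apply sqrt2_pos|apply rad3_pos]. Qed.

(* Fowler variables adapted to the supercritical power [u^7], in the variable [x = r / sqrt 2],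
   for which the expansion of the singular solution has rational coefficients. *)
Definition sfow (a t : R) : R := rad t * sol a (sqrt 2 * rad t ^ 3).
Definition sfow' (a t : R) : R :=
  rad t * (sol a (sqrt 2 * rad t ^ 3) / 3 - sqrt 2 * rad t ^ 3 * slope a (sqrt 2 * rad t ^ 3)).

Lemma srad_derive t : is_derive (fun t => sqrt 2 * rad t ^ 3) t (sqrt 2 * rad t ^ 3).
Proof.
  assert (h := rad3_derive t). set (c := sqrt 2).
  apply (is_derive_scal (fun t => rad t ^ 3) t c (rad t ^ 3)). exact h.
Qed.

Lemma sol_sup_derive a t : 0 < a -> is_derive (fun t => sol a (sqrt 2 * rad t ^ 3)) t
  (sqrt 2 * rad t ^ 3 * (- slope a (sqrt 2 * rad t ^ 3))).
Proof.
  intros ha.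
  apply (is_derive_comp (sol a) (fun t => sqrt 2 * rad t ^ 3)); [now apply sol_derive|apply
    srad_derive].
Qed.

Lemma slope_sup_derive a t : 0 < a -> is_derive (fun t => slope a (sqrt 2 * rad t ^ 3)) t
  (sqrt 2 * rad t ^ 3 * (react_pos (sol a (sqrt 2 * rad t ^ 3))
     - 2 / (sqrt 2 * rad t ^ 3) * slope a (sqrt 2 * rad t ^ 3))).
Proof.
  intros ha. assert (h := srad_pos t).
  apply (is_derive_comp (slope a) (fun t => sqrt 2 * rad t ^ 3));
    [now apply slope_derive|apply srad_derive].
Qed.

Lemma sfow_derive a t : 0 < a -> is_derive (sfow a) t (sfow' a t).
Proof.
  intros ha. assert (h := rad_derive t). assert (hs := sol_sup_derive a t ha).
  unfold sfow, sfow'. set (R0 := sqrt 2 * rad t ^ 3) in *.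
  set (u := fun t => sol a (sqrt 2 * rad t ^ 3)) in *.
  change (is_derive u t (R0 * - slope a R0)) in hs.
  change (sol a R0) with (u t).
  change (is_derive (fun t => rad t * u t) t (rad t * (u t / 3 - R0 * slope a R0))).
  derive_hyps. field.
Qed.

(** With [x = rad t ^ 3] and [r^2 = 2 x^2] the equation reads
    [w'' + w' / 3 = 2 / 9 w - 2 w^7 - 2 x w^4]: positive damping, and [u^4] enters with the factor
    [x], small near the origin. *)
Lemma sfow'_derive a t : 0 < a -> 0 <= sol a (sqrt 2 * rad t ^ 3) ->
  is_derive (sfow' a) t
    (- sfow' a t / 3 + 2 / 9 * sfow a t - 2 * sfow a t ^ 7 - 2 * rad t ^ 3 * sfow a t ^ 4).
Proof.
  intros ha hp. assert (h := rad_derive t). assert (hs := sol_sup_derive a t ha).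
  assert (hd := slope_sup_derive a t ha). assert (h3 := srad_derive t).
  assert (hR := srad_pos t). assert (hr := rad_pos t).
  rewrite react_pos_eq in hd by assumption. unfold react in hd.
  assert (hR2 : (sqrt 2 * rad t ^ 3) ^ 2 = 2 * rad t ^ 6)
    by (rewrite Rpow_mult_distr, sqrt2_sq; ring).
  unfold sfow', sfow. set (rr := fun t => sqrt 2 * rad t ^ 3) in *.
  set (u := fun t => sol a (sqrt 2 * rad t ^ 3)) in *.
  set (m := fun t => slope a (sqrt 2 * rad t ^ 3)) in *.
  change (is_derive u t (rr t * - m t)) in hs.
  change (is_derive m t (rr t * (u t ^ 4 + u t ^ 7 - 2 / rr t * m t))) in hd.
  change (is_derive rr t (rr t)) in h3.
  change (rr t ^ 2 = 2 * rad t ^ 6) in hR2. change (0 < rr t) in hR.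
  change (is_derive (fun t => rad t * (u t / 3 - rr t * m t)) t
    (- (rad t * (u t / 3 - rr t * m t)) / 3 + 2 / 9 * (rad t * u t)
     - 2 * (rad t * u t) ^ 7 - 2 * rad t ^ 3 * (rad t * u t) ^ 4)).
  derive_hyps. transitivity (- (rad t * (u t / 3 - rr t * m t)) / 3 + 2 / 9 * (rad t * u t)
    - rad t * (rr t ^ 2 * (u t ^ 4 + u t ^ 7))); [field; lra|].
  rewrite hR2. ring.
Qed.

Lemma slope_le a r : 0 < a -> 0 <= r -> slope a r <= r * react a / 3.
Proof.
  intros ha hr. destruct (Rle_lt_or_eq_dec _ _ hr) as [h|<-].
  2: { rewrite slope_0 by assumption. lra. }
  assert (hm : 0 ^ 3 * react a / 3 - 0 ^ 2 * slope a 0 <= r ^ 3 * react a / 3 - r ^ 2 * slope a r).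
  { apply (derive_nonneg_le (fun t => t ^ 3 * react a / 3 - t ^ 2 * slope a t)
      (fun t => t ^ 2 * (react a - react_pos (sol a t)))); [assumption| | |].
    - intros x _. assert (hc := slope_cont a ha x). cont.
    - intros x hx. assert (hd := slope_derive a ha x ltac:(lra)).
      derive_hyps. field. lra.
    - intros x hx. apply Rmult_le_pos; [apply pow2_ge_0|].
      assert (react_pos (sol a x) <= react a); [|lra].
      unfold react_pos. apply react_le. split; [apply Rmax_l|]. apply Rmax_lub; [lra|].
      apply sol_le; lra. }
  assert (hr2 : 0 < r ^ 2) by now apply pow_lt.
  apply Rmult_le_reg_l with (r ^ 2); [assumption|]. nra.
Qed.

Lemma sol_ge a r : 0 < a -> 0 <= r -> a - r ^ 2 * react a / 6 <= sol a r.
Proof.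
  intros ha hr.
  assert (hm : sol a 0 + 0 ^ 2 * react a / 6 <= sol a r + r ^ 2 * react a / 6).
  { apply (derive_nonneg_le' (fun t => sol a t + t ^ 2 * react a / 6)
      (fun t => t * react a / 3 - slope a t)); [assumption| |].
    - intros x _. assert (hd := sol_derive a ha x).
      derive_hyps. field.
    - intros x hx. assert (h := slope_le a x ha ltac:(lra)). lra. }
  rewrite sol_0 in hm by assumption. lra.
Qed.

(* Limit at [r = 0] of the variable [sfow] of the singular solution. *)
Definition crit : R := exp (- ln 3 / 3).

Lemma crit_pos : 0 < crit. Proof. apply exp_pos. Qed.

Lemma crit_cube : crit ^ 3 = / 3.
Proof.
  unfold crit. rewrite exp_third_cube, exp_Ropp, exp_ln by lra. reflexivity.
Qed.

Lemma crit_bounds : 693 / 1000 < crit < 694 / 1000.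
Proof.
  assert (hp := crit_pos). assert (hc := crit_cube). split; apply Rnot_le_lt; intros h.
  - assert (crit ^ 3 <= (693 / 1000) ^ 3) by (apply pow_incr; lra). lra.
  - assert ((694 / 1000) ^ 3 <= crit ^ 3) by (apply pow_incr; lra). lra.
Qed.

(** * Attraction of ground states to the singular solution *)

Section GroundSup.

Variable a : R.
Hypothesis hg : global_pos a.

Let ha : 0 < a := proj1 hg.

Lemma sfow_at t : 0 < sol a (sqrt 2 * rad t ^ 3).
Proof. apply hg. left. apply srad_pos. Qed.

Lemma sfow_pos t : 0 < sfow a t.
Proof. unfold sfow. apply Rmult_lt_0_compat; [apply rad_pos|apply sfow_at]. Qed.

Lemma sfow_6_le t : sfow a t ^ 6 <= 1 / 2.
Proof.
  unfold sfow. assert (h := ground_decay_7 a hg (sqrt 2 * rad t ^ 3) ltac:(left; apply srad_pos)).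
  rewrite Rpow_mult_distr, sqrt2_sq in h. rewrite Rpow_mult_distr.
  replace ((rad t ^ 3) ^ 2) with (rad t ^ 6) in h by ring. lra.
Qed.

Lemma sfow_le t : sfow a t < 9 / 10.
Proof.
  assert (h := sfow_6_le t). assert (hp := sfow_pos t). apply Rnot_le_lt. intros hle.
  assert ((9 / 10) ^ 6 <= sfow a t ^ 6) by (apply pow_incr; lra). lra.
Qed.

Lemma sfow'_bounds t : - 2 / 3 * sfow a t <= sfow' a t <= sfow a t / 3.
Proof.
  assert (hr := rad_pos t). assert (hR := srad_pos t).
  assert (h1 := ground_slope_le a hg _ hR).
  assert (h2 := slope_pos a ha _ hR).
  assert (h3 : 0 < sqrt 2 * rad t ^ 3 * slope a (sqrt 2 * rad t ^ 3)) by now apply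
    Rmult_lt_0_compat.
  unfold sfow, sfow'. set (m := sqrt 2 * rad t ^ 3 * slope a (sqrt 2 * rad t ^ 3)) in *.
  set (u := sol a (sqrt 2 * rad t ^ 3)) in *. set (p := rad t) in *. split; nra.
Qed.

Lemma sfow'_derive_ground t : is_derive (sfow' a) t
    (- sfow' a t / 3 + 2 / 9 * sfow a t - 2 * sfow a t ^ 7 - 2 * rad t ^ 3 * sfow a t ^ 4).
Proof. apply sfow'_derive; [assumption|]. left. apply sfow_at. Qed.

(** The last term compensates the growth of the factor [x] in front of [w^5]: [2 / 5 w^5 < 3 / 10]
    because [w < 9 / 10]. *)
Definition sfow_energy (t : R) : R :=
  sfow' a t ^ 2 / 2 - sfow a t ^ 2 / 9 + sfow a t ^ 8 / 4 + 2 / 5 * rad t ^ 3 * sfow a t ^ 5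
  - 3 / 10 * rad t ^ 3.

Lemma sfow_energy_decr s t : s <= t -> sfow_energy t <= sfow_energy s.
Proof.
  intros hst. apply Ropp_le_cancel.
  apply (derive_nonneg_le' (fun t => - sfow_energy t)
    (fun t => sfow' a t ^ 2 / 3 + rad t ^ 3 * (3 / 10 - 2 / 5 * sfow a t ^ 5))); [assumption| |].
  - intros x _. assert (h := rad_derive x). assert (h1 := sfow_derive a x ha).
    assert (h2 := sfow'_derive_ground x). unfold sfow_energy.
    derive_hyps. field.
  - intros x _. assert (h0 := pow2_ge_0 (sfow' a x)). assert (h3 := rad3_pos x).
    assert (hp := sfow_pos x). assert (hl := sfow_le x).
    assert (h5 : sfow a x ^ 5 <= (9 / 10) ^ 5) by (apply pow_incr; lra).
    assert (0 <= rad x ^ 3 * (3 / 10 - 2 / 5 * sfow a x ^ 5)) by (apply Rmult_le_pos; lra). lra.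
Qed.

(** Potential of the autonomous part, normalized to vanish at [crit]; the factored form shows how it
    compares with [(w - crit)^2]. *)
Definition sfow_pot (w : R) : R :=
  (w ^ 2 - crit ^ 2) ^ 2 * (w ^ 4 + 2 * crit ^ 2 * w ^ 2 + 3 * crit ^ 4) / 4.

Lemma sfow_pot_eq w : sfow_pot w = w ^ 8 / 4 - w ^ 2 / 9 + crit ^ 2 / 12.
Proof.
  assert (h : crit ^ 6 = / 9) by (replace (crit ^ 6) with ((crit ^ 3) ^ 2) by ring; rewrite
    crit_cube; field).
  unfold sfow_pot.
  transitivity (w ^ 8 / 4 - w ^ 2 * crit ^ 6 + 3 / 4 * crit ^ 2 * crit ^ 6); [field|rewrite h;
    field].
Qed.

(* The cross term turns the energy into a strict Lyapunov function. *)
Definition lyap (t : R) : R :=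
  sfow' a t ^ 2 / 2 + sfow_pot (sfow a t) + (sfow a t - crit) * sfow' a t / 10.

Definition lyap_rate (t : R) : R :=
  - sfow' a t ^ 2 / 3 - 2 * rad t ^ 3 * sfow a t ^ 4 * sfow' a t
  + (sfow' a t ^ 2 + (sfow a t - crit) * (- sfow' a t / 3 + 2 / 9 * sfow a t - 2 * sfow a t ^ 7
     - 2 * rad t ^ 3 * sfow a t ^ 4)) / 10.

Lemma lyap_derive t : is_derive lyap t (lyap_rate t).
Proof.
  assert (h1 := sfow_derive a t ha). assert (h2 := sfow'_derive_ground t).
  apply (is_derive_ext (fun t => sfow' a t ^ 2 / 2 + (sfow a t ^ 8 / 4 - sfow a t ^ 2 / 9 + crit ^ 2
    / 12)
    + (sfow a t - crit) * sfow' a t / 10)).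
  - intros x. unfold lyap. rewrite sfow_pot_eq. reflexivity.
  - unfold lyap_rate. derive_hyps. field.
Qed.

Lemma lyap_bounds t : (sfow' a t ^ 2 + (sfow a t - crit) ^ 2) / 20 <= lyap t
  <= 15 / 10 * (sfow' a t ^ 2 + (sfow a t - crit) ^ 2).
Proof.
  assert (hp := sfow_pos t). assert (hl := sfow_le t). assert (hc := crit_bounds).
  unfold lyap, sfow_pot. set (w := sfow a t) in *. set (z := sfow' a t) in *. set (c := crit) in *.
  replace ((w ^ 2 - c ^ 2) ^ 2) with ((w - c) ^ 2 * (w + c) ^ 2) by ring.
  assert (hc2 : (693/1000)^2 <= c ^ 2 <= (694/1000)^2) by (split; apply pow_incr; lra).
  assert (hc4 : (693/1000)^4 <= c ^ 4 <= (694/1000)^4) by (split; apply pow_incr; lra).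
  assert (hw2 : 0 <= w ^ 2 <= (9/10)^2) by (split; [apply pow_le|apply pow_incr]; lra).
  assert (hw4 : 0 <= w ^ 4 <= (9/10)^4) by (split; [apply pow_le|apply pow_incr]; lra).
  assert (hcw : 0 <= c ^ 2 * w ^ 2 <= (694/1000)^2 * (9/10)^2)
    by (split; [apply Rmult_le_pos|apply Rmult_le_compat]; lra).
  assert (hwc : (693/1000)^2 <= (w + c) ^ 2 <= (16/10)^2) by (split; apply pow_incr; lra).
  set (P := w ^ 4 + 2 * c ^ 2 * w ^ 2 + 3 * c ^ 4).
  assert (hP : 68/100 <= P <= 22/10) by (unfold P; lra).
  set (Q := (w + c) ^ 2) in *.
  assert (hPQ : 32/100 <= Q * P <= 564/100).
  { assert ((693/1000)^2 * (68/100) <= Q * P) by (apply Rmult_le_compat; lra).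
    assert (Q * P <= (16/10)^2 * (22/10)) by (apply Rmult_le_compat; lra). split; lra. }
  set (y := w - c). set (K := Q * P) in *.
  replace (y ^ 2 * Q * P / 4) with (y ^ 2 * (K / 4)) by (unfold K; field).
  assert (h1 := pow2_ge_0 (y + z)). assert (h2 := pow2_ge_0 (y - z)).
  assert (h3 := pow2_ge_0 y). assert (h4 := pow2_ge_0 z).
  assert (h5 : y ^ 2 * (8 / 100) <= y ^ 2 * (K / 4)) by (apply Rmult_le_compat_l; lra).
  assert (h6 : y ^ 2 * (K / 4) <= y ^ 2 * (141 / 100)) by (apply Rmult_le_compat_l; lra).
  assert (h7 := pow2_ge_0 (y + 3 * z)). assert (h8 := pow2_ge_0 (y - 3 * z)).
  split; nra.
Qed.

(** The cross term supplies a negative multiple of [(w - crit)^2] as long as [w] stays away from the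
    other equilibrium 0, whence the hypothesis. The terms with [x] are the perturbation by [u^4]. *)
Lemma lyap_rate_le t : 1 / 4 <= sfow a t -> lyap_rate t <= - lyap t / 300 + 2 * rad t ^ 3.
Proof.
  intros hw0. assert (hb := lyap_bounds t). assert (hx := rad3_pos t).
  assert (hp := sfow_pos t). assert (hl := sfow_le t). assert (hc := crit_bounds).
  assert (hd := sfow'_bounds t).
  assert (h6 : crit ^ 6 = / 9)
    by (replace (crit ^ 6) with ((crit ^ 3) ^ 2) by ring; rewrite crit_cube; field).
  unfold lyap_rate. set (w := sfow a t) in *. set (z := sfow' a t) in *. set (c := crit) in *.
  set (x := rad t ^ 3) in *. set (y := w - c) in *.
  (* The cofactor in [w^6 - c^6 = (w - c) Sg], where [c^6 = 1 / 9]. *)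
  set (Sg := w ^ 5 + w ^ 4 * c + w ^ 3 * c ^ 2 + w ^ 2 * c ^ 3 + w * c ^ 4 + c ^ 5).
  assert (hN : y * (2 / 9 * w - 2 * w ^ 7) = - (2 * w * Sg) * y ^ 2).
  { replace (2 / 9 * w) with (2 * w * c ^ 6) by (rewrite h6; field). unfold Sg, y. ring. }
  assert (hSg : 159 / 1000 <= Sg).
  { assert (hc5 : (693/1000)^5 <= c ^ 5) by (apply pow_incr; lra).
    assert (hq : forall i j, 0 <= w ^ i * c ^ j) by (intros; apply Rmult_le_pos; apply pow_le; lra).
    assert (q1 := hq 5%nat 0%nat). assert (q2 := hq 4%nat 1%nat). assert (q3 := hq 3%nat 2%nat).
    assert (q4 := hq 2%nat 3%nat). assert (q5 := hq 1%nat 4%nat). rewrite ?pow_O, ?pow_1 in *.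
    unfold Sg. lra. }
  assert (hwS : 79 / 1000 <= 2 * w * Sg) by nra.
  assert (hw4 : 0 <= w ^ 4 <= (9/10)^4) by (split; [apply pow_le|apply pow_incr]; lra).
  assert (hz : - (6/10) <= z <= 3/10) by lra.
  assert (hy : -7/10 <= y <= 21/100) by (unfold y; lra).
  assert (hx1 : - (2 * x * w ^ 4 * z) <= x).
  { assert (- (w ^ 4 * z) <= 1 / 2) by nra. nra. }
  assert (hx2 : - (y * (2 * x * w ^ 4)) <= x * (95 / 100)).
  { assert (- (y * w ^ 4) <= 46/100) by nra. nra. }
  assert (h3 := pow2_ge_0 y). assert (h4 := pow2_ge_0 z).
  assert (h5 : - (2 * w * Sg) * y ^ 2 <= - (79/1000) * y ^ 2) by nra.
  replace (y * (- z / 3 + 2 / 9 * w - 2 * w ^ 7 - 2 * x * w ^ 4))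
    with (- (y * z) / 3 + y * (2 / 9 * w - 2 * w ^ 7) - y * (2 * x * w ^ 4)) by field.
  rewrite hN. assert (h9 := pow2_ge_0 (y + 6 * z)).
  assert (hcomb : - z ^ 2 / 3 + z ^ 2 / 10 - y * z / 30 - 79/10000 * y ^ 2
    <= - (15/3000) * (z ^ 2 + y ^ 2)) by nra.
  lra.
Qed.

Lemma lyap_decay s t : s <= t -> (forall x, s <= x <= t -> 1 / 4 <= sfow a x) ->
  lyap t - 2 * rad t ^ 3 <= exp (- (t - s) / 300) * lyap s.
Proof.
  intros hst hw.
  assert (hm : - (exp (s / 300) * (lyap s - 2 * rad s ^ 3)) <= - (exp (t / 300) * (lyap t - 2 * rad
    t ^ 3))).
  { apply (derive_nonneg_le' (fun x => - (exp (x / 300) * (lyap x - 2 * rad x ^ 3)))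
      (fun x => - (exp (x / 300) * ((lyap x - 2 * rad x ^ 3) / 300 + lyap_rate x - 2 * rad x ^
        3))));
      [assumption| |].
    - intros x _. assert (h := rad_derive x). assert (h1 := lyap_derive x).
      derive_hyps. unfold Rdiv. generalize (exp (x * / 300)). intros E. field.
    - intros x hx. assert (hle := lyap_rate_le x (hw x hx)). assert (h3 := rad3_pos x).
      assert (hE := exp_pos (x / 300)). nra. }
  assert (hE : exp (- (t - s) / 300) * exp (t / 300) = exp (s / 300)).
  { rewrite <- exp_plus. f_equal. field. }
  assert (h3 := rad3_pos s). assert (hEs := exp_pos (s / 300)). assert (hEt := exp_pos (t / 300)).
  apply Rmult_le_reg_r with (exp (t / 300)); [assumption|].
  replace (exp (- (t - s) / 300) * lyap s * exp (t / 300)) with (exp (s / 300) * lyap s)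
    by (rewrite <- hE; ring).
  nra.
Qed.

Hypothesis a_large : 5 <= a.

(* The radius [r = sqrt 2 / (8 a^3)] is still in the core, where [u] is close to [u 0]. *)
Definition core_time : R := - 3 * ln (2 * a).

Lemma rad_core : rad core_time = / (2 * a).
Proof.
  unfold rad, core_time. replace (-3 * ln (2 * a) / 3) with (- ln (2 * a)) by field.
  rewrite exp_Ropp, exp_ln; lra.
Qed.

(** At this radius [r^2 react a <= 101 / 3200 a], so [u] has lost at most two percent of [a] and [w]
    lies just below 1/2. *)
Lemma core_energy : sfow_energy core_time <= - (12 / 1000) /\ lyap core_time <= 3.
Proof.
  assert (hr := rad_core). assert (hR := srad_pos core_time).
  set (r1 := sqrt 2 * rad core_time ^ 3) in *.
  assert (ha3 : 125 <= a ^ 3) by (replace 125 with (5 ^ 3) by ring; apply pow_incr; lra).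
  assert (hreact : react a <= 101 / 100 * a ^ 7).
  { unfold react. assert (h4 : 0 < a ^ 4) by now apply pow_lt.
    replace (a ^ 7) with (a ^ 4 * a ^ 3) by ring. nra. }
  assert (hr1 : r1 ^ 2 = / (32 * a ^ 6)).
  { unfold r1. rewrite hr, Rpow_mult_distr, sqrt2_sq. field. lra. }
  assert (hrr : r1 ^ 2 * react a <= 101 / 3200 * a).
  { rewrite hr1. apply Rle_trans with (/ (32 * a ^ 6) * (101 / 100 * a ^ 7)).
    - apply Rmult_le_compat_l; [|assumption]. left. apply Rinv_0_lt_compat.
      assert (0 < a ^ 6) by now apply pow_lt. lra.
    - right. field. lra. }
  assert (hu := sol_ge a r1 ha ltac:(lra)). assert (hul := sol_le a ha r1 ltac:(lra)).
  assert (hs := slope_le a r1 ha ltac:(lra)). assert (hsp := slope_pos a ha r1 hR).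
  assert (hrs : 0 <= r1 * slope a r1 <= 11 / 1000 * a).
  { split; [apply Rmult_le_pos; lra|].
    apply Rle_trans with (r1 * (r1 * react a / 3)); [apply Rmult_le_compat_l; lra|].
    replace (r1 * (r1 * react a / 3)) with (r1 ^ 2 * react a / 3) by field. lra. }
  assert (hw : 49 / 100 <= sfow a core_time <= 1 / 2).
  { unfold sfow. fold r1. rewrite hr. assert (hi : 0 < / (2 * a)) by (apply Rinv_0_lt_compat; lra).
    split.
    - apply Rle_trans with (/ (2 * a) * (98 / 100 * a)); [right; field; lra|].
      apply Rmult_le_compat_l; lra.
    - apply Rle_trans with (/ (2 * a) * a); [apply Rmult_le_compat_l; lra|right; field; lra]. }
  assert (hz : 0 <= sfow' a core_time <= sfow a core_time / 3).
  { split; [|apply sfow'_bounds]. unfold sfow'. fold r1. apply Rmult_le_pos; [left; apply rad_pos|].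
    lra. }
  assert (hx : 0 < rad core_time ^ 3 <= / 1000).
  { split; [apply rad3_pos|]. rewrite hr. rewrite pow_inv, Rpow_mult_distr.
    apply Rinv_le_contravar; lra. }
  split.
  - unfold sfow_energy. set (w := sfow a core_time) in *. set (z := sfow' a core_time) in *.
    set (x := rad core_time ^ 3) in *.
    assert (hz2 : z ^ 2 <= (w / 3) ^ 2) by (apply pow_incr; lra).
    assert (hw2 : (49/100) ^ 2 <= w ^ 2) by (apply pow_incr; lra).
    assert (hw8 : w ^ 8 <= (1/2) ^ 8) by (apply pow_incr; lra).
    assert (hw5 : 0 <= w ^ 5 <= (1/2) ^ 5) by (split; [apply pow_le|apply pow_incr]; lra).
    assert (x * w ^ 5 <= x * (1/2)^5) by (apply Rmult_le_compat_l; lra). lra.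
  - destruct (lyap_bounds core_time) as [_ hb]. assert (hc := crit_bounds).
    set (w := sfow a core_time) in *. set (z := sfow' a core_time) in *. nra.
Qed.

(** The energy cannot rise above [- 12 / 1000], while for [w < 1 / 4] and [x <= 1 / 100] it would be
    at least [- 1 / 144 - 3 / 1000]. *)
Lemma sfow_ge_after_core t : core_time <= t -> rad t ^ 3 <= 1 / 100 -> 1 / 4 <= sfow a t.
Proof.
  intros ht hx. assert (he := sfow_energy_decr core_time t ht). destruct core_energy as [h0 _].
  assert (hp := sfow_pos t). assert (h3 := rad3_pos t).
  unfold sfow_energy at 1 in he. set (w := sfow a t) in *.
  assert (q1 := pow2_ge_0 (sfow' a t)). assert (q2 : 0 <= w ^ 8) by (apply pow_le; lra).
  assert (q3 : 0 <= rad t ^ 3 * w ^ 5) by (apply Rmult_le_pos; [lra|apply pow_le; lra]).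
  apply Rnot_lt_le. intros hlt. assert (w ^ 2 <= (1/4) ^ 2) by (apply pow_incr; lra). lra.
Qed.

End GroundSup.

(** [core_time a] tends to minus infinity as [a] grows, so [lyap] has arbitrarily long to decay
    before [t0]; only the perturbation [2 x] remains. *)
Lemma near_crit_start (t0 eta : R) : rad t0 ^ 3 <= 1 / 100 -> 80 * rad t0 ^ 3 <= eta ->
  exists A, 0 < A /\ forall a, A < a -> global_pos a ->
    sfow' a t0 ^ 2 + (sfow a t0 - crit) ^ 2 <= eta.
Proof.
  intros hx0 heta. assert (h3 := rad3_pos t0).
  (* Starting no later than [T], the decay factor is at most [eta / 120]. With [lyap <= 3] at the
     start and the factor 20 of [lyap_bounds] this leaves [eta / 2]; the other half covers
     [40 x]. *)
  set (T := t0 + 300 * ln (eta / 120)).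
  exists (5 + exp (- T / 3) + exp (- t0 / 3)).
  assert (e1 := exp_pos (- T / 3)). assert (e2 := exp_pos (- t0 / 3)).
  split; [lra|]. intros a haA hg. assert (ha := proj1 hg).
  assert (hlow : forall s, exp (- s / 3) < a -> core_time a <= s).
  { intros s hs. unfold core_time.
    assert (hln : - s / 3 < ln (2 * a)).
    { rewrite <- (ln_exp (- s / 3)). apply ln_increasing; [apply exp_pos|lra]. }
    lra. }
  assert (hcT := hlow T ltac:(lra)). assert (hct0 := hlow t0 ltac:(lra)).
  destruct (core_energy a hg ltac:(lra)) as [_ hL].
  assert (hdec := lyap_decay a hg (core_time a) t0 hct0).
  assert (hd : lyap a t0 - 2 * rad t0 ^ 3 <= exp (- (t0 - core_time a) / 300) * lyap a (core_time
    a)).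
  { apply hdec. intros x hx. apply (sfow_ge_after_core a hg ltac:(lra)); [lra|].
    apply Rle_trans with (rad t0 ^ 3); [|assumption]. apply pow_incr.
    split; [left; apply rad_pos|apply rad_incr; lra]. }
  assert (hE : exp (- (t0 - core_time a) / 300) <= eta / 120).
  { rewrite <- (exp_ln (eta / 120)) by lra.
    destruct (Req_dec (- (t0 - core_time a) / 300) (ln (eta / 120))) as [->|n]; [lra|].
    left. apply exp_increasing. unfold T in hcT. lra. }
  assert (hE0 := exp_pos (- (t0 - core_time a) / 300)).
  assert (hle : exp (- (t0 - core_time a) / 300) * lyap a (core_time a) <= eta / 120 * 3).
  { apply Rle_trans with (exp (- (t0 - core_time a) / 300) * 3).
    - apply Rmult_le_compat_l; lra.
    - apply Rmult_le_compat_r; lra. }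
  destruct (lyap_bounds a hg t0) as [hb _]. lra.
Qed.

(* Nonnegative coefficients in the Bernstein basis of [p, q] certify the sextic inequalities
   below. *)
Lemma bernstein_nonneg p q x c0 c1 c2 c3 c4 c5 c6 :
  0 <= c0 -> 0 <= c1 -> 0 <= c2 -> 0 <= c3 -> 0 <= c4 -> 0 <= c5 -> 0 <= c6 -> p <= x <= q ->
  0 <= c0 * (q - x) ^ 6 + c1 * (x - p) * (q - x) ^ 5 + c2 * (x - p) ^ 2 * (q - x) ^ 4
    + c3 * (x - p) ^ 3 * (q - x) ^ 3 + c4 * (x - p) ^ 4 * (q - x) ^ 2
    + c5 * (x - p) ^ 5 * (q - x) + c6 * (x - p) ^ 6.
Proof.
  intros h0 h1 h2 h3 h4 h5 h6 hx.
  assert (hm : forall i, 0 <= (x - p) ^ i) by (intros; apply pow_le; lra).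
  assert (hn : forall i, 0 <= (q - x) ^ i) by (intros; apply pow_le; lra).
  assert (hm1 := hm 1%nat). assert (hn1 := hn 1%nat). rewrite pow_1 in hm1, hn1.
  repeat apply Rplus_le_le_0_compat;
    repeat first [assumption | apply hm | apply hn | apply Rmult_le_pos].
Qed.

(* [u^-3 = x shape x] approximates the singular solution, whose expansion starts with
   [u^-3 = 3 x + 9/4 x^2 + 9/16 x^3]; the last coefficient is fitted on [0, 5]. *)
Definition shape (x : R) : R := 3 + 9 / 4 * x + 9 / 16 * x ^ 2 + 3 / 160 * x ^ 3.
(** [shape1] and [shape2] are [x d/dx] applied once and twice to [shape], that is, its derivatives
    in [t] along [x = exp t]. *)
Definition shape1 (x : R) : R := 9 / 4 * x + 9 / 8 * x ^ 2 + 9 / 160 * x ^ 3.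
Definition shape2 (x : R) : R := 9 / 4 * x + 9 / 4 * x ^ 2 + 27 / 160 * x ^ 3.
(** What remains when [shape^(-1/3)] is inserted into the equation, cleared of the factor
    [shape^(-1/3) / (9 shape^2)]. The exact leading coefficients of [shape] make it vanish to order
    3 at 0. *)
Definition defect (x : R) : R := x ^ 3 * (99 / 160 - 81 / 320 * x + 9 / 6400 * x ^ 3).

Lemma defect_eq x : defect x =
  4 * shape1 x ^ 2 - 3 * shape x * shape2 x - shape x * shape1 x - 2 * shape x ^ 2 + 18
  + 18 * x * shape x.
Proof. unfold defect, shape, shape1, shape2. field. Qed.

Lemma shape_ge x : 0 <= x -> 3 <= shape x.
Proof.
  intros h. unfold shape. assert (0 <= x ^ 2) by (apply pow_le; lra).
  assert (0 <= x ^ 3) by (apply pow_le; lra). lra.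
Qed.

(** After division by [x] both signs are sextic inequalities, certified by Bernstein coefficients,
    one of them piecewise. *)
Lemma defect_bound x : 0 <= x <= 5 -> Rabs (defect x) <= 129 / 10000 * shape x ^ 2 * x.
Proof.
  intros hx.
  assert (h1 : 0 <= 129 / 10000 * shape x ^ 2 + x ^ 2 * (99 / 160 - 81 / 320 * x + 9 / 6400 * x ^
    3)).
  { assert (h := bernstein_nonneg 0 5 x (1161 / 156250000) (31347 / 312500000) (777123 / 500000000)
      (3610323 / 1000000000) (20831553 / 8000000000) (18904221 / 40000000000)
      (3544569 / 160000000000)). unfold shape. lra. }
  assert (h2 : 0 <= 129 / 10000 * shape x ^ 2 - x ^ 2 * (99 / 160 - 81 / 320 * x + 9 / 6400 * x ^
    3)).
  { destruct (Rle_dec x (5 / 4)).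
    - assert (h := bernstein_nonneg 0 (5 / 4) x (297216 / 9765625) (2340576 / 9765625)
        (1041003 / 1953125) (7671627 / 15625000) (109263033 / 500000000) (794011779 / 10000000000)
        (4497648489 / 160000000000)). unfold shape. lra.
    - destruct (Rle_dec x (5 / 2)).
      + assert (h := bernstein_nonneg (5 / 4) (5 / 2) x (4497648489 / 160000000000)
          (10316898351 / 40000000000) (8889059763 / 8000000000) (2578825773 / 1000000000)
          (6452185707 / 2000000000) (5096019231 / 2500000000) (1274562081 / 2500000000)).
        unfold shape. lra.
      + assert (h := bernstein_nonneg (5 / 2) 5 x (1274562081 / 160000000000)
          (3187519749 / 40000000000) (2572311627 / 8000000000) (665841807 / 1000000000)
          (1488616803 / 2000000000) (1065442149 / 2500000000) (244744569 / 2500000000)).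
        unfold shape. lra. }
  apply Rabs_le_between. unfold defect.
  replace (x ^ 3 * (99 / 160 - 81 / 320 * x + 9 / 6400 * x ^ 3))
    with (x * (x ^ 2 * (99 / 160 - 81 / 320 * x + 9 / 6400 * x ^ 3))) by ring.
  set (N := x ^ 2 * (99 / 160 - 81 / 320 * x + 9 / 6400 * x ^ 3)) in *.
  set (K := 129 / 10000 * shape x ^ 2) in *. split; nra.
Qed.

(* The quantity bounded here is the zeroth-order coefficient of the linearization at the
   approximate solution; its value at the singular point is 4/3. *)
Lemma shape_frequency x : 0 <= x <= 5 ->
  108 / 100 <= - 2 / 9 + (14 + 8 * x * shape x) / shape x ^ 2 <= 16 / 10.
Proof.
  intros hx. assert (hk := shape_ge x ltac:(lra)).
  assert (hk2 : 0 < shape x ^ 2) by (apply pow_lt; lra).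
  assert (h1 : (108 / 100 + 2 / 9) * shape x ^ 2 <= 14 + 8 * x * shape x).
  { assert (h := bernstein_nonneg 0 5 x (57 / 390625) (2289 / 781250) (29601 / 1250000)
      (192001 / 2500000) (2011011 / 20000000) (4615527 / 100000000) (420203 / 400000000)).
    unfold shape. lra. }
  assert (h2 : 14 + 8 * x * shape x <= (16 / 10 + 2 / 9) * shape x ^ 2).
  { destruct (Rle_dec x (5 / 4)).
    - assert (h := bernstein_nonneg 0 (5 / 4) x (49152 / 78125) (310272 / 78125) (146016 / 15625)
        (162668 / 15625) (726393 / 125000) (4295859 / 2500000) (12636169 / 40000000)).
      unfold shape. lra.
    - destruct (Rle_dec x (5 / 2)).
      + assert (h := bernstein_nonneg (5 / 4) (5 / 2) x (12636169 / 40000000) (20725071 / 10000000)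
          (15163923 / 2000000) (4472333 / 250000) (12348747 / 500000) (11013951 / 625000)
          (3118401 / 625000)). unfold shape. lra.
      + assert (h := bernstein_nonneg (5 / 2) 5 x (3118401 / 40000000) (8525829 / 10000000)
          (7615467 / 2000000) (2205647 / 250000) (5578563 / 500000) (4563429 / 625000)
          (1209049 / 625000)). unfold shape. lra. }
  split.
  - assert (108 / 100 + 2 / 9 <= (14 + 8 * x * shape x) / shape x ^ 2); [|lra].
    now apply (proj1 (Rle_div_r _ _ _ hk2)).
  - assert ((14 + 8 * x * shape x) / shape x ^ 2 <= 16 / 10 + 2 / 9); [|lra].
    now apply (proj2 (Rle_div_l _ _ _ hk2)).
Qed.

Definition kap (t : R) : R := shape (rad t ^ 3).
Definition approx (t : R) : R := exp (- ln (kap t) / 3).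
Definition approx' (t : R) : R := - approx t * shape1 (rad t ^ 3) / (3 * kap t).
Definition residual (t : R) : R := approx t * defect (rad t ^ 3) / (9 * kap t ^ 2).

Lemma kap_ge t : 3 <= kap t.
Proof. apply shape_ge. left. apply rad3_pos. Qed.

Lemma approx_pos t : 0 < approx t.
Proof. apply exp_pos. Qed.

Lemma approx_cube t : approx t ^ 3 = / kap t.
Proof.
  assert (hk := kap_ge t). unfold approx.
  rewrite exp_third_cube, exp_Ropp, exp_ln by lra. reflexivity.
Qed.

Lemma approx_lt t : approx t < 694 / 1000.
Proof.
  assert (hk := kap_ge t). assert (hc := approx_cube t). assert (hp := approx_pos t).
  apply Rnot_le_lt. intros hle.
  assert ((694 / 1000) ^ 3 <= approx t ^ 3) by (apply pow_incr; lra).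
  assert (/ kap t <= / 3) by (apply Rinv_le_contravar; lra). lra.
Qed.

Lemma kap_derive t : is_derive kap t (shape1 (rad t ^ 3)).
Proof.
  assert (h := rad3_derive t). unfold kap. set (x := fun t => rad t ^ 3) in *.
  change (is_derive x t (x t)) in h. change (rad t ^ 3) with (x t).
  change (is_derive (fun t => shape (x t)) t (shape1 (x t))). unfold shape, shape1.
  derive_hyps. field.
Qed.

Lemma shape1_derive t : is_derive (fun t => shape1 (rad t ^ 3)) t (shape2 (rad t ^ 3)).
Proof.
  assert (h := rad3_derive t). set (x := fun t => rad t ^ 3) in *.
  change (is_derive x t (x t)) in h. change (rad t ^ 3) with (x t).
  change (is_derive (fun t => shape1 (x t)) t (shape2 (x t))). unfold shape1, shape2.
  derive_hyps. field.
Qed.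

Lemma approx_derive t : is_derive approx t (approx' t).
Proof.
  assert (hk := kap_ge t). assert (hd := kap_derive t). unfold approx', approx.
  derive_hyps. unfold Rdiv. generalize (exp (- ln (kap t) * / 3)). intros e. field. lra.
Qed.

Lemma approx'_derive t : is_derive approx' t
  (- approx' t / 3 + 2 / 9 * approx t - 2 * approx t ^ 7 - 2 * rad t ^ 3 * approx t ^ 4 + residual
    t).
Proof.
  assert (hk := kap_ge t). assert (hd := kap_derive t). assert (h1 := shape1_derive t).
  assert (h0 := approx_derive t). assert (hc := approx_cube t).
  replace (approx t ^ 7) with (approx t * (approx t ^ 3) ^ 2) by ring.
  replace (approx t ^ 4) with (approx t * approx t ^ 3) by ring. rewrite hc.
  unfold residual. rewrite defect_eq. unfold approx' at 1 2. unfold approx' in h0.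
  change (shape (rad t ^ 3)) with (kap t) in *. set (y := fun t => shape1 (rad t ^ 3)) in *.
  change (is_derive y t (shape2 (rad t ^ 3))) in h1.
  change (shape1 (rad t ^ 3)) with (y t) in *.
  change (is_derive (fun t => - approx t * y t / (3 * kap t)) t
   (- (- approx t * y t / (3 * kap t)) / 3 + 2 / 9 * approx t - 2 * (approx t * (/ kap t) ^ 2) -
    2 * rad t ^ 3 * (approx t * / kap t) +
    approx t * (4 * y t ^ 2 - 3 * kap t * shape2 (rad t ^ 3) - kap t * y t - 2 * kap t ^ 2 + 18
      + 18 * rad t ^ 3 * kap t) / (9 * kap t ^ 2))).
  derive_hyps. field. lra.
Qed.

Lemma residual_bound t : rad t ^ 3 <= 5 -> Rabs (residual t) <= / 1000 * rad t ^ 3.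
Proof.
  intros hx. assert (h3 := rad3_pos t). assert (hk := kap_ge t).
  assert (hp := approx_pos t). assert (hl := approx_lt t).
  assert (hd := defect_bound (rad t ^ 3) ltac:(lra)). change (shape (rad t ^ 3)) with (kap t) in hd.
  assert (hk2 : 0 < kap t ^ 2) by (apply pow_lt; lra).
  unfold residual. replace (approx t * defect (rad t ^ 3) / (9 * kap t ^ 2))
    with (approx t / (9 * kap t ^ 2) * defect (rad t ^ 3)) by (field; lra).
  assert (hq : 0 < approx t / (9 * kap t ^ 2)) by (apply Rdiv_lt_0_compat; lra).
  rewrite Rabs_mult, (Rabs_pos_eq (approx t / _)) by lra.
  apply Rle_trans with (approx t / (9 * kap t ^ 2) * (129 / 10000 * kap t ^ 2 * rad t ^ 3)).
  - apply Rmult_le_compat_l; lra.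
  - replace (approx t / (9 * kap t ^ 2) * (129 / 10000 * kap t ^ 2 * rad t ^ 3))
      with (approx t * (129 / 90000) * rad t ^ 3) by (field; lra).
    apply Rmult_le_compat_r; lra.
Qed.

Lemma approx_start t : rad t ^ 3 <= 1 ->
  0 <= crit - approx t <= 2 * rad t ^ 3 /\ - rad t ^ 3 <= approx' t <= 0.
Proof.
  intros hx. assert (h3 := rad3_pos t). assert (hk := kap_ge t).
  assert (hp := approx_pos t). assert (hl := approx_lt t). assert (hc := crit_bounds).
  assert (e1 := approx_cube t). assert (e2 := crit_cube).
  set (x := rad t ^ 3) in *.
  assert (hx2 : 0 <= x ^ 2 <= x) by (simpl; nra).
  assert (hx3 : 0 <= x ^ 3 <= x) by (simpl in *; nra).
  assert (hk3 : kap t - 3 <= 3 * x) by (unfold kap, shape; fold x; lra).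
  assert (hki : 0 < / kap t) by (apply Rinv_0_lt_compat; lra).
  split.
  - assert (he : (crit - approx t) * (crit ^ 2 + crit * approx t + approx t ^ 2) = (kap t - 3) / (3
      * kap t)).
    { transitivity (crit ^ 3 - approx t ^ 3); [ring|]. rewrite e1, e2. field. lra. }
    assert (hq : 48 / 100 <= crit ^ 2 + crit * approx t + approx t ^ 2) by (simpl; nra).
    assert (hr : 0 <= (kap t - 3) / (3 * kap t) <= x / 3).
    { split; [apply Rdiv_le_0_compat; lra|]. apply Rle_div_l; [lra|]. nra. }
    set (q := crit ^ 2 + crit * approx t + approx t ^ 2) in *. split; nra.
  - unfold approx'. fold x. assert (hs : 0 <= shape1 x <= 9 / 2 * x) by (unfold shape1; lra).
    replace (- approx t * shape1 x / (3 * kap t)) with (- (approx t * shape1 x / (3 * kap t))) by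
      (field; lra).
    assert (0 <= approx t * shape1 x / (3 * kap t) <= x); [|lra].
    split; [apply Rdiv_le_0_compat; [apply Rmult_le_pos|]; lra|].
    apply Rle_div_l; [lra|].
    assert (approx t * shape1 x <= 694 / 1000 * (9 / 2 * x)) by (apply Rmult_le_compat; lra). nra.
Qed.

(** * Deviation of a ground state from the approximation, and the Pohozaev contradiction *)

Section Compare.

Variable a : R.
Hypothesis hg : global_pos a.

Let ha : 0 < a := proj1 hg.

Definition dev (t : R) : R := sfow a t - approx t.
(** The shift by a sixth of the deviation splits the damping 1/3 evenly between the two
    components. *)
Definition dev' (t : R) : R := sfow' a t - approx' t + (sfow a t - approx t) / 6.

(** Divided difference of [- 2 / 9 w + 2 w^7 + 2 x w^4] between the solution and [approx], expanded
    in powers of [dev]. *)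
Definition dev_freq (t : R) : R :=
  - 2 / 9
  + 2 * (7 * approx t ^ 6 + 21 * approx t ^ 5 * dev t + 35 * approx t ^ 4 * dev t ^ 2
     + 35 * approx t ^ 3 * dev t ^ 3 + 21 * approx t ^ 2 * dev t ^ 4 + 7 * approx t * dev t ^ 5 +
         dev t ^ 6)
  + 2 * rad t ^ 3 * (4 * approx t ^ 3 + 6 * approx t ^ 2 * dev t + 4 * approx t * dev t ^ 2 + dev t
      ^ 3).

(* The quadratic form is adapted to the damped oscillator [D'' + D'/3 + 4/3 D = 0]:
   along it, it decays like [exp (- t / 3)]. *)
Definition dev_norm (t : R) : R := dev' t ^ 2 + 47 / 36 * dev t ^ 2.

(** With [D'' + D' / 3 + dev_freq D = - residual] and [X = D' + D / 6], a weight [c] on [D^2] gives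
    the mixed term [2 (1 / 36 + c - dev_freq) X D]; [c = 47 / 36 = 4 / 3 - 1 / 36] leaves only the
    distance of the frequency from 4/3. *)
Lemma dev_norm_derive t : is_derive dev_norm t
  (- dev_norm t / 3 + 2 * (4 / 3 - dev_freq t) * (dev' t * dev t) - 2 * residual t * dev' t).
Proof.
  assert (h1 := sfow_derive a t ha). assert (h2 := sfow'_derive_ground a hg t).
  assert (h3 := approx_derive t). assert (h4 := approx'_derive t).
  unfold dev_norm, dev_freq, dev', dev.
  derive_hyps. field.
Qed.

(** [shape_frequency] puts the value for [dev = 0] within 0.27 of 4/3; the rest is [Q] times [dev]
    with [|Q| <= 17]. *)
Lemma dev_freq_bound t : rad t ^ 3 <= 5 -> Rabs (dev t) <= 53 / 10000 ->
  Rabs (4 / 3 - dev_freq t) <= 36 / 100.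
Proof.
  intros hx hD. assert (h3 := rad3_pos t). assert (hk := kap_ge t).
  assert (hp := approx_pos t). assert (hl := approx_lt t). assert (e1 := approx_cube t).
  assert (hf := shape_frequency (rad t ^ 3) ltac:(lra)).
  change (shape (rad t ^ 3)) with (kap t) in hf.
  unfold dev_freq. set (x := rad t ^ 3) in *. set (s := approx t) in *. set (d := dev t) in *.
  assert (hmain : - 2 / 9 + (14 + 8 * x * kap t) / kap t ^ 2 = - 2 / 9 + 2 * (7 * s ^ 6) + 2 * x *
    (4 * s ^ 3)).
  { replace (s ^ 6) with ((s ^ 3) ^ 2) by ring. rewrite e1. field. lra. }
  rewrite hmain in hf.
  (* By the inequality of the means [kap^2 >= 5 x^3], so [(x s^2)^3 = x^3 / kap^2 <= 1 / 5], below
     the cube of 6/10. *)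
  assert (hxs : x * s ^ 2 <= 6 / 10).
  { apply Rnot_lt_le. intros hlt.
    assert (hk2 : 5 * x ^ 3 <= kap t ^ 2).
    { assert (hx2 : 0 <= x ^ 2) by (apply pow_le; lra).
      assert (hx3 : 0 <= x ^ 3) by (apply pow_le; lra).
      assert (hkx : 9 / 4 * x + 9 / 16 * x ^ 2 <= kap t) by (unfold kap, shape; fold x; lra).
      assert (hsq : (9 / 4 * x + 9 / 16 * x ^ 2) ^ 2 <= kap t ^ 2) by (apply pow_incr; lra).
      assert (hag := pow2_ge_0 (9 / 4 * x - 9 / 16 * x ^ 2)).
      replace ((9 / 4 * x + 9 / 16 * x ^ 2) ^ 2)
        with ((9 / 4 * x - 9 / 16 * x ^ 2) ^ 2 + 81 / 16 * x ^ 3) in hsq by field. lra. }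
    assert (hcube : (6 / 10) ^ 3 < (x * s ^ 2) ^ 3).
    { assert (h2 : (6/10) ^ 2 < (x * s ^ 2) ^ 2) by (set (y := x * s ^ 2) in *; simpl; nra).
      set (y := x * s ^ 2) in *. simpl in *. nra. }
    replace ((x * s ^ 2) ^ 3) with (x ^ 3 * (s ^ 3) ^ 2) in hcube by ring. rewrite e1 in hcube.
    assert (hk2p : 0 < kap t ^ 2) by (apply pow_lt; lra).
    replace (x ^ 3 * (/ kap t) ^ 2) with (x ^ 3 / kap t ^ 2) in hcube by (field; lra).
    apply (proj2 (Rlt_div_r _ _ _ hk2p)) in hcube. lra. }
  assert (hs2 : 0 < s ^ 2 <= (7/10) ^ 2) by (split; [apply pow_lt; lra|apply pow_incr; lra]).
  assert (hs3 : 0 < s ^ 3 <= (7/10) ^ 3) by (split; [apply pow_lt; lra|apply pow_incr; lra]).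
  assert (hs4 : 0 < s ^ 4 <= (7/10) ^ 4) by (split; [apply pow_lt; lra|apply pow_incr; lra]).
  assert (hs5 : 0 < s ^ 5 <= (7/10) ^ 5) by (split; [apply pow_lt; lra|apply pow_incr; lra]).
  set (Q := 2 * (21 * s ^ 5 + 35 * s ^ 4 * d + 35 * s ^ 3 * d ^ 2 + 21 * s ^ 2 * d ^ 3 + 7 * s * d ^
    4 + d ^ 5)
    + (12 * (x * s ^ 2) + 8 * (x * s) * d + 2 * x * d ^ 2)).
  assert (hQ : Rabs Q <= 17).
  { assert (hdp : forall n, Rabs (d ^ n) <= (53/10000) ^ n).
    { intros n. rewrite <- RPow_abs. apply pow_incr. split; [apply Rabs_pos|assumption]. }
    assert (d1 := hdp 1%nat). assert (d2 := hdp 2%nat). assert (d3 := hdp 3%nat).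
    assert (d4 := hdp 4%nat). assert (d5 := hdp 5%nat).
    rewrite !pow_1 in d1. apply Rabs_le_between in d1, d2, d3, d4, d5.
    assert (hmul : forall p e m, 0 <= p <= m -> - (1/100) <= e <= 1/100 -> - m / 100 <= p * e <= m /
      100)
      by (intros p e m hpm hem; split; nra).
    assert (t1 := hmul (s ^ 4) d 1 ltac:(lra) ltac:(lra)).
    assert (t2 := hmul (s ^ 3) (d ^ 2) 1 ltac:(lra) ltac:(lra)).
    assert (t3 := hmul (s ^ 2) (d ^ 3) 1 ltac:(lra) ltac:(lra)).
    assert (t4 := hmul s (d ^ 4) 1 ltac:(lra) ltac:(lra)).
    assert (hxs1 : 0 <= x * s <= 35/10) by (split; [apply Rmult_le_pos|]; nra).
    assert (t5 := hmul (x * s) d (35/10) ltac:(lra) ltac:(lra)).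
    assert (t6 := hmul x (d ^ 2) 5 ltac:(lra) ltac:(lra)).
    assert (0 <= x * s ^ 2) by (apply Rmult_le_pos; lra).
    unfold Q. apply Rabs_le_between. lra. }
  replace (4 / 3 - (- 2 / 9 + 2 * (7 * s ^ 6 + 21 * s ^ 5 * d + 35 * s ^ 4 * d ^ 2 + 35 * s ^ 3 * d
    ^ 3
    + 21 * s ^ 2 * d ^ 4 + 7 * s * d ^ 5 + d ^ 6) + 2 * x * (4 * s ^ 3 + 6 * s ^ 2 * d + 4 * s * d ^
        2 + d ^ 3)))
  with (4 / 3 - (- 2 / 9 + 2 * (7 * s ^ 6) + 2 * x * (4 * s ^ 3)) - Q * d) by (unfold Q; ring).
  assert (hQd : Rabs (Q * d) <= 17 * (53 / 10000))
    by (rewrite Rabs_mult; apply Rmult_le_compat; try apply Rabs_pos; assumption).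
  apply Rabs_le_between in hQd. apply Rabs_le_between. lra.
Qed.

Lemma dev_norm_bound t0 t : t0 <= t -> rad t ^ 3 <= 5 -> dev_norm t0 < / 1000000 ->
  dev_norm t <= (/ 1000 + / 1000 * rad t ^ 3) ^ 2.
Proof.
  intros ht hx h0. destruct (Req_dec t0 t) as [<-|n].
  { assert (h3 := rad3_pos t0). assert ((/ 1000) ^ 2 <= (/ 1000 + / 1000 * rad t0 ^ 3) ^ 2)
      by (apply pow_incr; lra). lra. }
  (* The growth of [Bd] absorbs exactly the residual bound; in the remaining terms the decay rate
     1/3 beats twice 0.36 times 0.44, which is 0.3168. *)
  set (Bd := fun t => / 1000 + / 1000 * rad t ^ 3).
  assert (hp : 0 < Bd t ^ 2 - dev_norm t); [|unfold Bd in *; lra].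
  assert (hder : forall s, is_derive (fun t => Bd t ^ 2 - dev_norm t) s
    (2 * Bd s * (/ 1000 * rad s ^ 3) - (- dev_norm s / 3 + 2 * (4 / 3 - dev_freq s) * (dev' s * dev
      s)
       - 2 * residual s * dev' s))).
  { intros s. assert (h1 := dev_norm_derive s). assert (h2 := rad_derive s).
    unfold Bd. derive_hyps. field. }
  apply (barrier (fun t => Bd t ^ 2 - dev_norm t) t0 t); [| | |lra].
  - intros s _. apply (ex_derive_continuous (fun t => Bd t ^ 2 - dev_norm t)). eexists. apply hder.
  - intros s hs hs0. eexists. split; [|apply hder].
    assert (hxs : rad s ^ 3 <= 5).
    { apply Rle_trans with (rad t ^ 3); [|assumption]. apply pow_incr.
      split; [left; apply rad_pos|apply rad_incr; lra]. }
    assert (h3 := rad3_pos s). assert (hres := residual_bound s hxs).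
    assert (hB : / 1000 < Bd s <= 6 / 1000) by (unfold Bd; lra).
    assert (hG : dev_norm s = Bd s ^ 2) by lra. rewrite hG.
    unfold dev_norm in hG. set (B := Bd s) in *. set (X := dev' s) in *. set (D := dev s) in *.
    assert (hXB : Rabs X <= B).
    { apply Rabs_le_of_sq; [lra|]. assert (hd2 := pow2_ge_0 D). lra. }
    assert (hDB : Rabs D <= 53 / 10000).
    { apply Rabs_le_of_sq; [lra|]. assert (hx2 := pow2_ge_0 X).
      assert (B ^ 2 <= (6/1000) ^ 2) by (apply pow_incr; lra). lra. }
    assert (hfr := dev_freq_bound s hxs hDB). set (q := 4 / 3 - dev_freq s) in *.
    assert (hXD : Rabs (X * D) <= 44 / 100 * B ^ 2).
    { assert (p1 := pow2_ge_0 (X - 114 / 100 * D)). assert (p2 := pow2_ge_0 (X + 114 / 100 * D)).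
      assert (p3 := pow2_ge_0 D).
      apply Rabs_le_between. split; lra. }
    assert (k1 : Rabs (q * (X * D)) <= 36 / 100 * (44 / 100 * B ^ 2))
      by (rewrite Rabs_mult; apply Rmult_le_compat; try apply Rabs_pos; assumption).
    assert (k2 : Rabs (residual s * X) <= / 1000 * rad s ^ 3 * B)
      by (rewrite Rabs_mult; apply Rmult_le_compat; try apply Rabs_pos; assumption).
    apply Rabs_le_between in k1, k2.
    assert (hB2 : 0 < B ^ 2) by (apply pow_lt; lra). lra.
  - assert (h3 := rad3_pos t0).
    assert ((/ 1000) ^ 2 <= Bd t0 ^ 2) by (apply pow_incr; unfold Bd; lra). lra.
Qed.

(* Pohozaev's functional, completed at time [t1] by a lower bound of its increase on [t1, oo)
   which uses that [x u] is nondecreasing. *)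
Lemma pohozaev_tail t1 : rad t1 ^ 3 = 5 -> sfow a t1 ^ 3 <= 4 / 100 ->
  (sfow' a t1 - sfow a t1 / 3) * (sfow' a t1 + 2 / 3 * sfow a t1) / 2
  + 2 * (5 * sfow a t1 ^ 5 / 5 + sfow a t1 ^ 8 / 8) + 98 / 100 * 5 * sfow a t1 ^ 5 / 10 <= 0.
Proof.
  intros h5 hs3. set (h := fun t => rad t ^ 2 * sfow a t).
  assert (hh : forall t, t1 <= t -> h t1 <= h t).
  { intros t ht. apply (derive_nonneg_le' h (fun t => rad t ^ 2 * (2 / 3 * sfow a t + sfow' a t)));
      [assumption| |].
    - intros x _. assert (k1 := rad_derive x). assert (k2 := sfow_derive a x ha).
      unfold h. derive_hyps. field.
    - intros x _. assert (hb := sfow'_bounds a hg x). apply Rmult_le_pos; [apply pow2_ge_0|lra]. }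
  assert (hp1 : 0 < h t1) by (unfold h; apply Rmult_lt_0_compat; [apply pow_lt, rad_pos|now apply
    sfow_pos]).
  (* As [h = x u] is nondecreasing and [u^3 <= 8 / 1000] from [t1] on, the functional increases at a
     rate of at least [0.196 (h t1)^5 / x^2], where 0.196 is below [2 (0.1 - 0.008 / 8)]. The last
     term of [P] is the integral of this rate from [t] to infinity. *)
  set (P := fun t => rad t * ((sfow' a t - sfow a t / 3) * (sfow' a t + 2 / 3 * sfow a t) / 2
    + 2 * (rad t ^ 3 * sfow a t ^ 5 / 5 + sfow a t ^ 8 / 8)) + 98 / 1000 * h t1 ^ 5 / rad t ^ 6).
  assert (hPd : forall x, is_derive P x (2 * (rad x ^ 4 * sfow a x ^ 5 / 10 - rad x * sfow a x ^ 8 /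
    8)
    - 196 / 1000 * h t1 ^ 5 / rad x ^ 6)).
  { intros x. assert (k1 := rad_derive x). assert (k2 := sfow_derive a x ha).
    assert (k3 := sfow'_derive_ground a hg x). assert (hr := rad_pos x).
    assert (hr6 : 0 < rad x ^ 6) by now apply pow_lt.
    unfold P. generalize (h t1). intros c.
    derive_hyps. field. lra. }
  assert (hu : forall x, t1 <= x -> sfow a x ^ 3 <= 8 / 1000 * rad x ^ 3).
  { intros x hx.
    assert (hsol : sol a (sqrt 2 * rad x ^ 3) <= sol a (sqrt 2 * rad t1 ^ 3)).
    { apply sol_decr_le; [assumption|]. split; [left; apply srad_pos|].
      apply Rmult_le_compat_l; [left; apply sqrt2_pos|]. apply pow_incr.
      split; [left; apply rad_pos|now apply rad_incr]. }
    unfold sfow in *. rewrite Rpow_mult_distr in *. rewrite h5 in hs3.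
    assert (hx3 := rad3_pos x). rewrite Rmult_comm. apply Rmult_le_compat_r; [lra|].
    apply Rle_trans with (sol a (sqrt 2 * rad t1 ^ 3) ^ 3).
    - apply pow_incr. split; [left; now apply sfow_at|assumption].
    - rewrite h5. lra. }
  assert (hPm : forall t, t1 <= t -> P t1 <= P t).
  { intros t ht. eapply (derive_nonneg_le' P _ t1 t ht); [intros x _; apply hPd|].
    intros x hx. assert (hr := rad_pos x). assert (hsp := sfow_pos a hg x).
    assert (hr6 : 0 < rad x ^ 6) by now apply pow_lt.
    assert (h55 : h t1 ^ 5 <= h x ^ 5) by (apply pow_incr; split; [lra|apply hh; lra]).
    assert (hux := hu x ltac:(lra)).
    assert (hh5 : h x ^ 5 = rad x ^ 10 * sfow a x ^ 5) by (unfold h; ring).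
    assert (hs5 : 0 < rad x ^ 4 * sfow a x ^ 5) by (apply Rmult_lt_0_compat; now apply pow_lt).
    assert (k1 : h t1 ^ 5 / rad x ^ 6 <= rad x ^ 4 * sfow a x ^ 5).
    { apply Rle_div_l; [assumption|]. replace (rad x ^ 4 * sfow a x ^ 5 * rad x ^ 6) with (h x ^ 5)
        by (rewrite hh5; ring). assumption. }
    assert (k2 : rad x * sfow a x ^ 8 <= 8 / 1000 * (rad x ^ 4 * sfow a x ^ 5)).
    { replace (rad x * sfow a x ^ 8) with (rad x * sfow a x ^ 5 * sfow a x ^ 3) by ring.
      replace (8 / 1000 * (rad x ^ 4 * sfow a x ^ 5)) with (rad x * sfow a x ^ 5 * (8 / 1000 * rad x
        ^ 3)) by ring.
      apply Rmult_le_compat_l; [|assumption]. apply Rmult_le_pos; [lra|apply pow_le; lra]. }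
    unfold Rdiv in *. lra. }
  assert (hP1 : P t1 <= 0).
  { apply Rnot_lt_le. intros hpos.
    set (C := 98 / 1000 * h t1 ^ 5).
    assert (hC : 0 < C) by (unfold C; apply Rmult_lt_0_compat; [lra|now apply pow_lt]).
    destruct (rad_large (1 + (100 + C) / P t1)) as (T & hT).
    set (t := Rmax T t1). specialize (hT t (Rmax_l T t1)). specialize (hPm t (Rmax_r T t1)).
    assert (hq : 0 < (100 + C) / P t1) by (apply Rdiv_lt_0_compat; lra).
    assert (hr := rad_pos t). set (w := sfow a t). set (z := sfow' a t).
    assert (hw := sfow_pos a hg t). assert (hwb := ground_decay_4 a hg (sqrt 2 * rad t ^ 3)
      ltac:(left; apply srad_pos)).
    assert (hw3 : rad t ^ 3 * w ^ 3 <= 1).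
    { unfold w, sfow. rewrite Rpow_mult_distr, sqrt2_sq in hwb. rewrite Rpow_mult_distr.
      replace (rad t ^ 3 * (rad t ^ 3 * sol a (sqrt 2 * rad t ^ 3) ^ 3))
        with ((rad t ^ 3) ^ 2 * sol a (sqrt 2 * rad t ^ 3) ^ 3) by ring. lra. }
    assert (hrw : rad t * w <= 1).
    { apply Rnot_lt_le. intros hlt.
      replace (rad t ^ 3 * w ^ 3) with ((rad t * w) ^ 3) in hw3 by ring.
      set (y := rad t * w) in *. assert (1 < y ^ 2) by (simpl; nra). simpl in *. nra. }
    assert (hb := sfow'_bounds a hg t). fold w z in hb. fold w in hw.
    assert (hPt : P t * rad t <= 100 + C).
    { unfold P. fold w z. fold C.
      assert (c1 : rad t ^ 2 * w ^ 2 <= 1).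
      { replace (rad t ^ 2 * w ^ 2) with ((rad t * w) ^ 2) by ring. rewrite <- (pow1 2).
        apply pow_incr. split; [|lra]. apply Rmult_le_pos; lra. }
      assert (c2 : rad t ^ 2 * ((z - w / 3) * (z + 2 / 3 * w)) <= 1).
      { apply Rle_trans with 0; [|lra]. assert ((z - w / 3) * (z + 2 / 3 * w) <= 0) by nra.
        assert (0 < rad t ^ 2) by now apply pow_lt. nra. }
      assert (c3 : rad t ^ 5 * w ^ 5 <= 1).
      { replace (rad t ^ 5 * w ^ 5) with ((rad t * w) ^ 5) by ring. rewrite <- (pow1 5).
        apply pow_incr. split; [|lra]. apply Rmult_le_pos; lra. }
      assert (c4 : rad t ^ 2 * w ^ 8 <= 1).
      { replace (rad t ^ 2 * w ^ 8) with ((rad t ^ 2 * w ^ 2) * w ^ 6) by ring.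
        assert (h6 := sfow_6_le a hg t). fold w in h6. assert (0 <= w ^ 6) by (apply pow_le; lra).
        assert (0 <= rad t ^ 2 * w ^ 2) by (apply Rmult_le_pos; apply pow_le; lra). nra. }
      assert (c5 : C / rad t ^ 6 * rad t <= C).
      { replace (C / rad t ^ 6 * rad t) with (C / rad t ^ 5) by (field; lra).
        assert (1 <= rad t ^ 5) by (rewrite <- (pow1 5); apply pow_incr; lra).
        apply Rle_div_l; nra. }
      replace ((rad t * ((z - w / 3) * (z + 2 / 3 * w) / 2 + 2 * (rad t ^ 3 * w ^ 5 / 5 + w ^ 8 /
        8))
        + C / rad t ^ 6) * rad t)
      with (rad t ^ 2 * ((z - w / 3) * (z + 2 / 3 * w)) / 2 + 2 / 5 * (rad t ^ 5 * w ^ 5)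
        + rad t ^ 2 * w ^ 8 / 4 + C / rad t ^ 6 * rad t) by (field; lra).
      lra. }
    assert (hid : P t1 * ((100 + C) / P t1) = 100 + C) by (field; lra).
    assert (P t1 * rad t <= P t * rad t) by (apply Rmult_le_compat_r; lra). nra. }
  unfold P in hP1. assert (hr := rad_pos t1).
  replace (98 / 1000 * h t1 ^ 5 / rad t1 ^ 6)
    with (rad t1 * (98 / 1000 * rad t1 ^ 3 * sfow a t1 ^ 5)) in hP1 by (unfold h; field; lra).
  rewrite h5 in hP1. rewrite <- Rmult_plus_distr_l in hP1.
  apply Rmult_le_reg_l with (rad t1); [assumption|]. rewrite Rmult_0_r.
  eapply Rle_trans; [|exact hP1]. right. field.
Qed.

End Compare.

Theorem no_large_ground : exists A, 0 < A /\ forall a, A < a -> ~ global_pos a.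
Proof.
  (* At [x = 10^(-12)] both the perturbation by [u^4] and the distance from [approx] to [crit] are
     negligible. *)
  set (t0 := 3 * ln (/ 10000)).
  assert (hr0 : rad t0 = / 10000).
  { unfold rad, t0. replace (3 * ln (/ 10000) / 3) with (ln (/ 10000)) by field. apply exp_ln. lra.
    }
  destruct (near_crit_start t0 (/ 10000000)) as (A & hA & hstart); [rewrite hr0; lra|rewrite hr0;
    lra|].
  exists A. split; [assumption|]. intros a ha hg. specialize (hstart a ha hg).
  set (t1 := ln 5).
  assert (h5 : rad t1 ^ 3 = 5) by (apply rad_ln; lra).
  assert (ht : t0 <= t1).
  { apply Rnot_lt_le. intros hlt. assert (hi := rad_incr t1 t0 ltac:(lra)).
    assert (rad t1 ^ 3 <= rad t0 ^ 3) by (apply pow_incr; split; [left; apply rad_pos|assumption]).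
    rewrite hr0 in H. lra. }
  assert (hn0 : dev_norm a t0 < / 1000000).
  { destruct (approx_start t0) as [s1 s2]; [rewrite hr0; lra|]. rewrite hr0 in s1, s2.
    unfold dev_norm, dev', dev.
    set (p := crit - approx t0) in *. set (q := approx' t0) in *.
    replace (sfow a t0 - approx t0) with ((sfow a t0 - crit) + p) by (unfold p; ring).
    set (y := sfow a t0 - crit) in *. set (z := sfow' a t0) in *.
    assert (k1 := pow2_ge_0 y). assert (k2 := pow2_ge_0 z).
    assert (hy : Rabs y <= / 3000).
    { apply Rabs_le_of_sq; lra. }
    assert (hz : Rabs z <= / 3000).
    { apply Rabs_le_of_sq; lra. }
    apply Rabs_le_between in hy, hz. nra. }
  assert (hn1 := dev_norm_bound a hg t0 t1 ht ltac:(lra) hn0). rewrite h5 in hn1.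
  unfold dev_norm, dev', dev in hn1.
  assert (hk : kap t1 = 981 / 32) by (unfold kap; rewrite h5; unfold shape; field).
  assert (hc := approx_cube t1). rewrite hk in hc. assert (hap := approx_pos t1).
  assert (hS : 3194 / 10000 < approx t1 < 3196 / 10000).
  { split; apply Rnot_le_lt; intros hle.
    - assert (approx t1 ^ 3 <= (3194 / 10000) ^ 3) by (apply pow_incr; lra). lra.
    - assert ((3196 / 10000) ^ 3 <= approx t1 ^ 3) by (apply pow_incr; lra). lra. }
  assert (hS' : approx' t1 = - (495 / 981) * approx t1).
  { unfold approx'. rewrite hk, h5. unfold shape1. field. }
  rewrite hS' in hn1. set (s := approx t1) in *.
  set (w := sfow a t1) in *. set (z := sfow' a t1) in *.
  assert (hD : Rabs (w - s) <= 53 / 10000).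
  { apply Rabs_le_of_sq; [lra|].
    assert (k := pow2_ge_0 (z - - (495 / 981) * s + (w - s) / 6)). lra. }
  assert (hX : Rabs (z - - (495 / 981) * s + (w - s) / 6) <= 6 / 1000).
  { apply Rabs_le_of_sq; [lra|]. assert (k := pow2_ge_0 (w - s)). lra. }
  apply Rabs_le_between in hD, hX.
  assert (hw : 314 / 1000 <= w <= 325 / 1000) by lra.
  assert (hw3 : w ^ 3 <= (325 / 1000) ^ 3) by (apply pow_incr; lra).
  assert (hp := pohozaev_tail a hg t1 h5 ltac:(fold w; lra)). fold w z in hp.
  set (y := z + w / 6) in *.
  assert (hy : y <= - (1015 / 10000)) by (unfold y; lra).
  assert (hy2 : (1015 / 10000) ^ 2 <= y ^ 2).
  { replace (y ^ 2) with ((- y) ^ 2) by ring. apply pow_incr. lra. }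
  (* The tail inequality becomes [y^2 / 2 - w^2 / 8 + 249 / 100 w^5 + w^8 / 4 <= 0], whose left side
     is positive for the present bounds on [y] and [w]. *)
  replace ((z - w / 3) * (z + 2 / 3 * w)) with (y ^ 2 - w ^ 2 / 4) in hp by (unfold y; field).
  assert (hw8 : 0 <= w ^ 8) by (apply pow_le; lra).
  assert (hw5 : 249 / 100 * (314 / 1000) ^ 5 - (314 / 1000) ^ 2 / 8 <= 249 / 100 * w ^ 5 - w ^ 2 /
    8).
  { apply (derive_nonneg_le' (fun w => 249 / 100 * w ^ 5 - w ^ 2 / 8)
      (fun w => w * (1245 / 100 * w ^ 3 - / 4))); [lra| |].
    - intros x _. auto_derive; [trivial|]. field.
    - intros x hx. assert ((314 / 1000) ^ 3 <= x ^ 3) by (apply pow_incr; lra).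
      apply Rmult_le_pos; lra. }
  lra.
Qed.

(** * Solution curves *)

(** The curve is the union of all connected sets of Dirichlet points through [p]. *)
Lemma component_exists p : dirichlet_points p -> exists C, solution_curve C /\ C p /\
  forall S, connected S -> (forall q, S q -> dirichlet_points q) -> S p -> forall q, S q -> C q.
Proof.
  intros hp.
  set (C := fun q => exists S, connected S /\ (forall x, S x -> dirichlet_points x) /\ S p /\ S q).
  assert (hmax : forall S, connected S -> (forall q, S q -> dirichlet_points q) -> S p ->
    forall q, S q -> C q) by (intros S h1 h2 h3 q hq; now exists S).
  assert (hCp : C p).
  { apply (hmax (fun q => q = p)); try reflexivity.
    - intros U V _ _ _ (x & -> & hU) (y & -> & hV). now exists p.
    - now intros q ->. }
  exists C. split; [|split; assumption]. split; [|split].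
  - intros q (S & _ & h & _ & hq). now apply h.
  - intros U V hU hV hcov (x & hx & hxU) (y & hy & hyV).
    destruct hx as (Sx & cx & dx & px & qx). destruct hy as (Sy & cy & dy & py & qy).
    destruct (hcov p hCp) as [hpU|hpV].
    + destruct (cy U V hU hV) as (z & hz & hzU & hzV).
      * intros q hq. apply hcov. now exists Sy.
      * now exists p.
      * now exists y.
      * exists z. split; [now exists Sy|now split].
    + destruct (cx U V hU hV) as (z & hz & hzU & hzV).
      * intros q hq. apply hcov. now exists Sx.
      * now exists x.
      * now exists p.
      * exists z. split; [now exists Sx|now split].
  - intros C' h1 h2 h3 q hq. exists C'. split; [assumption|]. split; [assumption|].
    split; [now apply h3|assumption].
Qed.

(** The level of a ground state carries no Dirichlet point, so the half-planes below and above it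
    would disconnect the curve. *)
Lemma solution_curve_not_straddle a C : global_pos a -> solution_curve C ->
  ~ ((exists p, C p /\ snd p < a) /\ (exists q, C q /\ a < snd q)).
Proof.
  intros hg (hd & hc & _) [h1 h2].
  destruct (hc (fun p => snd p < a) (fun p => a < snd p)) as (p & _ & k1 & k2); try assumption.
  - apply (open_comp (snd : R * R -> R) (fun y => y < a)); [|apply open_lt].
    intros [x y] _. apply (continuous_snd x y).
  - apply (open_comp (snd : R * R -> R) (fun y => a < y)); [|apply open_gt].
    intros [x y] _. apply (continuous_snd x y).
  - intros [lam b] hp. simpl. destruct (Rtotal_order b a) as [h|[h|h]]; [now left| |now right].
    exfalso. subst b. apply (global_pos_not_dirichlet a lam hg). now apply hd.
  - lra.
Qed.

Lemma interval_connected (PU PV : R -> Prop) (a b : R) : a <= b ->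
  (forall x, a <= x <= b -> PU x \/ PV x) ->
  (forall x, a <= x <= b -> PU x -> exists d, 0 < d /\ forall y, Rabs (y - x) < d -> PU y) ->
  (forall x, a <= x <= b -> PV x -> exists d, 0 < d /\ forall y, Rabs (y - x) < d -> PV y) ->
  PU a -> PV b -> exists x, a <= x <= b /\ PU x /\ PV x.
Proof.
  intros hab hcov hU hV ha hb. apply NNPP. intros hn.
  set (E := fun x => a <= x <= b /\ PU x).
  destruct (completeness E) as [s [hub hlub]].
  { exists b. intros x [hx _]. lra. }
  { exists a. split; [lra|assumption]. }
  assert (h1 : a <= s) by (apply hub; split; [lra|assumption]).
  assert (h2 : s <= b) by (apply hlub; intros x [hx _]; lra).
  destruct (hcov s ltac:(lra)) as [h|h].
  - destruct (Req_dec s b) as [->|n]; [apply hn; exists b; repeat split; (assumption || lra)|].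
    destruct (hU s ltac:(lra) h) as (d & hd & hh).
    assert (m1 := Rmin_l b (s + d / 2)). assert (m2 := Rmin_r b (s + d / 2)).
    assert (m3 : s < Rmin b (s + d / 2)) by (apply Rmin_glb_lt; lra).
    assert (hE : E (Rmin b (s + d / 2))) by (split; [lra|apply hh, Rabs_def1; lra]).
    specialize (hub _ hE). lra.
  - destruct (hV s ltac:(lra) h) as (d & hd & hh).
    assert (hle : s <= s - d); [|lra]. apply hlub. intros x [hx hxU].
    apply Rnot_lt_le. intros hlt. assert (hxs : x <= s) by (apply hub; now split).
    apply hn. exists x. split; [lra|]. split; [assumption|]. apply hh, Rabs_def1; lra.
Qed.

(** Strict monotonicity gives opposite signs at [w - e] and [w + e]; they persist for nearby initial
    values and confine the root. *)
Lemma zero_continuous a w eps : 0 < a -> 0 < w -> sol a w = 0 -> 0 < eps ->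
  exists d, 0 < d /\ forall b v, Rabs (b - a) < d -> 0 < v -> sol b v = 0 -> Rabs (v - w) < eps.
Proof.
  intros ha hw h0 he. set (e := Rmin eps (w / 2)).
  assert (e1 : e <= eps) by apply Rmin_l. assert (e2 : e <= w / 2) by apply Rmin_r.
  assert (e3 : 0 < e) by (apply Rmin_glb_lt; lra).
  assert (h1 : 0 < sol a (w - e)) by (rewrite <- h0; apply sol_decr; [assumption|lra]).
  assert (h2 : sol a (w + e) < 0) by (rewrite <- h0; apply sol_decr; [assumption|lra]).
  destruct (sol_continuous_param a (w + e) (Rmin (sol a (w - e)) (- sol a (w + e))) ha ltac:(lra))
    as (d & hd & hh); [apply Rmin_glb_lt; lra|].
  assert (m1 := Rmin_l (sol a (w - e)) (- sol a (w + e))).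
  assert (m2 := Rmin_r (sol a (w - e)) (- sol a (w + e))).
  exists d. split; [assumption|]. intros b v hb hv hv0.
  destruct (hh b hb) as [hb0 hs].
  destruct (hs (w - e) ltac:(lra)) as [s1 _]. destruct (hs (w + e) ltac:(lra)) as [s2 _].
  apply Rabs_def2 in s1, s2.
  assert (k1 : w - e < v).
  { apply Rnot_le_lt. intros hle. assert (hd' := sol_decr_le b hb0 v (w - e) ltac:(lra)). lra. }
  assert (k2 : v < w + e).
  { apply Rnot_le_lt. intros hle. assert (hd' := sol_decr_le b hb0 (w + e) v ltac:(lra)). lra. }
  apply Rabs_def1; lra.
Qed.

Lemma zero_unique a v w : 0 < a -> 0 <= v -> 0 <= w -> sol a v = 0 -> sol a w = 0 -> v = w.
Proof.
  intros ha hv hw h1 h2. destruct (Rtotal_order v w) as [h|[h|h]]; [|assumption|].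
  - assert (hd := sol_decr a ha v w ltac:(lra)). lra.
  - assert (hd := sol_decr a ha w v ltac:(lra)). lra.
Qed.

(** The set is the graph, over a half-line of initial values, of the squared root, which is
    continuous by [zero_continuous]. *)
Lemma upper_branch_connected A : 0 < A -> (forall a, A < a -> ~ global_pos a) ->
  connected (fun p : R * R => dirichlet_points p /\ A < snd p).
Proof.
  intros hA hng.
  assert (hz : forall a, exists w, A < a -> 0 < w /\ sol a w = 0).
  { intros a. destruct (Rlt_dec A a) as [h|h]; [|exists 0; tauto].
    destruct (not_global_pos_zero a ltac:(lra) (hng a h)) as (w & hw). exists w. now intros _. }
  set (om := fun a => proj1_sig (constructive_indefinite_description _ (hz a))).
  assert (hom : forall a, A < a -> 0 < om a /\ sol a (om a) = 0).
  { intros a h. unfold om. destruct (constructive_indefinite_description _ _) as [w hw].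
    now apply hw. }
  assert (hS : forall p, (dirichlet_points p /\ A < snd p) <-> (A < snd p /\ p = (om (snd p) ^ 2,
    snd p))).
  { intros [lam a]. simpl. split.
    - intros [hd h]. split; [assumption|]. apply dirichlet_points_iff in hd.
      destruct hd as (ha & hl & h0).
      destruct (hom a h) as [w1 w2].
      assert (e := zero_unique a (sqrt lam) (om a) ha (sqrt_pos lam) ltac:(lra) h0 w2).
      rewrite <- e, Rmult_1_r, sqrt_sqrt by lra. reflexivity.
    - intros [h ->]. split; [|assumption]. destruct (hom a h) as [w1 w2].
      apply zero_dirichlet; try assumption. lra. }
  assert (hopen : forall W : R * R -> Prop, open W -> forall a, A < a -> W (om a ^ 2, a) ->
    exists d, 0 < d /\ forall b, Rabs (b - a) < d -> A < b /\ W (om b ^ 2, b)).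
  { intros W hW a ha hWa. destruct (hW _ hWa) as [e he].
    destruct (hom a ha) as [w1 w2]. assert (hep := cond_pos e).
    set (K := 2 * om a + 1).
    assert (hKe : 0 < Rmin 1 (e / K)) by (apply Rmin_glb_lt; [lra|apply Rdiv_lt_0_compat; unfold K;
      lra]).
    destruct (zero_continuous a (om a) (Rmin 1 (e / K)) ltac:(lra) w1 w2 hKe) as (d & hd & hh).
    assert (n1 := Rmin_l 1 (e / K)). assert (n2 := Rmin_r 1 (e / K)).
    set (d' := Rmin d (Rmin (a - A) e)).
    assert (m1 : d' <= d) by apply Rmin_l. assert (m2 : d' <= Rmin (a - A) e) by apply Rmin_r.
    assert (m3 := Rmin_l (a - A) e). assert (m4 := Rmin_r (a - A) e).
    exists d'. split; [repeat apply Rmin_glb_lt; lra|]. intros b hb.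
    assert (hbA : A < b) by (apply Rabs_def2 in hb; lra). split; [assumption|].
    destruct (hom b hbA) as [v1 v2]. specialize (hh b (om b) ltac:(lra) v1 v2).
    apply he. split; simpl.
    - change (Rabs (om b * (om b * 1) - om a * (om a * 1)) < e).
      replace (om b * (om b * 1) - om a * (om a * 1)) with ((om b + om a) * (om b - om a)) by ring.
      rewrite Rabs_mult. assert (h0 := Rabs_pos (om b - om a)). assert (hh' := Rabs_def2 _ _ hh).
      rewrite (Rabs_pos_eq (om b + om a)) by lra.
      apply Rle_lt_trans with (K * Rabs (om b - om a)).
      + apply Rmult_le_compat_r; [assumption|unfold K; lra].
      + apply Rlt_le_trans with (K * (e / K)); [|right; field; unfold K; lra].
        apply Rmult_lt_compat_l; [unfold K|]; lra.
    - change (Rabs (b - a) < e). lra. }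
  intros U V hU hV hcov ([lp bp] & hp & hpU) ([lq bq] & hq & hqV).
  apply hS in hp, hq. destruct hp as [pA ep], hq as [qA eq]. rewrite ep in hpU. rewrite eq in hqV.
  cbn [snd] in pA, qA, hpU, hqV.
  assert (hcov' : forall x, A < x -> U (om x ^ 2, x) \/ V (om x ^ 2, x)).
  { intros x hx. apply hcov. apply hS. now split. }
  assert (hfin : exists x, A < x /\ U (om x ^ 2, x) /\ V (om x ^ 2, x)).
  { destruct (Rle_dec bp bq) as [hle|hle].
    - destruct (interval_connected (fun x => U (om x ^ 2, x)) (fun x => V (om x ^ 2, x)) bp bq)
        as (x & hx & h1 & h2); try assumption.
      + intros x hx. apply hcov'. lra.
      + intros x hx h. destruct (hopen U hU x ltac:(lra) h) as (d & hd & hh). exists d.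
        split; [assumption|]. intros y hy. now apply hh.
      + intros x hx h. destruct (hopen V hV x ltac:(lra) h) as (d & hd & hh). exists d.
        split; [assumption|]. intros y hy. now apply hh.
      + exists x. split; [lra|now split].
    - destruct (interval_connected (fun x => V (om x ^ 2, x)) (fun x => U (om x ^ 2, x)) bq bp)
        as (x & hx & h1 & h2); try assumption.
      + lra.
      + intros x hx. destruct (hcov' x ltac:(lra)); tauto.
      + intros x hx h. destruct (hopen V hV x ltac:(lra) h) as (d & hd & hh). exists d.
        split; [assumption|]. intros y hy. now apply hh.
      + intros x hx h. destruct (hopen U hU x ltac:(lra) h) as (d & hd & hh). exists d.
        split; [assumption|]. intros y hy. now apply hh.
      + exists x. split; [lra|now split]. }
  destruct hfin as (x & hx & h1 & h2). exists (om x ^ 2, x). split; [|now split].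
  apply hS. now split.
Qed.

Lemma unique_upper_curve : exists A : R, 0 < A /\ exists C, solution_curve C /\
  forall (lam : R) (u : R -> R), positive_dirichlet_solution lam u -> A < u 0 -> C (lam, u 0).
Proof.
  destruct no_large_ground as (A & hA & hng). exists A. split; [assumption|].
  destruct (not_global_pos_zero (A + 1) ltac:(lra) (hng (A + 1) ltac:(lra))) as (w & hw & h0).
  assert (hp := zero_dirichlet (A + 1) w ltac:(lra) hw h0).
  destruct (component_exists _ hp) as (C & hC & _ & hmax). exists C. split; [assumption|].
  intros lam u hu hlt.
  apply (hmax (fun p => dirichlet_points p /\ A < snd p)).
  - now apply upper_branch_connected.
  - now intros q [h _].
  - split; [assumption|simpl; lra].
  - split; [|assumption]. exists u. now split.
Qed.

Lemma offset_functions (sg : R) : (sg = 1 \/ sg = -1) -> exists g n : R -> R,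
  (forall d, 0 < d < 1 -> 0 < g d < d /\ global_pos (2 + sg * g d)) /\
  (forall d, 0 < d < 1 -> 0 < n d < d /\ 0 < 2 + sg * n d /\ ~ global_pos (2 + sg * n d)).
Proof.
  intros hsg.
  assert (h1 : forall d, exists x, 0 < d < 1 -> 0 < x < d /\ global_pos (2 + sg * x)).
  { intros d. destruct (classic (0 < d < 1)) as [h|h]; [|exists 0; tauto].
    destruct (accumulation sg d hsg h) as [(x & hx) _]. exists x. now intros _. }
  assert (h2 : forall d, exists x, 0 < d < 1 -> 0 < x < d /\ 0 < 2 + sg * x /\ ~ global_pos (2 + sg
    * x)).
  { intros d. destruct (classic (0 < d < 1)) as [h|h]; [|exists 0; tauto].
    destruct (accumulation sg d hsg h) as [_ (x & hx)]. exists x. now intros _. }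
  exists (fun d => proj1_sig (constructive_indefinite_description _ (h1 d))),
    (fun d => proj1_sig (constructive_indefinite_description _ (h2 d))).
  split; intros d hd; destruct (constructive_indefinite_description _ _) as [x hx]; now apply hx.
Qed.

Lemma one_sided_sequences (sg : R) : (sg = 1 \/ sg = -1) -> exists x y : nat -> R,
  (forall n, 0 < x n <= (1 / 2) ^ n /\ global_pos (2 + sg * x n)) /\
  (forall n, 0 < 2 + sg * y n /\ ~ global_pos (2 + sg * y n)) /\
  (forall m n, (m < n)%nat -> x n < y (S m) < x m / 2).
Proof.
  intros hsg. destruct (offset_functions sg hsg) as (g & nd & hg & hn).
  (* Here [d n] is the current distance bound, [y n] lies below it, [x n] below [y n], and half of
     [x n] is the next bound. The halving yields both convergence to 2 and separation. *)
  set (d := fix d n := match n with O => 1 / 2 | S m => g (nd (d m)) / 2 end).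
  assert (hd : forall n, 0 < d n <= (1 / 2) ^ n /\ d n < 1).
  { induction n as [|n [IH1 IH2]]; simpl.
    - lra.
    - destruct (hn (d n) ltac:(lra)) as [hy _]. destruct (hg (nd (d n)) ltac:(lra)) as [hx _].
      change (0 < g (nd (d n)) / 2 <= 1 / 2 * (1 / 2) ^ n /\ g (nd (d n)) / 2 < 1). lra. }
  assert (hy : forall n, 0 < nd (d n) < d n) by (intros n; apply hn; destruct (hd n); lra).
  assert (hx : forall n, 0 < g (nd (d n)) < nd (d n))
    by (intros n; apply hg; destruct (hd n), (hy n); lra).
  exists (fun n => g (nd (d n))), (fun n => nd (d n)). split; [|split].
  - intros n. destruct (hd n), (hy n), (hx n). split; [lra|]. apply hg. lra.
  - intros n. apply hn. destruct (hd n). lra.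
  - intros m n hmn.
    assert (hstep : forall k, g (nd (d (S k))) < nd (d (S k)) < g (nd (d k)) / 2).
    { intros k. destruct (hx (S k)), (hy (S k)). change (d (S k)) with (g (nd (d k)) / 2) in *.
      lra. }
    assert (hle : forall k, g (nd (d (S (k + m)))) <= g (nd (d (S m)))).
    { induction k as [|k IH]; [simpl; lra|].
      destruct (hstep (S k + m)%nat). destruct (hx (S (k + m))). simpl Nat.add in *. lra. }
    specialize (hle (n - S m)%nat). replace (S (n - S m + m)) with n in hle by lia.
    destruct (hstep m). lra.
Qed.

Theorem proposition4 :
  (exists (u : nat -> R -> R) (a : nat -> R),
     (forall n, ground_state (u n) /\ a n = u n 0) /\
     (forall m n, m <> n -> a m <> a n) /\
     (forall n, exists d, 0 < d /\ forall m, m <> n -> d <= Rabs (a m - a n)) /\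
     (forall n, a n <> 2) /\
     is_lim_seq a 2 /\
     (forall N, exists n, (N <= n)%nat /\ 2 < a n) /\
     (forall N, exists n, (N <= n)%nat /\ a n < 2) /\
     (forall n C, solution_curve C ->
        ~ ((exists p, C p /\ snd p < a n) /\ (exists q, C q /\ a n < snd q))) /\
     (forall i j, adjacent a i j ->
        exists C, solution_curve C /\ curve_meets_gap C a i j) /\
     (exists C : nat -> R * R -> Prop,
        (forall k, solution_curve (C k) /\
           exists i j, adjacent a i j /\ curve_meets_gap (C k) a i j) /\
        (forall k l, k <> l -> ~ (forall p, C k p <-> C l p)))) /\
  (exists A : R, 0 < A /\
     exists C, solution_curve C /\
       forall (lam : R) (u : R -> R),
         positive_dirichlet_solution lam u -> A < u 0 -> C (lam, u 0)).
Proof.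
  split; [|exact unique_upper_curve].
  destruct (one_sided_sequences 1 (or_introl eq_refl)) as (xp & yp & hxp & hyp & hp).
  destruct (one_sided_sequences (-1) (or_intror eq_refl)) as (xm & ym & hxm & hym & hm).
  (* Interleaving puts infinitely many values on each side in one convergent sequence. *)
  set (a := fun n => if Nat.even n then 2 + xp (Nat.div2 n) else 2 - xm (Nat.div2 n)).
  assert (aeven : forall n, a (2 * n)%nat = 2 + xp n).
  { intros n. unfold a. rewrite Nat.even_mul. simpl orb. rewrite Nat.div2_double. reflexivity. }
  assert (aodd : forall n, a (2 * n + 1)%nat = 2 - xm n).
  { intros n. unfold a. rewrite Nat.even_add, Nat.even_mul. simpl.
    replace (n + (n + 0) + 1)%nat with (S (2 * n)) by lia. rewrite Nat.div2_succ_double.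
    reflexivity. }
  assert (par : forall n, (exists m, n = (2 * m)%nat) \/ exists m, n = (2 * m + 1)%nat).
  { intros n. destruct (Nat.Even_or_Odd n) as [[m hm']|[m hm']]; [left|right]; now exists m. }
  assert (xpp : forall n, 0 < xp n) by (intros n; apply hxp).
  assert (xmp : forall n, 0 < xm n) by (intros n; apply hxm).
  assert (ag : forall n, global_pos (a n)).
  { intros n. destruct (par n) as [[m ->]|[m ->]].
    - rewrite aeven. replace (xp m) with (1 * xp m) by ring. apply hxp.
    - rewrite aodd. replace (2 - xm m) with (2 + -1 * xm m) by ring. apply hxm. }
  (* The halving in the construction leaves around each value a gap of half its distance to 2. *)
  assert (hsep : forall n, exists d, 0 < d /\ forall m, m <> n -> d <= Rabs (a m - a n)).
  { assert (gen : forall (x y : nat -> R), (forall n, 0 < x n) ->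
      (forall m n, (m < n)%nat -> x n < y (S m) < x m / 2) ->
      forall m n, m <> n -> x n / 2 <= Rabs (x m - x n)).
    { intros x y hx h m n hmn. specialize (hx n) as hn. destruct (Nat.lt_ge_cases m n) as [hlt|hge].
      - specialize (h m n hlt). rewrite Rabs_pos_eq; lra.
      - specialize (h n m ltac:(lia)). rewrite Rabs_left1; lra. }
    intros n. destruct (par n) as [[n' ->]|[n' ->]].
    - exists (xp n' / 2). specialize (xpp n') as h. split; [lra|]. intros m hmn. rewrite aeven.
      destruct (par m) as [[m' ->]|[m' ->]].
      + rewrite aeven. replace (2 + xp m' - (2 + xp n')) with (xp m' - xp n') by ring.
        apply (gen xp yp); try assumption. lia.
      + rewrite aodd. specialize (xmp m'). rewrite Rabs_left1; lra.
    - exists (xm n' / 2). specialize (xmp n') as h. split; [lra|]. intros m hmn. rewrite aodd.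
      destruct (par m) as [[m' ->]|[m' ->]].
      + rewrite aeven. specialize (xpp m'). rewrite Rabs_pos_eq; lra.
      + rewrite aodd. replace (2 - xm m' - (2 - xm n')) with (- (xm m' - xm n')) by ring.
        rewrite Rabs_Ropp. apply (gen xm ym); try assumption. lia. }
  assert (hcurve : forall b, 0 < b -> ~ global_pos b ->
    exists C, solution_curve C /\ exists p, C p /\ snd p = b).
  { intros b hb hn. destruct (not_global_pos_zero b hb hn) as (w & hw & h0).
    destruct (component_exists _ (zero_dirichlet b w hb hw h0)) as (C & hC & hCp & _).
    exists C. split; [assumption|]. now exists (w ^ 2, b). }
  assert (hyp' : forall n, exists C, solution_curve C /\ exists p, C p /\ snd p = 2 + yp n).
  { intros n. replace (yp n) with (1 * yp n) by ring. apply hcurve; apply hyp. }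
  assert (hym' : forall n, exists C, solution_curve C /\ exists p, C p /\ snd p = 2 - ym n).
  { intros n. replace (2 - ym n) with (2 + -1 * ym n) by ring. apply hcurve; apply hym. }
  exists (fun n => scaled (a n) 1), a.
  split; [|split; [|split; [|split; [|split; [|split; [|split; [|split; [|split]]]]]]]].
  - intros n. split; [now apply global_pos_ground_state|].
    unfold scaled. rewrite Rmult_0_r, sol_0; [reflexivity|apply ag].
  - intros m n hmn e. destruct (hsep n) as (d & hd & h). specialize (h m hmn).
    rewrite e, Rminus_diag, Rabs_R0 in h. lra.
  - exact hsep.
  - intros n. destruct (par n) as [[m ->]|[m ->]].
    + rewrite aeven. specialize (xpp m). lra.
    + rewrite aodd. specialize (xmp m). lra.
  - apply is_lim_seq_spec. intros eps.
    assert (hgeo : is_lim_seq (fun n => (1 / 2) ^ n) 0)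
      by (apply is_lim_seq_geom; rewrite Rabs_pos_eq; lra).
    apply is_lim_seq_spec in hgeo. destruct (hgeo eps) as [M hM].
    exists (2 * M)%nat. intros n hn.
    destruct (par n) as [[m ->]|[m ->]].
    + rewrite aeven. destruct (hxp m) as [hx _]. specialize (hM m ltac:(lia)).
      rewrite Rminus_0_r in hM. assert (h := Rle_abs ((1 / 2) ^ m)).
      replace (2 + xp m - 2) with (xp m) by ring. rewrite Rabs_pos_eq; lra.
    + rewrite aodd. destruct (hxm m) as [hx _]. specialize (hM m ltac:(lia)).
      rewrite Rminus_0_r in hM. assert (h := Rle_abs ((1 / 2) ^ m)).
      replace (2 - xm m - 2) with (- xm m) by ring. rewrite Rabs_Ropp, Rabs_pos_eq; lra.
  - intros N. exists (2 * N)%nat. split; [lia|]. rewrite aeven. specialize (xpp N). lra.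
  - intros N. exists (2 * N + 1)%nat. split; [lia|]. rewrite aodd. specialize (xmp N). lra.
  - intros n C hC. now apply solution_curve_not_straddle.
  - intros i j (hij & hside & _).
    destruct (par i) as [[i' ->]|[i' ->]], (par j) as [[j' ->]|[j' ->]];
      rewrite ?aeven, ?aodd in hij, hside.
    + assert (hlt : (j' < i')%nat).
      { apply Nat.nle_gt. intros hle. destruct (Nat.eq_dec i' j') as [->|n]; [lra|].
        specialize (hp i' j' ltac:(lia)). specialize (xpp i'). lra. }
      destruct (hyp' (S j')) as (C & hC & p & hCp & e). exists C. split; [assumption|].
      exists p. split; [assumption|]. rewrite e, !aeven. specialize (hp j' i' hlt).
      specialize (xpp j'). lra.
    + specialize (xpp i'). specialize (xmp j'). lra.
    + specialize (xpp j'). specialize (xmp i'). lra.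
    + assert (hlt : (i' < j')%nat).
      { apply Nat.nle_gt. intros hle. destruct (Nat.eq_dec i' j') as [->|n]; [lra|].
        specialize (hm j' i' ltac:(lia)). specialize (xmp j'). lra. }
      destruct (hym' (S i')) as (C & hC & p & hCp & e). exists C. split; [assumption|].
      exists p. split; [assumption|]. rewrite e, !aodd. specialize (hm i' j' hlt).
      specialize (xmp i'). lra.
  (* Curve [k] passes at height [2 + yp (S k)], between the ground states [2 + xp (S k)] and
     [2 + xp k]; the former separates it from the curves with larger index. *)
  - set (C := fun k => proj1_sig (constructive_indefinite_description _ (hyp' (S k)))).
    assert (hC : forall k, solution_curve (C k) /\ exists p, C k p /\ snd p = 2 + yp (S k))
      by (intros k; apply (proj2_sig (constructive_indefinite_description _ (hyp' (S k))))).
    exists C. split.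
    + intros k. destruct (hC k) as (hsc & p & hCp & e). split; [assumption|].
      exists (2 * S k)%nat, (2 * k)%nat.
      assert (h := hp k (S k) ltac:(lia)). specialize (xpp k) as hk. specialize (xpp (S k)) as hk1.
      split; [|exists p; split; [assumption|rewrite e, !aeven; lra]].
      split; [rewrite !aeven; lra|]. split; [right; rewrite aeven; lra|].
      intros l. rewrite !aeven. destruct (par l) as [[l' ->]|[l' ->]].
      * rewrite aeven. intros hl. destruct (Nat.lt_trichotomy l' k) as [h1|[->|h1]]; [|lra|].
        -- specialize (hp l' k h1). specialize (xpp l'). lra.
        -- destruct (Nat.eq_dec l' (S k)) as [->|n]; [lra|].
           specialize (hp (S k) l' ltac:(lia)). lra.
      * rewrite aodd. specialize (xmp l'). lra.
    + assert (hlt : forall k l, (k < l)%nat -> ~ (forall p, C k p <-> C l p)).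
      { intros k l hkl heq. destruct (hC k) as (hsc & p & hCp & e).
        destruct (hC l) as (_ & q & hCq & eq).
        apply (solution_curve_not_straddle (a (2 * S k)%nat) (C k) (ag _) hsc).
        rewrite aeven. split.
        - exists q. split; [now apply heq|]. rewrite eq.
          assert (h := hp l (S l) ltac:(lia)). specialize (xpp l) as h0.
          destruct (Nat.eq_dec l (S k)) as [->|n]; [lra|].
          assert (h' := hp (S k) l ltac:(lia)). specialize (xpp (S k)). lra.
        - exists p. split; [assumption|]. rewrite e. assert (h := hp k (S k) ltac:(lia)). lra. }
      intros k l hkl. destruct (Nat.lt_ge_cases k l) as [h|h]; [now apply hlt|].
      intros heq. apply (hlt l k ltac:(lia)). intros p. now rewrite heq.
Qed.
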